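(* Let $I=(c,d)$ with $-\infty\le c<d\le\infty$. Let $v:I\to[-\infty,\infty]$ be Lebesgue measurable with $\pi(v)\in L^1_{\mathrm{loc}}([c,d))$, $\lim_{b\to d-}\int_c^b v=\infty$, and suppose $w(x):=\left[\int_c^x v\right]^{-1}\in(0,\infty)$ for all $x\in I$. Let $\mathbf{g}\in L^0(I)$. The following statements are equivalent: (i) $\mathbf{g}\in(\mathrm{Ch}_{\infty,w}(I))'_{\mathrm{w}}$; (ii) $v\mathbf{g}\in L^1(I)$, $(\frac{1}{w}\mathbf{g})\cap BPV(I)\neq\emptyset$, $\mathbf{g}\in L^\infty(I)$, and $\chi_{(b,d)}\mathbf{g}=0$ for some $b\in I$. Moreover, if $v>0$ $\mathcal{L}^1$-a.e. on $I$, then for $\mathbf{g}$ satisfying these equivalent conditions $$\|\mathbf{g}\|_{(\mathrm{Ch}_{\infty,w}(I))'_{\mathrm{w}}}\approx\|v\mathbf{g}\|_{L^1(I)}+\|\lambda_{\tilde g}\|,$$ where $\tilde g\in(\frac{1}{w}\mathbf{g})\cap BPV(I)$.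
   Context: $\mathcal{L}^1$ is Lebesgue measure on $I$; $\mathfrak{M}(I)$ is the set of all $\mathcal{L}^1$-measurable functions $f:I\to[-\infty,\infty]$; $L^0(I)$ is the set of classes of elements of $\mathfrak{M}(I)$ modulo equality $\mathcal{L}^1$-a.e.; classes are written in bold, and $\pi(f)$ denotes the class of $f\in\mathfrak{M}(I)$. Products such as $v\mathbf{g}$, $\frac1w\mathbf{g}$ are classes of products of representatives; $(\frac1w\mathbf{g})\cap BPV(I)$ is the set of representatives of the class $\frac1w\mathbf{g}$ that belong to $BPV(I)$. $L^1_{\mathrm{loc}}([c,d))$ is the set of $\mathbf{f}\in L^0(I)$ with $\|\chi_{(c,x)}\mathbf{f}\|_{L^1(I)}<\infty$ for all $x\in I$. $\mathrm{Ch}_{\infty,w}(I)$ is the set of $\mathbf{f}\in L^1_{\mathrm{loc}}([c,d))$ with $\|\mathbf{f}\|_{\mathrm{Ch}_{\infty,w}(I)}:=\operatorname{ess\,sup}_{x\in I}\left|w(x)\int_c^x f\right|<\infty$, $f\in\mathbf{f}$. For a normed space $(Z,\|\cdot\|)$ of elements of $L^0(I)$, the weak associated space is $$Z'_{\mathrm{w}}=(Z,\|\cdot\|)'_{\mathrm{w}}:=\Big\{\mathbf{g}\in L^0(I):\ \mathbf{f}\mathbf{g}\in L^1(I)\ \forall\,\mathbf{f}\in Z,\ \text{ and }\ \|\mathbf{g}\|_{Z'_{\mathrm{w}}}:=\sup_{h\in\mathbf{h}\in Z\setminus\{0\}}\frac{\left|\int_I hg\right|}{\|\mathbf{h}\|}<\infty,\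 g\in\mathbf{g}\Big\}.$$ $BPV(I)$ is the space of all functions $f:I\to\mathbb{R}$ of bounded pointwise variation, i.e. $\sup\sum_{i}|f(x_{i})-f(x_{i-1})|<\infty$ over all finite $x_0<x_1<\dots<x_n$ in $I$. For $f\in BPV(I)$, $\lambda_f$ is the unique real (finite signed) Borel measure on $I$ with $\lambda_f((a,b])=f(b+)-f(a+)$ for all $a,b\in I$, $a\le b$; $\|\lambda\|:=|\lambda|(I)$, where $|\lambda|$ is the total variation of $\lambda$. $A\approx B$ means $c_1A\le B\le c_2A$ with absolute constants $c_1,c_2>0$ (independent of $I,v,w,\mathbf{g}$). *)

(* Defs.v *)
From HB Require Import structures.
From mathcomp Require Import all_boot all_order all_algebra.
From mathcomp Require Import all_classical all_reals all_analysis.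
From mathcomp Require Import measurable_realfun ess_sup_inf.
Import Order.TTheory GRing.Theory Num.Theory.
Import numFieldNormedType.Exports.

Set Implicit Arguments.
Unset Strict Implicit.
Unset Printing Implicit Defensive.

Local Open Scope classical_set_scope.
Local Open Scope ring_scope.
Local Open Scope ereal_scope.

(* [R] itself carries the Borel sigma-algebra in the library; [leb R] is the
   same carrier with the Lebesgue (Caratheodory) one. *)
Notation leb R := (caratheodory_type (@wlength R idfun)^*%mu).
Notation lambda1 := completed_lebesgue_measure.

(* The open interval (a, b) of R, with possibly infinite endpoints. *)
Definition oo {R : realType} (a b : \bar R) : set R :=
  [set x | a < x%:E < b].

(* A class in L^0(I) is given by any representative, a function on R of which
   only the values on I matter; each predicate or quantity below depends only on
   the class. *)
Definition L0 {R : realType} (I : set R) (f : R -> \bar R) : Prop :=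
  measurable_fun (I : set (leb R)) (f : leb R -> \bar R).

Definition eq_ae {R : realType} (I : set R) (f g : R -> \bar R) : Prop :=
  \forall x \ae @lambda1 R, I x -> f x = g x.

Definition L1norm {R : realType} (I : set R) (f : R -> \bar R) : \bar R :=
  \int[@lambda1 R]_(x in I) `|f x|.

(* The library's [ess_sup] is over the whole line, whence the extension by 0. *)
Definition Linfnorm {R : realType} (I : set R) (f : R -> \bar R) : \bar R :=
  ess_sup (@lambda1 R) (abse \o (f \_ I)).

Definition L1 {R : realType} (I : set R) (f : R -> \bar R) : Prop :=
  L0 I f /\ L1norm I f < +oo.

Definition Linf {R : realType} (I : set R) (f : R -> \bar R) : Prop :=
  L0 I f /\ Linfnorm I f < +oo.

Definition L1loc {R : realType} (c d : \bar R) (f : R -> \bar R) : Prop :=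
  L0 (oo c d) f /\
  forall x : R, oo c d x -> L1norm (oo c x%:E) f < +oo.

(* x |-> the integral of f over (c, x) *)
Definition primitive {R : realType} (c : \bar R) (f : R -> \bar R)
    (x : \bar R) : \bar R :=
  \int[@lambda1 R]_(t in oo c x) f t.

Definition Ch_norm {R : realType} (c d : \bar R) (w f : R -> \bar R) : \bar R :=
  Linfnorm (oo c d) (fun x => w x * primitive c f x%:E).

Definition Ch {R : realType} (c d : \bar R) (w f : R -> \bar R) : Prop :=
  L1loc c d f /\ Ch_norm c d w f < +oo.

Definition weak_assoc_norm {R : realType} (I : set R)
    (Z : set (R -> \bar R)) (N : (R -> \bar R) -> \bar R)
    (g : R -> \bar R) : \bar R :=
  ereal_sup [set `|\int[@lambda1 R]_(x in I) (h x * g x)| / N h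
            | h in [set h | Z h /\ ~ eq_ae I h (cst 0)]].

Definition weak_assoc {R : realType} (I : set R)
    (Z : set (R -> \bar R)) (N : (R -> \bar R) -> \bar R)
    (g : R -> \bar R) : Prop :=
  [/\ L0 I g,
      forall f, Z f -> L1 I (fun x => f x * g x) &
      weak_assoc_norm I Z N g < +oo].

(* The points x_0 < ... < x_n of I are a = x_0 followed by the elements of s,
   the last of which is b. *)
Definition BPV {R : realType} (I : set R) (f : R -> R) : Prop :=
  exists M : R, forall (a b : R) (s : seq R),
    I a -> I b -> itv_partition a b s -> (variation a b f s <= M)%R.

Definition BPV_repr {R : realType} (I : set R) (u : R -> \bar R) : set (R -> R) :=
  [set f | BPV I f /\ eq_ae I (EFin \o f) u].

(* A real Borel measure on I is a charge on the Borel sets of R which does not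
   charge the complement of I. *)
Definition is_stieltjes {R : realType} (I : set R) (f : R -> R)
    (nu : {charge set (measurableTypeR R) -> \bar R}) : Prop :=
  (forall A : set (measurableTypeR R), measurable A -> nu A = nu (A `&` I)) /\
  forall a b : R, I a -> I b -> (a <= b)%R ->
    nu `]a, b]%classic =
      (lim (f x @[x --> b^'+]) - lim (f x @[x --> a^'+]))%:E.

(* For f in BPV(I) the charge exists and its values on Borel sets are unique;
   the default [czero] is for other f. *)
Definition stieltjes {R : realType} (I : set R) (f : R -> R) :
    {charge set (measurableTypeR R) -> \bar R} :=
  match pselect (exists nu, is_stieltjes I f nu) with
  | left H => sval (cid H)
  | right _ => czero
  end.

(* The library's [charge_variation] takes a Hahn decomposition; its value on
   measurable sets does not depend on which. *)
Definition total_var {R : realType}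
    (nu : {charge set (measurableTypeR R) -> \bar R}) (A : set R) : \bar R :=
  let: exist P HP := cid (Hahn_decomposition nu) in
  let: exist N nuPN := cid HP in
  charge_variation nuPN A.

(* Main.v *)
Require Import Defs.
From HB Require Import structures.
From mathcomp Require Import all_boot all_order all_algebra.
From mathcomp Require Import all_classical all_reals all_analysis.
From mathcomp Require Import measurable_realfun ess_sup_inf.
From mathcomp Require Import ring lra.
Import Order.TTheory GRing.Theory Num.Theory.
Import numFieldNormedType.Exports.

Set Implicit Arguments.
Unset Strict Implicit.
Unset Printing Implicit Defensive.

Local Open Scope classical_set_scope.
Local Open Scope ring_scope.

(** Write [V x] for the integral of [v] over [(c, x)], so that [w = 1 / V].  A
   function [f] has norm at most [1] in [Ch c d w] exactly when its primitive is
   bounded by [V] in modulus.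

   Necessity.  Although membership in [Ch] is a condition on primitives, the
   moduli of its elements are those of all locally integrable functions: given
   [h >= 0], cut [I] into countably many compact intervals and, on each of them,
   give opposite signs to halves of equal mass, often enough for the primitive
   of the signed function to stay below [V] ([exists_signs]).  Hence [h g] is
   integrable for every such [h], and gliding humps show that [g] is essentially
   bounded ([locint_dual_bounded]) and null near [d] ([locint_dual_vanish]).
   As [v] is in [Ch], [v g] is integrable.  For the bounded variation of [V g],
   test [g] on the derivative of [V P], where [|P| <= 1] is a combination of
   ramps: after integration by parts, the pairing is the integral of [v P g]
   plus a sum of increments of averages of [V g].  These sums are therefore at
   most the norm of [g] plus that of [v g] ([average_variation]), and a limit of
   the averages along an ultrafilter is a representative of bounded variation
   ([exists_bpv_repr]).

   Sufficiency.  Let [r] be the function of the right limits of a representative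
   of [V g] of bounded variation.  The integral of [f g] is a limit of sums of
   [r / V] against the increments of the primitive of [f]; Abel summation moves
   the increments to [r / V], where they are controlled by those of [r] and of
   [V].  The result is that the norm of [g] is at most the variation of [r] plus
   the norm of [v g] in [L^1] ([dual_bound]).

   Norms.  The Stieltjes charge is a difference of two finite measures with
   nondecreasing distribution functions; its mass is at least the variation of
   [r] ([bpv_by_total_var]) and at most three times that ([total_var_le]).  If
   [v > 0], testing [g] on [v] times the sign of [g] bounds the norm of [v g] by
   that of [g].  Together these give the constants [1] and [7].

   The arguments are carried out for Borel representatives and for Lebesgue
   measure on the Borel sets; [leb_borel_repr] and [integral_leb] transfer them
   to the completed measure. *)

(** * Completed Lebesgue measure and Borel representatives *)

Section almost_everywhere.
Context d (T : measurableType d) {R : realType} (m : {measure set T -> \bar R}).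
Implicit Types P Q : T -> Prop.

Lemma aeS P Q : (forall x, P x -> Q x) ->
  (\forall x \ae m, P x) -> \forall x \ae m, Q x.
Proof. by move=> PQ; apply: (@filterS _ _ (ae_filter_ringOfSetsType m)). Qed.

Lemma aeS2 P Q (S : T -> Prop) : (forall x, P x -> Q x -> S x) ->
  (\forall x \ae m, P x) -> (\forall x \ae m, Q x) -> \forall x \ae m, S x.
Proof. by move=> PQ; apply: (@filterS2 _ _ (ae_filter_ringOfSetsType m)). Qed.

End almost_everywhere.

Section completion.
Context {R : realType}.
Notation mu := (@lebesgue_measure R).
Notation lam := (@lambda1 R).
Local Open Scope ereal_scope.

Lemma borel_leb (A : set R) :
  measurable A -> measurable (A : set (leb R)).
Proof. by move=> mA; exact: sub_caratheodory. Qed.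

(** The Caratheodory sigma-algebra is the completion of the Borel one. *)
Lemma leb_borelE (A : set R) : measurable (A : set (leb R)) ->
  exists B N, [/\ measurable (B : set R), measurable (N : set R), mu N = 0,
    B `<=` A & A `<=` B `|` N].
Proof.
move=> mA.
have : (completed_algebra_gen mu).-sigma.-measurable A.
  by rewrite completed_caratheodory_measurable.
rewrite g_sigma_completed_algebra_genE => -[B mB [N' [N [mN N0 N'N]]] BA].
exists B, N; split => //.
- by rewrite -BA; exact: subsetUl.
- by rewrite -BA; exact: setUS.
Qed.

(** A set which is null for the completion is covered by a null Borel set. *)
Lemma ae_lebP (P : R -> Prop) :
  (\forall x \ae lam, P x) <-> (\forall x \ae mu, P x).
Proof.
split=> [[A [mA A0 PA]]|[A [mA A0 PA]]]; last first.
  by exists A; split => //; exact: borel_leb.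
have [B [N [mB mN N0 BA AB]]] := leb_borelE mA.
exists (B `|` N); split.
- exact: measurableU.
- apply/eqP; rewrite eq_le measure_ge0 andbT.
  apply: (le_trans (measureU2 mu mB mN)); rewrite [X in _ + X]N0 adde0 -A0.
  by apply: (@le_measure _ _ _ lam) => //; rewrite inE//; exact: borel_leb.
- exact: subset_trans AB.
Qed.

Lemma measurable_fun_leb (D : set R) (f : R -> \bar R) : measurable D ->
  measurable_fun D f -> measurable_fun (D : set (leb R)) (f : leb R -> \bar R).
Proof. by move=> mD mf _ Y mY; apply: borel_leb; exact: mf. Qed.

Lemma measurable_id_leb : measurable_fun setT (idfun : leb R -> measurableTypeR R).
Proof. by move=> _ Y mY; rewrite setTI; exact: borel_leb. Qed.

(** Lebesgue measure on the Borel sets is the image of its completion under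
   the identity map. *)
Lemma ge0_integral_leb (D : set R) (f : R -> \bar R) : measurable D ->
  measurable_fun D f -> (forall x, D x -> 0 <= f x) ->
  \int[lam]_(x in D) f x = \int[mu]_(x in D) f x.
Proof.
move=> mD mf f0.
have f0' : {in D, forall y : R, 0 <= f y} by move=> y; rewrite inE; exact: f0.
have := ge0_integral_pushforward measurable_id_leb lam mD mf f0'.
by rewrite preimage_id => <-.
Qed.

Lemma integral_leb (D : set R) (f : R -> \bar R) : measurable D ->
  measurable_fun D f -> \int[lam]_(x in D) f x = \int[mu]_(x in D) f x.
Proof.
move=> mD mf; rewrite integralE [RHS]integralE; congr (_ - _).
  by apply: ge0_integral_leb => //; exact: measurable_funepos.
by apply: ge0_integral_leb => //; exact: measurable_funeneg.
Qed.

(** Each of the countably many superlevel sets of [f] at rational heights is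
   Borel up to a null Borel set [N n]; off the union of the [N n], the
   function [f] is Borel. *)
Lemma leb_borel_repr (D : set R) (f : R -> \bar R) : measurable D ->
  L0 D f -> exists2 f' : R -> \bar R, measurable_fun setT f' &
    eq_ae D f f'.
Proof.
move=> mD mf.
pose q n : R := ratr (odflt 0%R (unpickle n : option rat)).
have mE n : measurable (D `&` [set x | (q n)%:E < f x] : set (leb R)).
  by apply: emeasurable_fun_o_infty => //; exact: borel_leb.
have /choice[B /choice[N BN]] := fun n => leb_borelE (mE n).
pose M := \bigcup_n N n.
have mM : measurable M by apply: bigcupT_measurable => n; have [] := BN n.
have M0 : mu.-negligible M.
  apply: negligible_bigcup => n; have [_ mN N0 _ _] := BN n.
  by exists (N n); split.
pose f' := fun x => if (x \in D) && (x \notin M) then f x else -oo.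
exists f'; last first.
  apply/ae_lebP; apply: negligibleS M0 => x /=; apply: contra_notP => Mx Dx.
  by rewrite /f' mem_set//= ifT//; apply/negP => /set_mem.
apply: (measurability _ (ErealGenOInfty.measurableE R)) => // _ [_ [x ->] <-].
rewrite setTI.
rewrite [X in measurable X](_ : _ = \bigcup_(n in [set n | x <= q n]%R) (B n `\` M)).
  apply: bigcup_measurable => n _; apply: measurableD => //.
  by have [] := BN n.
apply/seteqP; split => [y /=|y [n /= xn [By My]]]; rewrite in_itv/= andbT /f'.
  case: ifPn => [/andP[/set_mem Dy /negP My] xf|_]; last by rewrite ltNge leNye.
  have {}My : ~ M y by move=> ?; apply: My; exact/mem_set.
  have [n xq qf] : exists2 n, (x < q n)%R & (q n)%:E < f y.
    have [r xr rf] : exists2 r : rat, (x < ratr r)%R & (ratr r)%:E < f y.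
      case: (f y) xf => [s| |]//.
        rewrite lte_fin => /rat_in_itvoo[r]; rewrite in_itv/= => /andP[? ?].
        by exists r.
      move=> _; have /rat_in_itvoo[r] : (x < x + 1)%R by rewrite ltrDl.
      by rewrite in_itv/= => /andP[? _]; exists r => //; rewrite ltry.
    by exists (pickle r); rewrite /q pickleK.
  exists n; first exact: ltW.
  split=> //; have [_ _ _ _ /(_ y)] := BN n.
  by move=> [//|//|Ny]; exfalso; apply: My; exists n.
have [_ _ _ BE _] := BN n; have [Dy qf] := BE _ By.
rewrite mem_set//= ifT; first by rewrite (le_lt_trans _ qf)// lee_fin.
by apply/negP => /set_mem.
Qed.

End completion.

(** * Primitives of locally integrable functions *)

Section intervals.
Context {R : realType}.
Implicit Types (c d : \bar R) (x : R).

Lemma measurable_oo c d : measurable (oo c d : set (measurableTypeR R)).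
Proof.
rewrite (_ : oo c d = setT `&` (EFin @^-1` `]c, d[%classic)).
  by apply: (@EFin_measurable R setT) => //; exact: emeasurable_itv.
by rewrite setTI; apply/seteqP; split => x; rewrite /oo/= in_itv/=.
Qed.

Lemma open_oo c d : open (oo c d).
Proof.
rewrite (_ : oo c d = [set r | (c < r%:E)%E] `&` [set r | (r%:E < d)%E]).
  exact: openI (@open_ereal_gt _ _) (@open_ereal_lt _ _).
by apply/seteqP; split => x; rewrite /oo/= => /andP.
Qed.

(** With its mirror image below, this reduces statements on [I] to countably
   many compact subintervals, whether or not the end points are finite. *)
Lemma oo_exhaust_left c d x0 : oo c d x0 -> exists a : R^nat,
  [/\ a 0%N = x0, forall n, oo c d (a n), nonincreasing_seq a &
      forall x, oo c d x -> exists n, a n < x].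
Proof.
move=> /andP[]; case: c => [c| |]// => cx xd.
- rewrite lte_fin in cx; exists (fun n => c + (x0 - c) / n.+1%:R).
  have le0 n : (x0 - c) / n.+1%:R <= x0 - c.
    by rewrite ler_pdivrMr// ler_peMr ?subr_ge0 ?(ltW cx)// ler1n.
  split.
  + by rewrite divr1 addrC subrK.
  + move=> n; apply/andP; split; first by rewrite lte_fin ltrDl divr_gt0// subr_gt0.
    by apply: le_lt_trans xd; rewrite lee_fin -lerBrDl.
  + apply/nonincreasing_seqP => n; rewrite lerD2l ler_pM2l ?subr_gt0//.
    by rewrite lef_pV2 ?posrE// ler_nat.
  + move=> x /andP[]; rewrite lte_fin => cx1 _.
    exists (Num.truncn ((x0 - c) / (x - c))).
    rewrite -ltrBrDl ltr_pdivrMr// mulrC -ltr_pdivrMr ?subr_gt0//.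
    exact: truncnS_gt.
- exists (fun n => x0 - n%:R); split.
  + by rewrite subr0.
  + move=> n; apply/andP; split; first by rewrite ltNyr.
    by apply: le_lt_trans xd; rewrite lee_fin lerBlDr lerDl.
  + by apply/nonincreasing_seqP => n; rewrite lerD2l lerN2 ler_nat.
  + move=> x _; exists (Num.truncn (x0 - x)).+1.
    by rewrite ltrBlDr -ltrBlDl; exact: truncnS_gt.
Qed.

Lemma oo_exhaust_right c d x0 : oo c d x0 -> exists b : R^nat,
  [/\ b 0%N = x0, forall n, oo c d (b n), nondecreasing_seq b &
      forall x, oo c d x -> exists n, x < b n].
Proof.
have ooN x : oo c d x = oo (- d)%E (- c)%E (- x).
  by rewrite /oo/= !EFinN !lteN2 andbC.
rewrite ooN => /oo_exhaust_left[a [a0 aI ani acof]].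
exists (fun n => - a n); split => [|n|m n mn|x].
- by rewrite a0 opprK.
- by rewrite ooN opprK.
- by rewrite lerN2 ani.
- by rewrite ooN => /acof[n anx]; exists n; rewrite ltrNr.
Qed.

Lemma oo_between c d (a b : R) x : oo c d a -> oo c d b -> a <= x <= b ->
  oo c d x.
Proof.
move=> /andP[ca _] /andP[_ bd] /andP[ax xb]; apply/andP; split.
  by rewrite (lt_le_trans ca).
by rewrite (le_lt_trans _ bd)// lee_fin.
Qed.

End intervals.

Section primitives.
Context {R : realType}.
Notation mu := (@lebesgue_measure R).
Variables c d : \bar R.
Notation I := (oo c d).
Implicit Types f g h : R -> R.

(** The real-valued Borel functions among the elements of [L1loc];
   measurability on the whole line makes restrictions to subintervals
   immediate. *)
Definition locint f := measurable_fun setT f /\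
  forall x, I x -> mu.-integrable (oo c x%:E) (EFin \o f).

Definition prim f x := \int[mu]_(t in oo c x%:E) f t.

Lemma sub_oo (x : R) : I x -> oo c x%:E `<=` I.
Proof.
move=> /andP[_ xd] y /andP[cy yx]; apply/andP; split => //.
exact: lt_trans xd.
Qed.

Lemma locintD f g : locint f -> locint g -> locint (fun x => f x + g x).
Proof.
move=> [mf If] [mg Ig]; split; first exact: measurable_funD.
move=> x Ix; have mo := measurable_oo c x%:E.
apply: eq_integrable (integrableD mo (If _ Ix) (Ig _ Ix)) => //.
Qed.

Lemma locint_le f g : measurable_fun setT f -> locint g ->
  (forall x, I x -> `|f x| <= `|g x|) -> locint f.
Proof.
move=> mf [mg Ig] fg; split=> // x Ix.
apply: (le_integrable (measurable_oo _ _) _ _ (Ig _ Ix)).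
  by apply/measurable_EFinP; exact: measurable_funTS.
by move=> y /(sub_oo Ix) /fg; rewrite /= lee_fin.
Qed.

Lemma locintZ (k : R) f : locint f -> locint (fun x => k * f x).
Proof.
move=> [mf If]; split; first exact: measurable_funM.
move=> x Ix; have mo := measurable_oo c x%:E.
apply: eq_integrable (integrableZl mo k (If _ Ix)) => //.
Qed.

Lemma locint_abs f : locint f -> locint (fun x => `|f x|).
Proof.
move=> lf; apply: (locint_le _ lf); last by move=> x; rewrite normr_id.
by apply: measurableT_comp => //; case: lf.
Qed.

Lemma locint_itv f (i : interval R) b : locint f -> I b ->
  [set` i] `<=` I -> (forall x, x \in i -> x <= b) ->
  mu.-integrable [set` i] (EFin \o f).
Proof.
move=> [_ If] Ib iI ib.
have [b' [_ b'I _ /(_ _ Ib)[n bn]]] := oo_exhaust_right Ib.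
apply: integrableS (If _ (b'I n)) => //; first exact: measurable_oo.
move=> x /= xi; apply/andP; split; first by have /andP[] := iI _ xi.
by rewrite lte_fin (le_lt_trans _ bn)// ib.
Qed.

Lemma locint_co f a b : locint f -> I a -> I b ->
  mu.-integrable `[a, b[ (EFin \o f).
Proof.
move=> lf Ia Ib; apply: (locint_itv lf Ib) => x /=; rewrite in_itv/=.
  by move=> /andP[ax xb]; apply: (oo_between Ia Ib); rewrite ax ltW.
by move=> /andP[_ /ltW].
Qed.

Lemma locint_cc f a b : locint f -> I a -> I b ->
  mu.-integrable `[a, b] (EFin \o f).
Proof.
move=> lf Ia Ib; apply: (locint_itv lf Ib) => x /=; rewrite in_itv/=.
  by move=> /andP[ax xb]; apply: (oo_between Ia Ib); rewrite ax.
by move=> /andP[_].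
Qed.

Lemma prim_sub f a b : locint f -> I a -> I b -> a <= b ->
  prim f b - prim f a = \int[mu]_(t in `[a, b[) f t.
Proof.
move=> lf Ia Ib ab; rewrite /prim.
have cbE : oo c b%:E = oo c a%:E `|` `[a, b[%classic.
  apply/seteqP; split => x; rewrite /oo/= in_itv/= !lte_fin.
    by move=> /andP[-> ->]; rewrite andbT/=; case: (ltP x a); [left|right].
  move=> [/andP[-> xa]|/andP[ax xb]]; first by rewrite (lt_le_trans xa).
  by rewrite xb andbT; case/andP: Ia => ca _; rewrite (lt_le_trans ca).
rewrite cbE Rintegral_setU//=; first by rewrite addrAC subrr add0r.
- exact: measurable_oo.
- by rewrite -cbE; case: lf => _; exact.
- apply/disj_setPS => x [] /andP[_]; rewrite /= in_itv/= lte_fin => xa.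
  by rewrite leNgt xa.
Qed.

Lemma primZ (k : R) f x : locint f -> I x ->
  prim (fun t => k * f t) x = k * prim f x.
Proof.
by move=> [_ If] Ix; rewrite /prim RintegralZl//; [exact: measurable_oo|exact: If].
Qed.

Lemma prim_le_abs f x : locint f -> I x ->
  `|prim f x| <= prim (fun t => `|f t|) x.
Proof.
by move=> [_ If] Ix; rewrite /prim le_normr_Rintegral//; [exact: measurable_oo|exact: If].
Qed.

Lemma prim_abs_mono f a b : locint f -> I a -> I b -> a <= b ->
  prim (fun t => `|f t|) a <= prim (fun t => `|f t|) b.
Proof.
move=> lf Ia Ib ab; rewrite -subr_ge0 (prim_sub (locint_abs lf))//.
exact: Rintegral_ge0.
Qed.

(** Dominated convergence along a sequence decreasing to [c]. *)
Lemma prim_cvg0 f (x0 e : R) : locint f -> I x0 -> 0 < e ->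
  exists2 a, I a & forall x, I x -> x <= a -> prim (fun t => `|f t|) x < e.
Proof.
move=> lf Ix0 e0; have [a [a0 aI ania acof]] := oo_exhaust_left Ix0.
suff [n ane] : exists n, prim (fun t => `|f t|) (a n) < e.
  exists (a n) => // x Ix xan; apply: le_lt_trans ane; exact: prim_abs_mono.
pose D := oo c x0%:E; have mD : measurable D := measurable_oo _ _.
pose F n := (fun x => (`|f x|)%:E) \_ (oo c (a n)%:E).
have [mf If] := locint_abs lf.
have mfD A : measurable_fun A (fun x => (`|f x|)%:E).
  by apply/measurable_EFinP; exact: measurable_funTS.
have DE n : oo c (a n)%:E = D `&` oo c (a n)%:E.
  apply/seteqP; split=> [x|x []//] ; rewrite /D/= /oo/= => /andP[cx xa].
  rewrite cx xa/=; split => //; apply: lt_le_trans xa _.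
  by rewrite -a0 lee_fin; exact: ania.
have [] := @dominated_convergence _ _ _ mu D mD F (cst 0%E)
    (fun x => (`|f x|)%:E).
- move=> n; apply: measurable_funTS; apply/(measurable_restrictT _ (measurable_oo _ _)); exact: mfD.
- exact: measurable_cst.
- apply: aeW => x Dx; have [n an] := acof _ (sub_oo Ix0 Dx).
  apply: cvg_near_cst; exists n => // m /= nm.
  rewrite /F patchE memNset// /oo/= => /andP[_]; rewrite lte_fin.
  by rewrite ltNge (le_trans (ania _ _ nm))// ltW.
- exact: If.
- apply: aeW => x n Dx; rewrite /F patchE; case: ifPn => _.
    by rewrite abse_EFin normr_id.
  by rewrite abse0 lee_fin.
move=> _ _; rewrite integral0 => /fine_cvgP[_ /cvgrPdist_lt/(_ _ e0)].
case=> n _ /(_ n (leqnn _)) /=; rewrite sub0r normrN => ne; exists n.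
rewrite /prim /Rintegral DE integral_mkcondr.
by apply: le_lt_trans ne; exact: ler_norm.
Qed.

Lemma prim_continuous f x : locint f -> I x -> {for x, continuous (prim f)}.
Proof.
move=> lf Ix.
have [a [_ aI _ /(_ _ Ix)[n ax]]] := oo_exhaust_left Ix.
have [b [_ bI _ /(_ _ Ix)[m xb]]] := oo_exhaust_right Ix.
have := parameterized_integral_continuous (ltW (lt_trans ax xb))
  (locint_cc lf (aI n) (bI m)).
move=> /(continuous_within_itvP _ (lt_trans ax xb))[+ _ _].
move=> /(_ x); rewrite in_itv/= ax xb => /(_ isT) C.
have near_eq : \forall y \near x, prim f y =
    parameterized_integral mu (a n) y f + prim f (a n).
  have : \forall y \near x, y \in `]a n, b m[.
    by apply: near_in_itvoo; rewrite in_itv/= ax xb.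
  apply: filterS => y; rewrite in_itv/= => /andP[ay yb].
  have Iy : I y by apply: (oo_between (aI n) (bI m)); rewrite !ltW.
  apply/eqP; rewrite -subr_eq (prim_sub lf (aI n) Iy (ltW ay)).
  by rewrite Rintegral_itv_bndo_bndc//; exact: locint_co.
have /= E := nbhs_singleton near_eq.
rewrite /prop_for /continuous_at E.
apply: cvg_trans; last exact: (cvgD C (cvg_cst _)).
apply: near_eq_cvg; apply: filterS near_eq => y -> //.
Qed.

Lemma prim_within f a b : locint f -> I a -> I b ->
  {within `[a, b], continuous (prim f)}.
Proof.
move=> lf Ia Ib; apply: continuous_in_subspaceT => x; rewrite inE/= in_itv/=.
by move=> axb; apply: prim_continuous => //; exact: oo_between axb.
Qed.

End primitives.

(** * Signs that make a primitive small *)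

Section signs.
Context {R : realType}.
Notation mu := (@lebesgue_measure R).
Variables c d : \bar R.
Notation I := (oo c d).
Implicit Types f g h : R -> R.

Lemma prim_co_add f a m b : locint c d f -> I a -> I b -> a <= m -> m <= b ->
  \int[mu]_(t in `[a, b[) f t =
  \int[mu]_(t in `[a, m[) f t + \int[mu]_(t in `[m, b[) f t.
Proof.
move=> lf Ia Ib am mb.
have Im : I m by apply: (oo_between Ia Ib); rewrite am.
rewrite -!(prim_sub lf)//; last exact: le_trans mb.
by ring.
Qed.

(** Reversing signs off [S] keeps [|f|], hence every absolute integrability
   condition, but may make the primitive small. *)
Definition signed (S : set R) f x := if x \in S then f x else - f x.

Lemma normr_signed S f x : `|signed S f x| = `|f x|.
Proof. by rewrite /signed; case: ifP => // _; rewrite normrN. Qed.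

Lemma measurable_signed S f : measurable S -> measurable_fun setT f ->
  measurable_fun setT (signed S f).
Proof.
move=> mS mf.
apply: measurable_fun_ifT => //; last exact: measurableT_comp.
apply: (measurable_fun_bool true); rewrite setTI.
rewrite [X in measurable X](_ : _ = S)//.
by apply/seteqP; split => x /=; [exact: set_mem|exact: mem_set].
Qed.

Lemma locint_signed S f : measurable S -> locint c d f ->
  locint c d (signed S f).
Proof.
move=> mS lf; apply: (locint_le _ lf); last by move=> x _; rewrite normr_signed.
by apply: measurable_signed => //; case: lf.
Qed.

Lemma co_half h p q : locint c d h -> (forall x, 0 <= h x) ->
  I p -> I q -> p <= q -> exists m, [/\ p <= m, m <= q,
    \int[mu]_(t in `[p, m[) h t = (\int[mu]_(t in `[p, q[) h t) / 2 &
    \int[mu]_(t in `[m, q[) h t = (\int[mu]_(t in `[p, q[) h t) / 2].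
Proof.
move=> lh h0 Ip Iq pq.
have T0 : 0 <= \int[mu]_(t in `[p, q[) h t by exact: Rintegral_ge0.
have E := prim_sub lh Ip Iq pq.
have [||m] := @IVT _ (prim c h) p q
  (prim c h p + (\int[mu]_(t in `[p, q[) h t) / 2) pq.
- exact: prim_within lh Ip Iq.
- have pq' : prim c h p <= prim c h q by rewrite -subr_ge0 E.
  rewrite min_l// max_r// lerDl divr_ge0//= -lerBrDl E.
  by rewrite ler_pdivrMr// ler_peMr// ler1n.
rewrite in_itv/= => /andP[pm mq] mE; exists m.
have Im : I m by apply: (oo_between Ip Iq); rewrite pm.
have Em := prim_sub lh Ip Im pm.
have Ehalf : \int[mu]_(t in `[p, m[) h t = (\int[mu]_(t in `[p, q[) h t) / 2.
  by rewrite -Em mE addrAC subrr add0r.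
split => //.
have := prim_co_add lh Ip Iq pm mq; rewrite Ehalf => /eqP.
by rewrite addrC -subr_eq => /eqP <-; rewrite [X in X - _]splitr addrK.
Qed.

Lemma eq_signed_co S S' h a b :
  (forall x, a <= x < b -> (S x <-> S' x)) ->
  \int[mu]_(t in `[a, b[) signed S h t = \int[mu]_(t in `[a, b[) signed S' h t.
Proof.
move=> SS'; apply: eq_Rintegral => x; rewrite inE/= in_itv/= => /SS' E.
by rewrite /signed; congr (if _ then _ else _); apply/idP/idP => /set_mem/E/mem_set.
Qed.

(** Halving the mass of [h] and giving opposite signs to the two halves keeps
   the primitive within half of the mass; recursively halving both halves
   divides that bound by two at each stage. *)
Lemma local_signs n h p q : locint c d h -> (forall x, 0 <= h x) ->
  I p -> I q -> p <= q -> exists S, [/\ measurable S, S `<=` `[p, q[,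
    \int[mu]_(t in `[p, q[) signed S h t = 0 &
    forall x, p <= x <= q -> `|\int[mu]_(t in `[p, x[) signed S h t| <=
      (\int[mu]_(t in `[p, q[) h t) / 2 ^+ n].
Proof.
move=> lh h0; elim: n p q => [|n IH] p q Ip Iq pq;
    have [m [pm mq hpm hmq]] := co_half lh h0 Ip Iq pq;
    have Im : I m by [apply: (oo_between Ip Iq); rewrite pm].
- set T := \int[mu]_(t in `[p, q[) h t in hpm hmq *.
  have T0 : 0 <= T by exact: Rintegral_ge0.
  have mS : measurable (`[p, m[%classic : set R) by exact: measurable_itv.
  have lS := locint_signed mS lh.
  have D1 x : p <= x -> x <= m ->
      \int[mu]_(t in `[p, x[) signed `[p, m[ h t = \int[mu]_(t in `[p, x[) h t.
    move=> px xm; apply: eq_Rintegral => t; rewrite inE/= in_itv/= => /andP[pt tx].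
    by rewrite /signed mem_set//= in_itv/= pt (lt_le_trans tx).
  have D2 x : m <= x -> x <= q ->
      \int[mu]_(t in `[m, x[) signed `[p, m[ h t = - \int[mu]_(t in `[m, x[) h t.
    move=> mx xq; have Ix : I x by apply: (oo_between Im Iq); rewrite mx.
    transitivity (\int[mu]_(t in `[m, x[) (-1 * h t)).
      apply: eq_Rintegral => t; rewrite inE/= in_itv/= => /andP[mt tx].
      by rewrite /signed memNset ?mulN1r//= in_itv/= ltNge mt andbF.
    by rewrite RintegralZl ?mulN1r//; exact: locint_co lh Im Ix.
  exists `[p, m[%classic; split => //.
  + by apply: subset_itvl; rewrite bnd_simp.
  + by rewrite (prim_co_add lS Ip Iq pm mq) D1// D2// hpm hmq subrr.
  + move=> x /andP[px xq]; rewrite expr0 divr1.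
    have Ix : I x by apply: (oo_between Ip Iq); rewrite px.
    have xT : \int[mu]_(t in `[p, x[) h t <= T.
      by rewrite /T (prim_co_add lh Ip Iq px xq) lerDl; exact: Rintegral_ge0.
    have [xm|/ltW mx] := leP x m.
      by rewrite D1// ger0_norm//; exact: Rintegral_ge0.
    rewrite (prim_co_add lS Ip Ix pm mx) D1// D2// hpm.
    have m0 : 0 <= \int[mu]_(t in `[m, x[) h t by exact: Rintegral_ge0.
    have mT : \int[mu]_(t in `[m, x[) h t <= T / 2.
      by rewrite -hmq (prim_co_add lh Im Iq mx xq) lerDl; exact: Rintegral_ge0.
    rewrite ger0_norm ?subr_ge0// (@le_trans _ _ (T / 2))//.
      by rewrite lerBlDr lerDl.
    by rewrite ler_pdivrMr// ler_peMr// ler1n.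
- have [S1 [mS1 S1s S10 S1b]] := IH _ _ Ip Im pm.
  have [S2 [mS2 S2s S20 S2b]] := IH _ _ Im Iq mq.
  have mS : measurable (S1 `|` S2) by exact: measurableU.
  have lS := locint_signed mS lh.
  have D1 x : x <= m ->
      \int[mu]_(t in `[p, x[) signed (S1 `|` S2) h t =
      \int[mu]_(t in `[p, x[) signed S1 h t.
    move=> xm; apply: eq_signed_co => t /andP[pt tx]; split; last by left.
    by move=> [//|/S2s]; rewrite /= in_itv/= leNgt (lt_le_trans tx xm).
  have D2 x :
      \int[mu]_(t in `[m, x[) signed (S1 `|` S2) h t =
      \int[mu]_(t in `[m, x[) signed S2 h t.
    apply: eq_signed_co => t /andP[mt tx]; split; last by right.
    by move=> [/S1s|//]; rewrite /= in_itv/= ltNge mt andbF.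
  exists (S1 `|` S2); split => //.
  + move=> t [/S1s|/S2s]; rewrite /= !in_itv/= => /andP[t1 t2].
      by rewrite t1 (lt_le_trans t2).
    by rewrite t2 (le_trans pm).
  + by rewrite (prim_co_add lS Ip Iq pm mq) D1// D2 S10 S20 addr0.
  + move=> x /andP[px xq]; rewrite exprS invfM mulrA.
    have [xm|/ltW mx] := leP x m; first by rewrite D1// -hpm S1b// px.
    have Ix : I x by apply: (oo_between Ip Iq); rewrite px.
    by rewrite (prim_co_add lS Ip Ix pm mx) D1// D2 S10 add0r -hmq S2b// mx.
Qed.

(** The signs chosen on countably many disjoint intervals are glued. On each
   interval the signed integral is null, so that the primitive takes the same
   value at all end points; this value is null because the primitive tends to
   zero at [c]. *)
Lemma exists_signs h (U : R -> R) : locint c d h -> (forall x, 0 <= h x) ->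
  (forall p q, I p -> I q -> p <= q -> exists2 e : R, 0 < e &
     forall x, p <= x <= q -> e <= U x) ->
  exists2 S, measurable S &
    forall x, I x -> `|prim c (signed S h) x| <= U x.
Proof.
move=> lh h0 Ulb.
have [[x0 Ix0]|I0] := pselect (I !=set0); last first.
  by exists set0 => // x Ix; exfalso; apply: I0; exists x.
have [a [a0 aI ania acof]] := oo_exhaust_left Ix0.
have [b [b0 bI bndb bcof]] := oo_exhaust_right Ix0.
(* [(true, n)] labels [[a n.+1, a n[] and [(false, n)] labels [[b n, b n.+1[]. *)
pose p (k : bool * nat) := if k.1 then a k.2.+1 else b k.2.
pose q (k : bool * nat) := if k.1 then a k.2 else b k.2.+1.
have pI k : I (p k) by rewrite /p; case: ifP.
have qI k : I (q k) by rewrite /q; case: ifP.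
have pq k : p k <= q k.
  by rewrite /p /q; case: ifP => _; [exact: ania|exact: bndb].
have ab n m : a n <= b m.
  by rewrite (@le_trans _ _ x0)// -?a0 ?ania// a0 -b0 bndb.
have disj k k' x : p k <= x < q k -> p k' <= x < q k' -> k = k'.
  have disj_mono (u : R^nat) n m : nonincreasing_seq u ->
      u n.+1 <= x < u n -> u m.+1 <= x < u m -> (n <= m)%N.
    move=> ni /andP[_ xu] /andP[ux _]; rewrite leqNgt; apply/negP => mn.
    by have := lt_le_trans xu (le_trans (ni _ _ mn) ux); rewrite ltxx.
  move: k k' => [[] n] [[] m]; rewrite /p /q /=.
  - move=> H1 H2; congr (_, _); apply/eqP; rewrite eqn_leq.
    by rewrite (disj_mono a)// (disj_mono a).
  - move=> /andP[_ xa] /andP[bx _]; have := lt_le_trans xa (le_trans (ab n m) bx).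
    by rewrite ltxx.
  - move=> /andP[bx _] /andP[_ xa]; have := lt_le_trans xa (le_trans (ab m n) bx).
    by rewrite ltxx.
  - have bmono i j : b i <= x < b i.+1 -> b j <= x < b j.+1 -> (i <= j)%N.
      move=> /andP[bx _] /andP[_ xb]; rewrite leqNgt; apply/negP => ji.
      by have := lt_le_trans xb (le_trans (bndb _ _ ji) bx); rewrite ltxx.
    move=> H1 H2; congr (_, _); apply/eqP; rewrite eqn_leq.
    by rewrite (bmono _ _ H1 H2) (bmono _ _ H2 H1).
have cover x : I x -> exists k, p k <= x < q k.
  move=> Ix; have [xx0|x0x] := ltP x x0.
    have [n an] := acof _ Ix.
    have ex : exists n, a n <= x by exists n; exact: ltW.
    case: (ex_minnP ex) => -[|k] ak kmin.
      by move: ak; rewrite a0 leNgt xx0.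
    exists (true, k); rewrite /p /q/= ak/= ltNge; apply/negP => /kmin.
    by rewrite ltnn.
  have [n xb] := bcof _ Ix; have ex : exists n, x < b n by exists n.
  case: (ex_minnP ex) => -[|k] bk kmin.
    by move: bk; rewrite b0 ltNge x0x.
  exists (false, k); rewrite /p /q/= bk andbT leNgt; apply/negP => /kmin.
  by rewrite ltnn.
have loc k : exists S, [/\ measurable S, S `<=` `[p k, q k[,
    \int[mu]_(t in `[p k, q k[) signed S h t = 0 &
    forall x, p k <= x <= q k ->
      `|\int[mu]_(t in `[p k, x[) signed S h t| <= U x].
  have [e e0 eU] := Ulb _ _ (pI k) (qI k) (pq k).
  set T := \int[mu]_(t in `[p k, q k[) h t.
  have T0 : 0 <= T by exact: Rintegral_ge0.
  (* As [2 ^ n.+1] exceeds [T / e], the primitive stays below [e]. *)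
  pose n := Num.truncn (T / e).
  have [S [mS Sk S0 Sb]] := local_signs n.+1 lh h0 (pI k) (qI k) (pq k).
  exists S; split => // x xk; apply: (le_trans (Sb _ xk)).
  apply: le_trans (eU _ xk); rewrite ler_pdivrMr ?exprn_gt0// mulrC.
  rewrite -ler_pdivrMr// (le_trans (ltW (truncnS_gt _)))// -natrX ler_nat.
  exact/ltnW/ltn_expl.
have {loc}[S_ SP] := choice loc.
pose S := \bigcup_k S_ k.
have mS : measurable S.
  apply: countable_bigcupT_measurable; first exact: countableP.
  by move=> k; have [] := SP k.
have SE k x : p k <= x < q k -> (S x <-> S_ k x).
  move=> xk; split; last by exists k.
  move=> [k' _ Sx]; have [_ /(_ _ Sx) + _ _] := SP k'.
  by rewrite /= in_itv/= => /(disj _ _ _ xk) ->.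
have lS := locint_signed mS lh.
have intS k x : p k <= x <= q k -> \int[mu]_(t in `[p k, x[) signed S h t =
    \int[mu]_(t in `[p k, x[) signed (S_ k) h t.
  move=> /andP[_ xq]; apply: eq_signed_co => t /andP[pt tx].
  by apply: SE; rewrite pt (lt_le_trans tx).
have step k : prim c (signed S h) (q k) = prim c (signed S h) (p k).
  apply/eqP; rewrite -subr_eq0 (prim_sub lS (pI k) (qI k) (pq k)).
  by rewrite intS ?pq ?lexx//; have [_ _ -> _] := SP k.
have Fa n : prim c (signed S h) (a n) = prim c (signed S h) x0.
  by elim: n => [|n <-]; [rewrite a0|rewrite (step (true, n))].
have Fb n : prim c (signed S h) (b n) = prim c (signed S h) x0.
  by elim: n => [|n <-]; [rewrite b0|rewrite -(step (false, n))].
have F0 : prim c (signed S h) x0 = 0.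
  apply/eqP; rewrite -normr_le0; apply/ler_addgt0Pr => e e0; rewrite add0r.
  have [a' Ia' a'e] := prim_cvg0 lS Ix0 e0.
  have [n an] := acof _ Ia'.
  rewrite -(Fa n); apply: (le_trans (prim_le_abs lS (aI n))).
  exact/ltW/a'e/ltW.
exists S => // x Ix; have [k xk] := cover _ Ix; have [/= px xq] := andP xk.
have Fp : prim c (signed S h) (p k) = 0.
  by rewrite /p; case: ifP; rewrite ?Fa ?Fb.
rewrite -[prim _ _ _]subr0 -Fp (prim_sub lS)// intS ?px ?(ltW xq)//.
by have [_ _ _] := SP k; apply; rewrite px ltW.
Qed.

End signs.

(** * Functions that are integrable against all locally integrable functions *)

Section humps.
Context {R : realType}.
Notation mu := (@lebesgue_measure R).
Variables c d : \bar R.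
Notation I := (oo c d).
Local Open Scope ereal_scope.

(** Supplies humps of finite mass, which can then be normalized. *)
Lemma positive_bounded_part (A : set (measurableTypeR R)) : measurable A -> 0 < mu A ->
  exists k : R, 0 < mu (A `&` `[(- k)%R, k]) /\ mu (A `&` `[(- k)%R, k]) < +oo.
Proof.
move=> mA A0; have mAk k : measurable (A `&` `[(- k)%R, k]%classic).
  by apply: measurableI => //; exact: measurable_itv.
have fin k : mu (A `&` `[(- k)%R, k]) < +oo.
  have mk : measurable (`[(- k)%R, k]%classic : set (measurableTypeR R)).
    exact: measurable_itv.
  apply: (@le_lt_trans _ _ (mu `[(- k)%R, k]%classic)).
    by apply: le_measure; rewrite ?inE//; exact: subIsetr.
  by rewrite lebesgue_measure_itv/=; case: ifP; rewrite ltry.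
apply: contrapT => /forallNP H.
have N n : mu.-negligible (A `&` `[(- n%:R)%R, n%:R]%classic).
  exists (A `&` `[(- n%:R)%R, n%:R]%classic); split => //.
  apply: contrapT => /eqP H0; apply: (H n%:R); split => //.
  by rewrite lt0e H0 measure_ge0.
have [B [mB B0 AB]] := negligible_bigcup N.
have : mu A <= mu B.
  apply: le_measure; rewrite ?inE// => x Ax; apply: AB.
  exists (Num.truncn `|x|%R).+1 => //; split => //=.
  by rewrite in_itv/= -ler_norml ltW// truncnS_gt.
by rewrite B0 leNgt A0.
Qed.

Variable g : R -> \bar R.
Hypothesis mg : measurable_fun setT g.
Hypothesis gint : forall h, locint c d h -> (forall x, (0 <= h x)%R) ->
  \int[mu]_(x in I) ((h x)%:E * `|g x|) < +oo.

(** Gliding hump: the superposition of the [t n] times the indicators of the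
   [E n] would be locally integrable, but not integrable against [g]. *)
Lemma no_humps (E : nat -> set (measurableTypeR R)) (t delta : nat -> R) :
  I !=set0 ->
  (forall n, measurable (E n)) -> (forall n, E n `<=` I) ->
  (forall n, 0 <= t n)%R -> (forall n, 0 <= delta n)%R ->
  (forall n x, E n x -> (delta n)%:E <= `|g x|) ->
  (forall x, I x -> \sum_(0 <= n <oo) ((t n)%:E * mu (E n `&` oo c x%:E)) < +oo) ->
  ~ (forall n, (n%:R)%:E <= (t n * delta n)%:E * mu (E n)).
Proof.
move=> [x0 Ix0] mE EI t0 d0 Eg sumE big.
pose u n x : \bar R := (t n * \1_(E n) x)%:E.
have u0 n x : 0 <= u n x by rewrite lee_fin mulr_ge0.
have mu_ n : measurable_fun setT (u n).
  by apply/measurable_EFinP; apply: measurable_funM => //; exact: measurable_indic.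
pose H x := \sum_(0 <= n <oo) u n x.
have H0 x : 0 <= H x by apply: nneseries_ge0.
have mH : measurable_fun setT H.
  by apply: ge0_emeasurable_sum.
pose h x := fine (H x).
have h0 x : (0 <= h x)%R by exact: fine_ge0.
have mh : measurable_fun setT h by exact: measurableT_comp.
have intu n (D : set (measurableTypeR R)) : measurable D ->
    \int[mu]_(x in D) u n x = (t n)%:E * mu (E n `&` D).
  move=> mD; under eq_integral do rewrite /u EFinM.
  rewrite ge0_integralZl ?lee_fin//; first by rewrite integral_indic.
  by apply/measurable_EFinP; exact: measurable_indic.
have IH x : I x -> mu.-integrable (oo c x%:E) H.
  move=> Ix; have mo := measurable_oo c x%:E.
  apply/integrableP; split; first exact: measurable_funTS.
  under eq_integral do rewrite gee0_abs//.
  rewrite integral_nneseries//; last by move=> ?; exact: measurable_funTS.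
  under eq_eseriesr do rewrite intu//.
  exact: sumE.
have lh : locint c d h.
  split => // x Ix; apply: le_integrable (IH _ Ix); first exact: measurable_oo.
    by apply/measurable_EFinP; exact: measurable_funTS.
  move=> y _; rewrite /= ger0_norm// gee0_abs// /h.
  by case: (H y) (H0 y) => //= _; rewrite ?leey.
have Hfin : \forall x \ae mu, I x -> (h x)%:E = H x.
  have [b [_ bI _ bcof]] := oo_exhaust_right Ix0.
  have : \forall x \ae mu, forall n, oo c (b n)%:E x -> H x \is a fin_num.
    apply: ae_foralln => n; apply: integrable_ae (IH _ (bI n)).
    exact: measurable_oo.
  apply: aeS => x Hx Ix; have [n xn] := bcof _ Ix.
  rewrite /h fineK//; apply: (Hx n); apply/andP; split => //.
  by case/andP: Ix.
have mI : measurable (I : set (measurableTypeR R)) := measurable_oo c d.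
have mag : measurable_fun setT (fun x => `|g x|) by exact: measurableT_comp.
have lower n : (n%:R)%:E <= \int[mu]_(x in I) ((h x)%:E * `|g x|).
  rewrite (_ : integral _ _ _ = \int[mu]_(x in I) (H x * `|g x|)); last first.
    apply: ae_eq_integral => //.
    - apply: measurable_funTS; apply: emeasurable_funM => //.
      exact/measurable_EFinP.
    - by apply: measurable_funTS; exact: emeasurable_funM.
    - by apply: aeS Hfin => x Hx Ix; rewrite Hx.
  apply: (le_trans (big n)); rewrite mulrC EFinM -muleA.
  rewrite -[X in _ * (_ * mu X)](setIidl (EI n)) -intu//.
  rewrite -ge0_integralZl ?lee_fin//; last exact: measurable_funTS.
  apply: ge0_le_integral => //.
  - by move=> x _; rewrite mule_ge0// lee_fin.
  - apply: measurable_funTS; apply: emeasurable_funM => //.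
  - by apply: measurable_funTS; exact: emeasurable_funM.
  - move=> x _; rewrite muleC; have uH : u n x <= H x.
      apply: le_trans (nneseries_lim_ge n.+1 _) => //.
      by rewrite big_nat_recr//= leeDr// sume_ge0.
    have [Ex|Ex] := pselect (E n x).
      by apply: lee_pmul => //; [rewrite lee_fin|exact: Eg].
    by rewrite /u indicE memNset// mulr0 mul0e mule_ge0.
have := gint lh h0; set X := integral _ _ _ in lower * => Xoo.
have Xfin : X \is a fin_num by rewrite ge0_fin_numE//; exact: (lower 0%N).
have := lower (Num.truncn (fine X)).+1; rewrite -(fineK Xfin) lee_fin.
by rewrite leNgt truncnS_gt.
Qed.

(** If [g] were unbounded, take the [n]-th hump of mass [2 ^- n.+1] where
   [|g|] exceeds [4 ^ n.+1]: the superposition is integrable, and the [n]-th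
   hump integrates to at least [2 ^ n.+1] against [|g|]. *)
Lemma locint_dual_bounded : exists2 M : R, (0 <= M)%R &
  \forall x \ae mu, I x -> `|g x| <= M%:E.
Proof.
have [[x0 Ix0]|I0] := pselect (I !=set0); last first.
  by exists 0%R => //; apply: aeW => x Ix; exfalso; apply: I0; exists x.
apply: contrapT => nb.
pose A n : set (measurableTypeR R) := I `&` [set x | (4 ^+ n.+1)%:E < `|g x|].
have mI : measurable (I : set (measurableTypeR R)) := measurable_oo c d.
have mA n : measurable (A n).
  apply: emeasurable_fun_o_infty => //; apply: measurable_funTS.
  exact: measurableT_comp.
have A0 n : 0 < mu (A n).
  rewrite lt0e measure_ge0 andbT; apply/eqP => An0; apply: nb.
  exists (4 ^+ n.+1)%R; first exact: exprn_ge0.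
  exists (A n); split => // x /=; apply: contra_notP => nA Ix.
  by rewrite leNgt; apply/negP => gx; apply: nA; split.
have /choice[k kP] := fun n => positive_bounded_part (mA n) (A0 n).
pose E n := A n `&` `[(- k n)%R, k n]%classic.
have mE n : measurable (E n).
  by apply: measurableI => //; exact: measurable_itv.
pose m n := fine (mu (E n)).
have mEE n : mu (E n) = (m n)%:E.
  by rewrite /m fineK// ge0_fin_numE//; case: (kP n).
have m0 n : (0 < m n)%R by rewrite -lte_fin -mEE; case: (kP n).
pose t n := ((2 ^ n.+1)%:R^-1 / m n)%R.
have t0 n : (0 <= t n)%R by rewrite divr_ge0// ltW.
have EI n : E n `<=` I by move=> x [[]].
apply: (no_humps (E := E) (t := t) (delta := fun n => 4 ^+ n.+1)%R) => //.
- by exists x0.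
- by move=> n x [[_ /ltW]].
- move=> x Ix; apply: (@le_lt_trans _ _ (\sum_(0 <= n <oo) (0 + (1 / (2 ^ n.+1)%:R)%:E))).
    apply: lee_nneseries => [n _|n _].
      by rewrite mule_ge0// lee_fin.
    rewrite add0e div1r; apply: (@le_trans _ _ ((t n)%:E * mu (E n))).
      rewrite lee_wpmul2l ?lee_fin//; apply: le_measure; rewrite ?inE//.
      by apply: measurableI => //; exact: measurable_oo.
    by rewrite mEE -EFinM lee_fin /t divfK ?gt_eqF.
  apply: le_lt_trans (epsilon_trick _ _ _) _ => //.
  by rewrite eseries0 ?add0e ?ltry.
- move=> n; rewrite mEE -EFinM lee_fin /t mulrAC divfK ?gt_eqF//.
  rewrite mulrC ler_pdivlMr// -natrX -natrM ler_nat.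
  by rewrite (_ : 4 = 2 * 2)%N// expnMn leq_mul2r ltnW ?orbT// ltnW// ltn_expl.
Qed.

(** Humps of arbitrary mass are allowed to the right of [b n]: as [b n] tends
   to [d], only finitely many of them meet a given [(c, x)], so that their
   superposition is locally integrable. *)
Lemma locint_dual_vanish : I !=set0 -> exists2 b, I b &
  \forall x \ae mu, oo b%:E d x -> g x = 0.
Proof.
move=> [x0 Ix0]; apply: contrapT => nb.
have [b [_ bI bnd bcof]] := oo_exhaust_right Ix0.
have mI : measurable (I : set (measurableTypeR R)) := measurable_oo c d.
pose A n j : set (measurableTypeR R) :=
  oo (b n)%:E d `&` [set x | (j.+1%:R^-1)%:E < `|g x|].
have mA n j : measurable (A n j).
  apply: emeasurable_fun_o_infty; first exact: measurable_oo.
  by apply: measurable_funTS; exact: measurableT_comp.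
have A0 n : exists j, 0 < mu (A n j).
  apply: contrapT => /forallNP H; apply: nb; exists (b n) => //.
  have N j : mu.-negligible (A n j).
    exists (A n j); split => //; apply/eqP; rewrite eq_le measure_ge0 andbT.
    by rewrite leNgt; apply/negP; exact: H.
  apply: negligibleS (negligible_bigcup N) => x /=; apply: contra_notP => nA bx.
  apply/eqP; rewrite -abse_eq0 eq_le abse_ge0 andbT leNgt; apply/negP => gx.
  apply: nA; have [j jg] : exists j, (j.+1%:R^-1)%:E < `|g x|.
    move: gx; case: `|g x| => [r| |]//.
      rewrite lte_fin => r0; exists (Num.truncn r^-1).
      by rewrite lte_fin invf_plt ?posrE// truncnS_gt.
    by exists 0%N; rewrite ltry.
  by exists j.
have {A0}/choice[j jP] := A0.
have /choice[k kP] := fun n => positive_bounded_part (mA n (j n)) (jP n).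
pose E n := A n (j n) `&` `[(- k n)%R, k n]%classic.
have mE n : measurable (E n).
  by apply: measurableI => //; exact: measurable_itv.
pose m n := fine (mu (E n)).
have mEE n : mu (E n) = (m n)%:E.
  by rewrite /m fineK// ge0_fin_numE//; case: (kP n).
have m0 n : (0 < m n)%R by rewrite -lte_fin -mEE; case: (kP n).
pose t n := (n%:R * (j n).+1%:R / m n)%R.
have t0 n : (0 <= t n)%R by rewrite divr_ge0// ltW.
have EI n : E n `<=` I.
  move=> x [[/andP[bx xd] _] _]; apply/andP; split => //.
  by apply: lt_trans bx; case/andP : (bI n).
apply: (no_humps (E := E) (t := t) (delta := fun n => (j n).+1%:R^-1)%R) => //.
- by exists x0.
- by move=> n x [[_ /ltW]].
- move=> x Ix; have [N xN] := bcof _ Ix.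
  have z n : (N <= n)%N -> (t n)%:E * mu (E n `&` oo c x%:E) = 0.
    move=> Nn; rewrite [X in mu X](_ : _ = set0) ?measure0 ?mule0//.
    apply/seteqP; split => // y [[[/andP[by_ _] _] _] /andP[_ yx]].
    have := lt_trans by_ yx; rewrite lte_fin ltNge => /negP; apply.
    by rewrite (le_trans (ltW xN))// bnd.
  rewrite (nneseries_split 0 N); last by move=> n _; rewrite mule_ge0// lee_fin.
  rewrite eseries0 ?adde0; last by move=> n; rewrite add0n => Nn _; exact: z.
  apply: lte_sum_pinfty => n _; apply: (@le_lt_trans _ _ ((t n)%:E * mu (E n))).
    rewrite lee_wpmul2l ?lee_fin//; apply: le_measure; rewrite ?inE//.
    by apply: measurableI => //; exact: measurable_oo.
  by rewrite mEE -EFinM ltry.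
- move=> n; rewrite mEE -EFinM lee_fin /t mulrAC divfK ?gt_eqF//.
  by rewrite mulfK.
Qed.

End humps.

(** * Integration by parts *)

Section sums_of_integrals.
Context d (T : measurableType d) {R : realType} (m : {measure set T -> \bar R}).
Variables (D : set T) (F : nat -> T -> R).
Hypotheses (mD : measurable D) (IF : forall i, m.-integrable D (EFin \o F i)).

Lemma Rintegrable_lin (f g : T -> R) (a b : R) : m.-integrable D (EFin \o f) ->
  m.-integrable D (EFin \o g) ->
  m.-integrable D (EFin \o (fun x => a * f x + b * g x)).
Proof.
move=> If Ig; apply: eq_integrable
  (integrableD mD (integrableZl mD a If) (integrableZl mD b Ig)) => //.
Qed.

Lemma RintegrableB (f g : T -> R) : m.-integrable D (EFin \o f) ->
  m.-integrable D (EFin \o g) ->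
  m.-integrable D (EFin \o (fun x => f x - g x)).
Proof.
move=> If Ig; apply: eq_integrable (integrableB mD If Ig) => //.
Qed.

Lemma RintegrableZl (f : T -> R) (a : R) : m.-integrable D (EFin \o f) ->
  m.-integrable D (EFin \o (fun x => a * f x)).
Proof.
move=> If; apply: eq_integrable (integrableZl mD a If) => //.
Qed.

Lemma Rintegrable_sum n :
  m.-integrable D (EFin \o (fun x => \sum_(i < n) F i x)).
Proof.
elim: n => [|n IH].
  apply: eq_integrable (integrable0 m D) => // x _.
  by rewrite /= big_ord0.
apply: eq_integrable (integrableD mD IH (IF n)) => // x _.
by rewrite /= big_ord_recr.
Qed.

Lemma Rintegral_sum n : \int[m]_(x in D) (\sum_(i < n) F i x) =
  \sum_(i < n) \int[m]_(x in D) F i x.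
Proof.
elim: n => [|n IH].
  rewrite big_ord0; under eq_Rintegral do rewrite big_ord0.
  by rewrite /Rintegral integral0.
rewrite big_ord_recr/= -IH -RintegralD//; last exact: Rintegrable_sum.
by apply: eq_Rintegral => x _; rewrite big_ord_recr.
Qed.

End sums_of_integrals.

Section by_parts.
Context {R : realType}.
Notation mu := (@lebesgue_measure R).

(** Summing the bound over [n.+1] equal steps gains a factor [n.+1^-1]. *)
Lemma increments_const (Q A : R -> R) (a b K : R) : a <= b ->
  (forall x y, a <= x -> x <= y -> y <= b ->
     `|Q y - Q x| <= K * (y - x) * (A y - A x)) -> Q b = Q a.
Proof.
move=> ab QA; apply/eqP; rewrite -subr_eq0 -normr_le0.
set B := K * (b - a) * (A b - A a).
suff small n : `|Q b - Q a| <= B / n.+1%:R.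
  have Bge0 : 0 <= B by have := QA _ _ (lexx a) ab (lexx b); exact: le_trans.
  apply/ler_addgt0Pr => e e0; rewrite add0r.
  apply: (le_trans (small (Num.truncn (B / e)))).
  rewrite ler_pdivrMr// mulrC -ler_pdivrMr//; exact/ltW/truncnS_gt.
pose t i := a + (b - a) * i%:R / n.+1%:R.
have t0 : t 0%N = a by rewrite /t mulr0 mul0r addr0.
have tn : t n.+1 = b by rewrite /t mulfK ?pnatr_eq0// addrC subrK.
have tS i : t i.+1 - t i = (b - a) / n.+1%:R.
  rewrite /t -(natr1 i); field; by rewrite nat1r pnatr_eq0.
have tmono i j : (i <= j)%N -> t i <= t j.
  move=> ij; rewrite lerD2l ler_pM2r ?invr_gt0//.
  by rewrite ler_wpM2l ?subr_ge0// ler_nat.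
have -> : Q b - Q a = \sum_(i < n.+1) (Q (t i.+1) - Q (t i)).
  by rewrite -(big_mkord xpredT (fun i => Q (t i.+1) - Q (t i))) telescope_sumr// tn t0.
have -> : B / n.+1%:R = \sum_(i < n.+1) (K * ((b - a) / n.+1%:R) * (A (t i.+1) - A (t i))).
  rewrite -mulr_sumr -(big_mkord xpredT (fun i => A (t i.+1) - A (t i))).
  by rewrite telescope_sumr// tn t0 /B; field; by rewrite nat1r pnatr_eq0.
apply: (le_trans (ler_norm_sum _ _ _)); apply: ler_sum => i _.
rewrite -(tS i); apply: QA.
- by rewrite -{1}t0; exact: tmono.
- exact: tmono.
- by rewrite -tn; apply: tmono; exact: ltn_ord.
Qed.

Lemma integrable_co_cst (k a b : R) : mu.-integrable `[a, b[ (EFin \o cst k).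
Proof.
have mi : measurable (`[a, b[%classic : set (measurableTypeR R)).
  exact: measurable_itv.
apply/integrableP; split; first by apply/measurable_EFinP; exact: measurable_cst.
rewrite [ltLHS](integral_cst mu mi `|k|%:E) /= lebesgue_measure_itv/=; case: ifP => _.
  by rewrite -EFinB -EFinM ltry.
by rewrite mule0 ltry.
Qed.

Lemma Rintegral_co_cst (k a b : R) : a <= b ->
  \int[mu]_(t in `[a, b[) k = k * (b - a).
Proof.
move=> ab; rewrite Rintegral_cst//.
congr (_ * _); rewrite /= lebesgue_measure_itv/=; case: ifPn; first by rewrite -EFinB.
by rewrite lte_fin -leNgt => ba; rewrite (le_anti (_ : a <= b <= a)) ?subrr ?ab.
Qed.

Lemma Rintegral_co_le (f : R -> R) (C a b : R) : a <= b ->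
  mu.-integrable `[a, b[ (EFin \o f) -> (forall x, `|f x| <= C) ->
  \int[mu]_(t in `[a, b[) `|f t| <= C * (b - a).
Proof.
move=> ab If fC; rewrite -Rintegral_co_cst//.
apply: le_Rintegral => //; last exact: integrable_co_cst.
by apply: eq_integrable (integrable_abse If).
Qed.

Variables c d : \bar R.
Notation I := (oo c d).
Implicit Types v f g psi : R -> R.

Lemma normr_prim_sub v x y : locint c d v -> I x -> I y -> x <= y ->
  `|prim c v y - prim c v x| <= \int[mu]_(t in `[x, y[) `|v t|.
Proof.
move=> lv Ix Iy xy; rewrite (prim_sub lv)//; apply: le_normr_Rintegral => //.
exact: locint_co lv Ix Iy.
Qed.

Lemma measurable_prim v : locint c d v ->
  measurable_fun (I : set (measurableTypeR R)) (prim c v).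
Proof.
move=> lv; apply: open_continuous_measurable_fun.
  exact: open_oo.
by move=> x; rewrite inE => Ix; exact: prim_continuous lv Ix.
Qed.

(** The almost everywhere derivative of the product of the two primitives, cut
   off outside [I], where the primitives carry no information. *)
Definition product_density v psi :=
  (fun x => v x * prim c psi x + prim c v x * psi x) \_ I.

Lemma prim_le v x y : locint c d v -> I x -> I y -> x <= y ->
  `|prim c v x| <= prim c (fun t => `|v t|) y.
Proof.
move=> lv Ix Iy xy; apply: (le_trans (prim_le_abs lv Ix)).
exact: (prim_abs_mono lv).
Qed.

Lemma locint_product_density v psi : locint c d v -> locint c d psi ->
  locint c d (product_density v psi).
Proof.
move=> lv lpsi; have [mv Iv] := lv; have [mpsi Ipsi] := lpsi.
have mI : measurable (I : set (measurableTypeR R)) := measurable_oo c d.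
split.
  apply/(measurable_restrictT _ mI)/measurable_funD; apply: measurable_funM;
    by [exact: measurable_funTS | exact: measurable_prim].
move=> x Ix; have mo := measurable_oo c x%:E.
pose A := prim c (fun t => `|v t|) x; pose B := prim c (fun t => `|psi t|) x.
have lb : locint c d (fun t => B * `|v t| + A * `|psi t|).
  by apply: locintD; apply: locintZ; exact: locint_abs.
apply: (le_integrable mo _ _ (lb.2 _ Ix)).
  apply/measurable_EFinP/measurable_funTS/(measurable_restrictT _ mI).
  apply/measurable_funD; apply: measurable_funM;
    by [exact: measurable_funTS | exact: measurable_prim].
move=> y /[dup] cyx /(sub_oo Ix) Iy; rewrite lee_fin.
have yx : y <= x by move: cyx => /andP[_]; rewrite lte_fin => /ltW.
rewrite /product_density patchE mem_set//.
apply: le_trans (ler_norm _); apply: (le_trans (ler_normD _ _)).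
rewrite !normrM mulrC; apply: lerD; apply: ler_wpM2r => //.
  exact: (prim_le lpsi Iy Ix yx).
exact: (prim_le lv Iy Ix yx).
Qed.

(** Integration by parts. The defect of the product rule over [[x, y[] is at
   most [2 C (y - x)] times the integral of [|v|] there, which is negligible
   after subdivision. *)
Lemma prim_product v psi (C : R) x : locint c d v -> locint c d psi ->
  (forall x, `|psi x| <= C) -> I x ->
  prim c (product_density v psi) x = prim c v x * prim c psi x.
Proof.
move=> lv lpsi psiC Ix.
have lf := locint_product_density lv lpsi.
pose f := product_density v psi; rewrite -/f in lf *.
pose V := prim c v; pose P := prim c psi.
pose Q y := prim c f y - V y * P y.
pose A := prim c (fun t => `|v t|).
have C0 : 0 <= C by exact: le_trans (psiC x).
have QA y z : I y -> I z -> y <= z ->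
    `|Q z - Q y| <= (2 * C) * (z - y) * (A z - A y).
  move=> Iy Iz yz.
  have Vyt t : y <= t -> t <= z -> `|V t - V y| <= A z - A y.
    move=> yt tz; have It : I t by apply: (oo_between Iy Iz); rewrite yt.
    apply: (le_trans (normr_prim_sub lv Iy It yt)).
    by rewrite -(prim_sub (locint_abs lv))// lerD2r (prim_abs_mono lv).
  have Pzt t : y <= t -> t <= z -> `|P z - P t| <= C * (z - y).
    move=> yt tz; have It : I t by apply: (oo_between Iy Iz); rewrite yt.
    apply: (le_trans (normr_prim_sub lpsi It Iz tz)).
    apply: (le_trans (Rintegral_co_le tz (locint_co lpsi It Iz) psiC)).
    by rewrite ler_wpM2l// lerD2l lerN2.
  have Ac : A z - A y = \int[mu]_(t in `[y, z[) `|v t| by rewrite (prim_sub (locint_abs lv)).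
  have mi : measurable (`[y, z[%classic : set (measurableTypeR R)) by exact: measurable_itv.
  have Iint t : t \in `[y, z[ -> I t.
    by rewrite in_itv/= => /andP[yt tz]; apply: (oo_between Iy Iz); rewrite yt ltW.
  have iv := locint_co lv Iy Iz; have ipsi := locint_co lpsi Iy Iz.
  have iF := locint_co lf Iy Iz.
  have -> : Q z - Q y = \int[mu]_(t in `[y, z[)
      (f t - (P z * v t + V y * psi t)).
    rewrite RintegralB//; last first.
      exact: Rintegrable_lin.
    rewrite RintegralD//; [|exact: RintegrableZl|exact: RintegrableZl].
    rewrite !RintegralZl// -(prim_sub lf)// -(prim_sub lv)// -(prim_sub lpsi)//.
    by rewrite /Q /V /P; ring.
  have iD : mu.-integrable `[y, z[ (EFin \o (fun t => f t - (P z * v t + V y * psi t))).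
    by apply: RintegrableB => //; exact: Rintegrable_lin.
  apply: (le_trans (le_normr_Rintegral mi iD)).
  have iB : mu.-integrable `[y, z[ (EFin \o (fun t => C * (z - y) * `|v t| + C * (A z - A y))).
    apply: eq_integrable (Rintegrable_lin mi (C * (z - y)) 1
      (locint_co (locint_abs lv) Iy Iz) (integrable_co_cst _ _ _)) => //.
    by move=> t _ /=; rewrite mul1r.
  apply: (@le_trans _ _ (\int[mu]_(t in `[y, z[) (C * (z - y) * `|v t| + C * (A z - A y)))).
    apply: le_Rintegral => // [|t tyz].
      by apply: eq_integrable (integrable_abse iD).
    have It := Iint _ tyz; move: tyz; rewrite /= in_itv/= => /andP[yt /ltW tz].
    rewrite /f /product_density patchE mem_set//.
    have -> : v t * prim c psi t + prim c v t * psi t - (P z * v t + V y * psi t)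
       = v t * (P t - P z) + (V t - V y) * psi t by rewrite /P /V; ring.
    apply: (le_trans (ler_normD _ _)); rewrite !normrM; apply: lerD.
      by rewrite mulrC ler_wpM2r// distrC Pzt.
    by rewrite mulrC ler_pM// Vyt.
  rewrite RintegralD//.
  - rewrite RintegralZl//; last exact: locint_co (locint_abs lv) Iy Iz.
    rewrite -Ac Rintegral_co_cst// [leLHS](_ : _ = 2 * C * (z - y) * (A z - A y))//.
    by ring.
  - by apply: RintegrableZl => //; exact: locint_co (locint_abs lv) Iy Iz.
  - exact: integrable_co_cst.
have Qx y : I y -> y <= x -> Q x = Q y.
  move=> Iy yx; apply: (@increments_const _ A _ _ (2 * C)) => // s t ys st tx.
  apply: QA => //; first by apply: (oo_between Iy Ix); rewrite ys (le_trans st).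
  by apply: (oo_between Iy Ix); rewrite tx (le_trans ys).
apply/eqP; rewrite -subr_eq0 -/V -/P -/(Q x) -normr_le0.
apply/ler_addgt0Pr => e e0; rewrite add0r.
have e2 : 0 < e / 2 by rewrite divr_gt0.
have [a1 Ia1 fa] := prim_cvg0 lf Ix e2.
have [a2 Ia2 va] := prim_cvg0 lv Ix ltr01.
have [a3 Ia3 psia] := prim_cvg0 lpsi Ix e2.
pose a := Num.min x (Num.min a1 (Num.min a2 a3)).
have Imin s t : I s -> I t -> I (Num.min s t).
  by move=> Is It; rewrite minEle; case: ifP.
have Ia : I a by exact: (Imin _ _ Ix (Imin _ _ Ia1 (Imin _ _ Ia2 Ia3))).
have ax : a <= x by rewrite /a ge_min lexx.
have {}fa : prim c (fun t => `|f t|) a < e / 2.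
  by apply: fa => //; rewrite /a !ge_min lexx !orbT.
have {}va : prim c (fun t => `|v t|) a < 1.
  by apply: va => //; rewrite /a !ge_min lexx !orbT.
have {}psia : prim c (fun t => `|psi t|) a < e / 2.
  by apply: psia => //; rewrite /a !ge_min lexx !orbT.
rewrite (Qx _ Ia ax) /Q (le_trans (ler_normB _ _))// normrM [leRHS]splitr.
apply: lerD; first exact: le_trans (prim_le_abs lf Ia) (ltW fa).
rewrite -[leRHS]mul1r; apply: ler_pM => //.
  exact: le_trans (prim_le_abs lv Ia) (ltW va).
exact: le_trans (prim_le_abs lpsi Ia) (ltW psia).
Qed.

End by_parts.

(** * The variation of averages *)

Section averages.
Context {R : realType}.
Notation mu := (@lebesgue_measure R).
Variables c d : \bar R.
Notation I := (oo c d).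

(** The averaging kernel: integrating against [box h x] averages over
   [[x, x + h[]. *)
Definition box (h x t : R) : R := h^-1 * \1_(`[x, x + h[%classic) t.

Definition average (u : R -> R) (h x : R) : R :=
  h^-1 * \int[mu]_(t in `[x, x + h[) u t.

Lemma measurable_box h x : measurable_fun setT (box h x).
Proof. by apply: measurable_funM => //; exact: measurable_indic. Qed.

Lemma normr_box h x t : 0 < h -> `|box h x t| <= h^-1.
Proof.
move=> h0; rewrite /box normrM ger0_norm ?invr_ge0 ?(ltW h0)//.
rewrite ler_piMr ?invr_ge0 ?(ltW h0)// indicE.
by case: (_ \in _); rewrite ?normr1 ?normr0.
Qed.

Lemma integrable_box h x (D : set (measurableTypeR R)) : measurable D ->
  mu.-integrable D (EFin \o box h x).
Proof.
move=> mD; have mi : measurable (`[x, x + h[%classic : set (measurableTypeR R)).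
  exact: measurable_itv.
apply: RintegrableZl => //; apply: (@integrableS _ _ _ mu setT) => //.
apply/integrableP; split.
  by apply/measurable_EFinP; exact: measurable_indic.
under eq_integral do rewrite /= ger0_norm//.
rewrite integral_indic// setIT /= lebesgue_measure_itv/=.
by case: ifP => _; rewrite ?ltry// -EFinB ltry.
Qed.

(** A ramp rising from [0] at [x] to [1] at [x + h]. *)
Lemma prim_box h x z : 0 < h -> I x -> I z ->
  prim c (box h x) z = h^-1 * Num.max 0 (Num.min h (z - x)).
Proof.
move=> h0 Ix Iz; have mo := measurable_oo c z%:E.
have mi : measurable (`[x, x + h[%classic : set (measurableTypeR R)).
  exact: measurable_itv.
rewrite /prim RintegralZl//; last first.
  apply: eq_integrable (RintegrableZl mo h (integrable_box h x mo)) => //.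
  by move=> t _; rewrite /= /box mulrA divff ?gt_eqF// mul1r.
congr (_ * _); rewrite /Rintegral integral_indic//.
have -> : `[x, x + h[%classic `&` oo c z%:E = `[x, Num.min (x + h) z[%classic.
  apply/seteqP; split => t; rewrite /oo/= !in_itv/= lte_fin lt_min.
    by move=> [/andP[-> ->] /andP[_ ->]].
  move=> /andP[xt /andP[-> ->]]; rewrite xt andbT; split=> //.
  by case/andP: Ix => cx _; rewrite (lt_le_trans cx).
rewrite /= lebesgue_measure_itv/= lte_fin -EFinB.
have -> : Num.min (x + h) z = x + Num.min h (z - x).
  by rewrite addr_minr; congr Num.min; rewrite addrC subrK.
by rewrite ltrDl [x + _ - x]addrAC subrr add0r; case: ltP.
Qed.

(** Moving a ramp to the right lowers it: this makes the absolute values of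
   successive differences of ramps telescope. *)
Lemma prim_box_anti h x y z : 0 < h -> I x -> I y -> I z -> x <= y ->
  prim c (box h y) z <= prim c (box h x) z.
Proof.
move=> h0 Ix Iy Iz xy; rewrite !prim_box// ler_wpM2l ?invr_ge0 ?(ltW h0)//.
by rewrite le_max2//= le_min2// lerD2l lerN2.
Qed.

Lemma prim_box_ge0 h x z : 0 < h -> I x -> I z -> 0 <= prim c (box h x) z.
Proof.
by move=> h0 Ix Iz; rewrite prim_box// mulr_ge0 ?invr_ge0 ?(ltW h0)// le_max lexx.
Qed.

Lemma prim_box_le1 h x z : 0 < h -> I x -> I z -> prim c (box h x) z <= 1.
Proof.
move=> h0 Ix Iz; rewrite prim_box// ler_pdivrMl// mulr1.
by rewrite ge_max (ltW h0) ge_min lexx.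
Qed.

Variables v g : R -> R.
Variable M : R.
Hypothesis lv : locint c d v.
Hypothesis mg : measurable_fun setT g.
Hypothesis gM : forall x, `|g x| <= M.
Notation V := (prim c v).

Lemma measurable_primM : measurable_fun (I : set (measurableTypeR R)) (fun x => V x * g x).
Proof.
by apply: measurable_funM; [exact: measurable_prim lv|exact: measurable_funTS].
Qed.

Lemma integrable_primM_co a b : I a -> I b ->
  mu.-integrable `[a, b[ (EFin \o (fun x => V x * g x)).
Proof.
move=> Ia Ib; have mi : measurable (`[a, b[%classic : set (measurableTypeR R)).
  exact: measurable_itv.
have sI : `[a, b[%classic `<=` I.
  by move=> x; rewrite /= in_itv/= => /andP[ax /ltW xb]; apply: (oo_between Ia Ib); rewrite ax.
apply: (le_integrable mi _ _ (integrable_co_cst (prim c (fun t => `|v t|) b * M) a b)).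
  apply/measurable_EFinP; apply: measurable_funS measurable_primM => //.
  exact: measurable_oo.
move=> x /[dup] /sI Ix; rewrite /= in_itv/= lee_fin => /andP[_ /ltW xb].
apply: le_trans (ler_norm _); rewrite normrM ler_pM//.
exact: (prim_le lv).
Qed.

Hypothesis Vgt0 : forall x, I x -> 0 < V x.
Hypothesis ivg : mu.-integrable I (EFin \o (fun x => v x * g x)).
Variable K : R.
Hypothesis gK : forall f, locint c d f ->
  (forall x, I x -> `|prim c f x| <= V x) -> `|\int[mu]_(x in I) (f x * g x)| <= K.

(** Let [P] be the sum of the differences of successive ramps with signs
   [e i]. The differences are of one sign and telescope, so [|P| <= 1], and
   the derivative [f] of [V P] is a test function. Integrating [f g] gives the
   integral of [v P g], at most that of [|v g|], plus the sum of the
   increments of the averages of [V g] multiplied by the [e i], which are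
   chosen to be the signs of those increments. *)
Lemma average_variation h (t : nat -> R) n : 0 < h ->
  {homo t : i j / (i <= j)%N >-> i <= j} -> (forall i, I (t i)) ->
  (forall i, I (t i + h)) ->
  \sum_(i < n) `|average (fun x => V x * g x) h (t i.+1) -
                 average (fun x => V x * g x) h (t i)| <=
  K + \int[mu]_(x in I) `|v x * g x|.
Proof.
move=> h0 tm tI thI.
have mI : measurable (I : set (measurableTypeR R)) := measurable_oo c d.
pose u x := V x * g x.
pose e i := Num.sg (average u h (t i.+1) - average u h (t i)).
have e1 i : `|e i| <= 1 by rewrite normr_sg; case: (_ != 0).
pose k i x := e i * (box h (t i.+1) x - box h (t i) x).
pose psi x := \sum_(i < n) k i x.
have ik i (D : set (measurableTypeR R)) : measurable D ->
    mu.-integrable D (EFin \o k i).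
  by move=> mD; apply: RintegrableZl => //; apply: RintegrableB => //;
    exact: integrable_box.
have lpsi : locint c d psi.
  split=> [|x _].
    apply: measurable_sum => i; apply: measurable_funM => //.
    by apply: measurable_funB; exact: measurable_box.
  apply: Rintegrable_sum => [|i]; first exact: measurable_oo.
  by apply: ik; exact: measurable_oo.
have psiC x : `|psi x| <= \sum_(i < n) (h^-1 + h^-1).
  apply: (le_trans (ler_norm_sum _ _ _)); apply: ler_sum => i _.
  rewrite /k normrM; apply: (le_trans (ler_piMl _ (e1 i))) => //.
  by apply: (le_trans (ler_normB _ _)); apply: lerD; exact: normr_box.
have Psi z : I z -> prim c psi z =
    \sum_(i < n) e i * (prim c (box h (t i.+1)) z - prim c (box h (t i)) z).
  move=> Iz; have mo := measurable_oo c z%:E.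
  rewrite /prim Rintegral_sum//; last by move=> i; exact: ik.
  apply: eq_bigr => i _; rewrite RintegralZl//; last first.
    by apply: RintegrableB => //; exact: integrable_box.
  by rewrite RintegralB//; exact: integrable_box.
have Psi1 z : I z -> `|prim c psi z| <= 1.
  move=> Iz; rewrite Psi//; apply: (le_trans (ler_norm_sum _ _ _)).
  apply: (@le_trans _ _ (\sum_(i < n) (prim c (box h (t i)) z - prim c (box h (t i.+1)) z))).
    apply: ler_sum => i _; rewrite normrM; apply: (le_trans (ler_piMl _ (e1 i))) => //.
    rewrite ler0_norm ?opprB// subr_le0; apply: prim_box_anti => //; exact: tm.
  under eq_bigr do rewrite -opprB.
  rewrite sumrN -(big_mkord xpredT (fun i => prim c (box h (t i.+1)) z - prim c (box h (t i)) z)).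
  rewrite telescope_sumr// opprB; apply: le_trans (prim_box_le1 h0 (tI 0%N) Iz).
  by rewrite lerBlDr lerDl prim_box_ge0.
pose f := product_density c d v psi.
have lf : locint c d f by exact: locint_product_density.
have fV x : I x -> `|prim c f x| <= V x.
  move=> Ix; rewrite (prim_product lv lpsi psiC Ix) normrM.
  by rewrite gtr0_norm ?Vgt0// ler_piMr ?Psi1// ltW// Vgt0.
pose T i := (u \_ `[t i, t i + h[) : R -> R.
have iT i : mu.-integrable I (EFin \o T i).
  have mi : measurable (`[t i, t i + h[%classic : set (measurableTypeR R)).
    exact: measurable_itv.
  apply: (@integrableS _ _ _ mu setT) => //.
  have := integrable_primM_co (tI i) (thI i).
  by move/(integrable_mkcond _ mi); rewrite restrict_EFin.
have intT i : h^-1 * \int[mu]_(x in I) T i x = average u h (t i).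
  rewrite /average; congr (_ * fine _).
  transitivity (\int[mu]_(x in I) ((EFin \o u) \_ `[t i, (t i + h)%R[) x)%E.
    by rewrite restrict_EFin.
  rewrite -integral_mkcondr setIidr// => x.
  rewrite /= in_itv/= => /andP[tx /ltW xt].
  by apply: (oo_between (tI i) (thI i)); rewrite tx.
pose G i x := e i * h^-1 * (T i.+1 x - T i x).
have iG i : mu.-integrable I (EFin \o G i).
  by apply: RintegrableZl => //; exact: RintegrableB.
have ivP : mu.-integrable I (EFin \o (fun x => v x * g x * prim c psi x)).
  apply: (le_integrable mI _ _ ivg).
    apply/measurable_EFinP; apply: measurable_funM; last exact: measurable_prim lpsi.
    by apply: measurable_funM; apply: measurable_funTS => //; case: lv.
  move=> x Ix; rewrite /= lee_fin normrM ler_piMr//; exact: Psi1.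
have fgE : \int[mu]_(x in I) (f x * g x) =
    \int[mu]_(x in I) (v x * g x * prim c psi x) +
    \sum_(i < n) `|average u h (t i.+1) - average u h (t i)|.
  rewrite (_ : \sum_(i < n) _ = \int[mu]_(x in I) \sum_(i < n) G i x).
    rewrite -RintegralD//; last exact: Rintegrable_sum.
    apply: eq_Rintegral => x /set_mem Ix.
    rewrite /f /product_density patchE mem_set//.
    rewrite mulrDl; congr (_ + _); first by rewrite mulrAC.
    rewrite mulrAC /psi mulr_sumr; apply: eq_bigr => i _.
    have TE j : T j x = u x * \1_(`[t j, t j + h[%classic) x.
      by rewrite /T patchE indicE; case: ifP => _; rewrite ?mulr1 ?mulr0.
    by rewrite /k /G /box !TE /u; ring.
  rewrite Rintegral_sum//; apply: eq_bigr => i _.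
  rewrite RintegralZl//; last exact: RintegrableB.
  by rewrite RintegralB// -mulrA mulrBr !intT normrEsg.
have := gK lf fV; rewrite fgE; set S := \sum_(i < n) _.
set X := \int[mu]_(x in I) (v x * g x * _); move=> SK.
have SX : S <= `|X + S| + `|X|.
  apply: le_trans (ler_normB _ _); apply: le_trans (ler_norm _).
  by rewrite addrAC subrr add0r.
apply: (le_trans SX); apply: lerD => //.
apply: (le_trans (le_normr_Rintegral mI ivP)).
apply: le_Rintegral => //.
- by apply: eq_integrable (integrable_abse ivP).
- by apply: eq_integrable (integrable_abse ivg).
- by move=> x Ix; rewrite normrM ler_piMr//; exact: Psi1.
Qed.

End averages.

(** * Bounded pointwise variation *)

Section bounded_pointwise_variation.
Context {R : realType}.
Notation mu := (@lebesgue_measure R).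
Implicit Types (I : set R) (f : R -> R) (L : R).

Definition bpv_by I f L := forall (a b : R) (s : seq R),
  I a -> I b -> itv_partition a b s -> variation a b f s <= L.

(** Monotone sequences may repeat points, so that, unlike strict partitions,
   they can be stopped and translated freely. *)
Lemma bpv_by_sum I f L (t : nat -> R) n : bpv_by I f L ->
  {homo t : i j / (i <= j)%N >-> i <= j} -> (forall i, I (t i)) ->
  \sum_(i < n) `|f (t i.+1) - f (t i)| <= L.
Proof.
move=> fL tm tI.
suff [s ps ->] : exists2 s, itv_partition (t 0%N) (t n) s &
  \sum_(i < n) `|f (t i.+1) - f (t i)| = variation (t 0%N) (t n) f s by exact: fL.
elim: n => [|n [s ps E]].
  by exists [::]; [split|rewrite big_ord0 variation_nil].
rewrite big_ord_recr/= E; have := tm n n.+1 (leqnSn n).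
rewrite le_eqVlt => /predU1P[tE|tn].
  by exists s; rewrite -tE// subrr normr0 addr0.
have p1 := itv_partition1 tn.
exists (s ++ [:: t n.+1]); first exact: itv_partition_cat ps p1.
rewrite (variation_cat (c := t n)) ?(ltW tn) ?tm//; congr (_ + _).
by rewrite /variation big_mkord big_ord1.
Qed.

Lemma bpv_by_of_sum I f L :
  (forall (t : nat -> R) n, {homo t : i j / (i <= j)%N >-> i <= j} ->
    (forall i, I (t i)) -> \sum_(i < n) `|f (t i.+1) - f (t i)| <= L) ->
  (forall a b x, I a -> I b -> a <= x <= b -> I x) -> bpv_by I f L.
Proof.
move=> H convI a b s Ia Ib ps; rewrite /variation big_mkord /=.
have nthS i : nth b (a :: s) i <= nth b (a :: s) i.+1.
  have [si|si] := ltnP i (size s).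
    by rewrite /= ltW//; have [/(pathP b) + _] := ps; apply.
  rewrite (nth_default b (n := i.+1))//.
  have [->|ne] := eqVneq i (size s); first by rewrite (itv_partition_nth_size _ ps).
  by rewrite nth_default//= ltn_neqAle eq_sym ne.
have nthm : {homo nth b (a :: s) : i j / (i <= j)%N >-> i <= j}.
  by apply: homo_leq => //; exact: le_trans.
apply: H => // i; apply: (convI a b) => //.
rewrite -[X in X <= _]/(nth b (a :: s) 0) nthm//=.
have [si|si] := ltnP i (size s).+1; first exact: itv_partition_nth_le.
by rewrite nth_default.
Qed.

(** [T x] is the variation up to [x]. *)
Lemma bpv_by_cumulative I f L : bpv_by I f L -> exists T : R -> R,
  (forall x, I x -> 0 <= T x <= L) /\
  (forall x y, I x -> I y -> x <= y -> `|f y - f x| <= T y - T x).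
Proof.
move=> fL.
pose A x := [set r | exists a s, [/\ I a, itv_partition a x s & r = variation a x f s]].
have A0 x : I x -> A x 0.
  by move=> Ix; exists x, [::]; split => //; rewrite variation_nil.
have AL x : I x -> ubound (A x) L.
  by move=> Ix _ [a [s [Ia ps ->]]]; exact: fL.
have supA x : I x -> has_sup (A x).
  by move=> Ix; split; [exists 0; exact: A0|exists L; exact: AL].
exists (fun x => sup (A x)); split=> [x Ix|x y Ix Iy].
  rewrite ub_le_sup; [|by case: (supA x Ix)|exact: A0].
  by rewrite ge_sup//; [exists 0; exact: A0|exact: AL].
rewrite le_eqVlt => /predU1P[->|xy]; first by rewrite !subrr normr0.
rewrite lerBrDl -lerBrDr; apply: ge_sup; first by exists 0; exact: A0.
move=> _ [a [s [Ia ps ->]]]; rewrite lerBrDr.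
apply: ub_le_sup; first by case: (supA y Iy).
have p1 := itv_partition1 xy.
exists a, (s ++ [:: y]); split => //; first exact: itv_partition_cat ps p1.
rewrite (variation_cat (c := x)) ?(ltW xy) ?(itv_partition_le ps)//; congr (_ + _).
by rewrite /variation big_mkord big_ord1.
Qed.

Lemma not_discontinuity_continuous (F : R -> R) (a b x : R) :
  {in `[a, b] &, nondecreasing_fun F} -> a < x < b ->
  ~ discontinuity F x -> {for x, continuous F}.
Proof.
move=> ndF /andP[ax xb] nd.
have cl : cvg (F y @[y --> x^'-]).
  apply: nondecreasing_at_left_is_cvgr; near=> r.
    apply: itv_sub_in2 ndF; apply: (subset_itvW _ _ _ (ltW xb)).
    by near: r; exact: nbhs_left_ge.
  exists (F x) => _/= [z zrx <-]; apply: ndF.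
  - apply: (subset_itvW _ _ _ (ltW xb) zrx).
    by near: r; exact: nbhs_left_ge.
  - by rewrite in_itv/= !ltW.
  - by move: zrx => /[!in_itv]/= /andP[_ /ltW].
have cr : cvg (F y @[y --> x^'+]).
  apply: nondecreasing_at_right_is_cvgr; near=> r.
    apply: itv_sub_in2 ndF; apply: (subset_itvW _ _ (ltW ax)).
    by near: r; exact: nbhs_right_le.
  exists (F x) => _/= [z zxr <-]; apply: ndF.
  - by rewrite in_itv/= !ltW.
  - apply: (subset_itvW _ _ (ltW ax) _ zxr).
    by near: r; exact: nbhs_right_le.
  - by move: zxr => /[!in_itv]/= /andP[/ltW].
have E : lim (F y @[y --> x^'-]) = lim (F y @[y --> x^'+]).
  by apply/eqP; apply: contrapT => /negP ne; apply: nd; split.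
have lF : lim (F y @[y --> x^'-]) <= F x.
  apply: limr_le => //; near=> y; apply: ndF; rewrite ?in_itv/=.
  - apply/andP; split; first by near: y; exact: nbhs_left_ge.
    by apply: ltW; apply: lt_trans xb; near: y; exact: nbhs_left_lt.
  - by rewrite !ltW.
  - by near: y; exact: nbhs_left_le.
have Fr : F x <= lim (F y @[y --> x^'+]).
  apply: limr_ge => //; near=> y; apply: ndF; rewrite ?in_itv/=.
  - by rewrite !ltW.
  - apply/andP; split; last by near: y; exact: nbhs_right_le.
    by apply: ltW; apply: (lt_trans ax); near: y; exact: nbhs_right_gt.
  - by near: y; exact: nbhs_right_ge.
have Fl : lim (F y @[y --> x^'-]) = F x by apply/eqP; rewrite eq_le lF E Fr.
apply/left_right_continuousP; split; first by rewrite -Fl.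
by rewrite -Fl E.
Unshelve. all: by end_near. Qed.

Variables c d : \bar R.
Notation I := (oo c d).

Lemma bpv_by_right_lim f L x : bpv_by I f L -> I x -> cvg (f y @[y --> x^'+]).
Proof.
move=> /bpv_by_cumulative[T [TL fT]] Ix.
have [b [_ bI _ /(_ _ Ix)[n xb]]] := oo_exhaust_right Ix.
have itvI y : x < y -> y < b n -> I y.
  by move=> xy yb; apply: (oo_between Ix (bI n)); rewrite !ltW.
have mono (F : R -> R) : (forall y z, I y -> I z -> y <= z -> F y <= F z) ->
    cvg (F y @[y --> x^'+]).
  move=> Fm; apply: nondecreasing_at_right_is_cvgr; near=> r.
    move=> y z; rewrite !in_itv/= => /andP[xy yr] /andP[xz zr]; apply: Fm.
      apply: itvI => //; apply: (lt_trans yr); near: r; exact: nbhs_right_lt.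
    apply: itvI => //; apply: (lt_trans zr); near: r; exact: nbhs_right_lt.
  exists (F x) => _ [z + <-]; rewrite /= in_itv/= => /andP[xz zr]; apply: Fm => //.
    apply: itvI => //; apply: (lt_trans zr); near: r; exact: nbhs_right_lt.
  exact: ltW.
have fE : f = T \- (fun y => T y - f y) by apply/funext => y /=; ring.
rewrite fE; apply: is_cvgB; apply: mono => y z Iy Iz yz.
  by rewrite -subr_ge0 (le_trans _ (fT _ _ Iy Iz yz)).
have := le_trans (ler_norm _) (fT _ _ Iy Iz yz); lra.
Unshelve. all: by end_near. Qed.

(** A difference of two nondecreasing functions, each of which has countably
   many discontinuities. *)
Lemma bpv_by_continuous_ae f L : bpv_by I f L ->
  \forall x \ae mu, I x -> {for x, continuous f}.
Proof.
move=> /bpv_by_cumulative[T [TL fT]].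
have [[x0 Ix0]|I0] := pselect (I !=set0); last first.
  by apply: aeW => x Ix; exfalso; apply: I0; exists x.
have [a [_ aI ania acof]] := oo_exhaust_left Ix0.
have [b [_ bI bndb bcof]] := oo_exhaust_right Ix0.
have mono (F : R -> R) : (forall y z, I y -> I z -> y <= z -> F y <= F z) ->
    \forall x \ae mu, I x -> {for x, continuous F}.
  move=> Fm; have ndF n : {in `[a n, b n] &, nondecreasing_fun F}.
    move=> y z; rewrite !in_itv/= => yi zi; apply: Fm.
      exact: oo_between yi.
    exact: oo_between zi.
  have : mu.-negligible (\bigcup_n [set x | x \in (`]a n, b n[) /\ discontinuity F x]).
    apply: negligible_bigcup => n; have C := discontinuity_countable (ndF n).
    set D := [set x | _] in C *.
    have mD : measurable (D : set (measurableTypeR R)) by exact: countable_measurable.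
    by exists D; split => //; exact: countable_lebesgue_measure0.
  apply: negligibleS => x /=; apply: contra_notP => nx Ix.
  have [n ax] := acof _ Ix; have [m xb] := bcof _ Ix.
  have xi : a (n + m)%N < x < b (n + m)%N.
    rewrite (le_lt_trans _ ax) ?ania ?leq_addr//.
    by rewrite (lt_le_trans xb)// bndb// leq_addl.
  apply: (not_discontinuity_continuous (ndF (n + m)%N) xi) => dx.
  by apply: nx; exists (n + m)%N => //; split => //; rewrite in_itv.
have fE : f = T \- (fun y => T y - f y) by apply/funext => y /=; ring.
have T1 : forall y z, I y -> I z -> y <= z -> T y <= T z.
  by move=> y z Iy Iz yz; rewrite -subr_ge0 (le_trans _ (fT _ _ Iy Iz yz)).
have T2 : forall y z, I y -> I z -> y <= z -> T y - f y <= T z - f z.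
  by move=> y z Iy Iz yz; have := le_trans (ler_norm _) (fT _ _ Iy Iz yz); lra.
apply: aeS2 (mono _ T1) (mono _ T2) => x C1 C2 Ix.
rewrite fE; apply: continuousB; [exact: C1|exact: C2].
Qed.

End bounded_pointwise_variation.

(** * Limits of averages *)

Section filters.
Context {R : realType} {T : Type} (U : set_system T).

Lemma ultra_cvg (f : T -> R) (a b : R) : UltraFilter U ->
  (\forall n \near U, a <= f n <= b) -> exists l : R, f n @[n --> U] --> l.
Proof.
move=> UU fab; have PU : ProperFilter U by exact: ultra_proper.
have FU : ProperFilter (fmap f U) by exact: fmap_proper_filter.
have [|l [_ fl]] := @segment_compact R a b (fmap f U) FU.
  by apply: filterS fab => n; rewrite /= in_itv.
exists l => B lB; have [//|UnB] := in_ultra_setVsetC (f @^-1` B) UU.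
by have [x [nBx]] := fl (~` B) B UnB lB.
Qed.

Lemma cvg_sum_ord {FU : Filter U} (F : nat -> T -> R) (l : nat -> R) n :
  (forall i, F i x @[x --> U] --> l i) ->
  \sum_(i < n) F i x @[x --> U] --> \sum_(i < n) l i.
Proof.
move=> Fl; elim: n => [|n IH].
  by under eq_fun do rewrite big_ord0; rewrite big_ord0; exact: cvg_cst.
under eq_fun do rewrite big_ord_recr; rewrite big_ord_recr /=.
exact: cvgD.
Qed.

End filters.

Section limits_of_averages.
Context {R : realType}.
Notation mu := (@lebesgue_measure R).
Variables c d : \bar R.
Notation I := (oo c d).
Notation step n := ((n.+1%:R : R)^-1).

Lemma near_step (x : R) : I x -> \forall n \near \oo, I (x + step n).
Proof.
move=> Ix; have [b [_ bI _ /(_ _ Ix)[m xb]]] := oo_exhaust_right Ix.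
have e0 : 0 < b m - x by rewrite subr_gt0.
near=> n; apply: (oo_between Ix (bI m)).
rewrite lerDl invr_ge0 ler0n/= -lerBrDl.
by apply: ltW; near: n; exact: near_infty_natSinv_lt (PosNum e0).
Unshelve. all: by end_near. Qed.

Variable u : R -> R.
Hypothesis iu : forall a b, I a -> I b -> mu.-integrable `[a, b[ (EFin \o u).

(** Lebesgue differentiation, applied to truncations of [u], which is only
   locally integrable. *)
Lemma average_cvg_ae : \forall x \ae mu, I x ->
  average u (step n) x @[n --> \oo] --> u x.
Proof.
have [[x0 Ix0]|I0] := pselect (I !=set0); last first.
  by apply: aeW => x Ix; exfalso; apply: I0; exists x.
have [a [_ aI ania acof]] := oo_exhaust_left Ix0.
have [b [_ bI bndb bcof]] := oo_exhaust_right Ix0.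
pose J n : set R := `[a n, b n[%classic.
have mJ n : measurable (J n : set (measurableTypeR R)) by exact: measurable_itv.
pose f n := u \_ (J n).
have iJ n : mu.-integrable setT (EFin \o f n).
  have := iu (aI n) (bI n).
  by move/(integrable_mkcond _ (mJ n)); rewrite restrict_EFin.
have iJA n (A : set (measurableTypeR R)) : measurable A -> mu.-integrable A (EFin \o f n).
  by move=> mA; apply: integrableS (iJ n).
pose F n x := \int[mu]_(t in `]-oo, x]) f n t.
have D n : \forall x \ae mu, derivable (F n) x 1 /\ (F n)^`()%classic x = f n x.
  apply: FTC1Ny; first by move=> y; apply: iJA; exact: measurable_itv.
  by apply: open_integrable_locally => //; exact: openT.
have := ae_foralln D.
apply: aeS => x Dx Ix.
have [n ax] := acof _ Ix; have [m xb] := bcof _ Ix.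
have axk : a (n + m)%N < x by rewrite (le_lt_trans _ ax) ?ania ?leq_addr//.
have xbk : x < b (n + m)%N by rewrite (lt_le_trans xb)// bndb// leq_addl.
move: axk xbk (Dx (n + m)%N); move: (n + m)%N => k ak kb [dF Fx].
have fx : f k x = u x.
  by rewrite /f patchE mem_set// /J/= in_itv/= kb ltW.
rewrite -fx -Fx derive1E.
have := dF; rewrite /derivable => dF'.
have stepc : (step n @[n --> \oo] --> (0:R)^').
  move=> B /= [e e0 Be]; suff: \forall i \near \oo, B (step i) by [].
  near=> i; apply: Be => /=; last by rewrite invr_eq0 pnatr_eq0.
  rewrite sub0r normrN ger0_norm ?invr_ge0//.
  by near: i; exact: near_infty_natSinv_lt (PosNum e0).
have := cvg_comp _ _ stepc dF'.
have e0 : 0 < b k - x by rewrite subr_gt0.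
apply: cvg_trans; apply: near_eq_cvg; near=> i.
have h0 : 0 < step i by rewrite invr_gt0.
have xi : x + step i <= b k.
  rewrite -lerBrDl; apply: ltW; near: i; exact: near_infty_natSinv_lt (PosNum e0).
rewrite /average /= [_%:A]mulr1 [step i + x]addrC.
congr (_ * _).
set y := x + step i in xi *; have xy : x < y by rewrite /y ltrDl.
have -> : F k y - F k x = \int[mu]_(t in `]x, y]) f k t.
  have E : `]-oo, y]%classic = `]-oo, x]%classic `|` `]x, y]%classic.
    apply/seteqP; split => t; rewrite /= !in_itv/=.
      by move=> ty; case: (leP t x) => [tx|xt]; [left|right].
    by move=> [tx|/andP[]//]; rewrite (le_trans tx)// ltW.
  rewrite /F E Rintegral_setU//.
  - by rewrite addrAC subrr add0r.
  - by apply: iJA; rewrite -E; exact: measurable_itv.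
  - apply/disj_setPS => t [] /=; rewrite !in_itv/= => tx /andP[xt _].
    by rewrite ltNge tx in xt.
rewrite Rintegral_itv_obnd_cbnd; last by apply: iJA; exact: measurable_itv.
rewrite -Rintegral_itv_bndo_bndc; last by apply: iJA; exact: measurable_itv.
apply: eq_Rintegral => t; rewrite inE/= in_itv/= => /andP[xt ty].
rewrite /f patchE mem_set// /J/= in_itv/= (le_trans (ltW ak))//=.
exact: lt_le_trans xi.
Unshelve. all: by end_near. Qed.

(** Stopping [t] at [n] does not change sums over [i < n], and reduces the
   condition that all [t i + h] belong to [I] to the one at [n]. *)
Lemma nat_mono_min (t : nat -> R) n : {homo t : i j / (i <= j)%N >-> i <= j} ->
  (forall i, I (t i)) ->
  [/\ {homo (fun i => t (minn i n)) : i j / (i <= j)%N >-> i <= j},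
     forall i, I (t (minn i n)) &
     forall h, 0 <= h -> I (t n + h) -> forall i, I (t (minn i n) + h)].
Proof.
move=> tm tI; split => // [i j ij|h h0 tn i].
  by apply: tm; rewrite leq_min geq_minr andbT (leq_trans (geq_minl _ _) ij).
apply: (oo_between (tI 0%N) tn).
by rewrite lerD2r tm ?geq_minr// (le_trans (tm 0%N (minn i n) _))//= lerDl.
Qed.

Variable L : R.
Hypothesis averageL : forall h (t : nat -> R) n, 0 < h ->
  {homo t : i j / (i <= j)%N >-> i <= j} -> (forall i, I (t i)) ->
  (forall i, I (t i + h)) ->
  \sum_(i < n) `|average u h (t i.+1) - average u h (t i)| <= L.

Lemma near_averageL (t : nat -> R) n : {homo t : i j / (i <= j)%N >-> i <= j} ->
  (forall i, I (t i)) -> \forall k \near \oo,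
  \sum_(i < n) `|average u (step k) (t i.+1) - average u (step k) (t i)| <= L.
Proof.
move=> tm tI; have [tm' tI' tIh] := nat_mono_min n tm tI.
near=> k; have h0 : 0 < step k by rewrite invr_gt0.
have tnk : I (t n + step k) by near: k; exact: near_step.
have := averageL n h0 tm' tI' (tIh _ (ltW h0) tnk).
apply: le_trans; rewrite le_eqVlt; apply/orP; left; apply/eqP/eq_bigr => i _.
by rewrite (minn_idPl (ltn_ord i)) (minn_idPl (ltnW (ltn_ord i))).
Unshelve. all: by end_near. Qed.

(** A limit of the averages along an ultrafilter exists at every point, since
   the variation bound confines them to a compact set; it inherits the
   variation bound, and coincides with [u] wherever the averages converge. *)
Lemma exists_bpv_repr : I !=set0 -> exists2 gt : R -> R, bpv_by I gt L &
  \forall x \ae mu, I x -> gt x = u x.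
Proof.
move=> I0.
have [x1 Ix1 cx1] : exists2 x1, I x1 &
    average u (step n) x1 @[n --> \oo] --> u x1.
  apply: contrapT => /forall2NP nx.
  have [N [mN N0 IN]] := average_cvg_ae.
  have IN' : I `<=` N.
    by move=> x Ix; apply: IN => /= H; have [|] := nx x; [exact|apply; exact: H].
  have [x0 Ix0] := I0.
  have [b [_ bI _ /(_ _ Ix0)[n xb]]] := oo_exhaust_right Ix0.
  have mJ : measurable (`[x0, b n[%classic : set (measurableTypeR R)).
    exact: measurable_itv.
  have : (mu `[x0, b n[%classic <= mu N)%E.
    apply: le_measure; rewrite ?inE// => x; rewrite /= in_itv/= => /andP[ax xb'].
    by apply: IN'; apply: (oo_between Ix0 (bI n)); rewrite ax ltW.
  rewrite [X in (_ <= X)%E]N0 /= lebesgue_measure_itv/= lte_fin xb -EFinB lee_fin.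
  by rewrite leNgt subr_gt0 xb.
have [U [UU Uoo]] := @ultraFilterLemma nat \oo _.
have PU : ProperFilter U by exact: ultra_proper.
have lim x : I x -> exists l : R, average u (step n) x @[n --> U] --> l.
  move=> Ix.
  have near2 : \forall n \near \oo,
      `|average u (step n) x - average u (step n) x1| <= L.
    pose t (i : nat) := if i is 0%N then Num.min x x1 else Num.max x x1.
    have tm : {homo t : i j / (i <= j)%N >-> i <= j}.
      move=> [|i] [|j]//= _; by rewrite le_max ge_min lexx.
    have tI i : I (t i) by case: i => [|i] /=; rewrite ?minEle ?maxEle; case: ifP.
    apply: filterS (near_averageL 1 tm tI) => n; rewrite big_ord1 /=.
    by case: (leP x x1) => // _; rewrite distrC.
  have near1 : \forall n \near \oo, `|average u (step n) x1| <= `|u x1| + 1.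
    move/cvgrPdist_lt : cx1 => /(_ _ ltr01); apply: filterS => n un.
    rewrite -lerBlDl (le_trans (lerB_dist _ _))// distrC; exact: ltW.
  pose B := L + (`|u x1| + 1).
  apply: (@ultra_cvg R _ U (fun n => average u (step n) x) (- B) B UU); apply: Uoo.
  apply: filterS2 near2 near1 => n n2 n1; rewrite -ler_norml.
  have := ler_normD (average u (step n) x - average u (step n) x1) (average u (step n) x1).
  by rewrite subrK /B; lra.
have [gt gtP] : exists gt : R -> R, forall x, I x -> average u (step n) x @[n --> U] --> gt x.
  have /choice[gt gtP] : forall x, exists l : R, I x -> average u (step n) x @[n --> U] --> l.
    move=> x; have [Ix|nI] := pselect (I x); last by exists 0.
    by have [l xl] := lim _ Ix; exists l.
  by exists gt.
exists gt.
  apply: bpv_by_of_sum; last exact: oo_between.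
  move=> t n tm tI.
  have C : \sum_(i < n) `|average u (step k) (t i.+1) - average u (step k) (t i)|
      @[k --> U] --> \sum_(i < n) `|gt (t i.+1) - gt (t i)|.
    apply: (cvg_sum_ord
      (F := fun i k => `|average u (step k) (t i.+1) - average u (step k) (t i)|)
      (l := fun i => `|gt (t i.+1) - gt (t i)|)) => i.
    by apply: cvg_norm; apply: cvgB; exact: gtP.
  have S : closed [set x : R | x <= L] by exact: closed_le.
  by apply: (@closed_cvg _ _ _ _ _ _ S _ _ C); apply: Uoo; exact: near_averageL.
apply: aeS average_cvg_ae => x xu Ix.
have C1 : average u (step n) x @[n --> U] --> u x.
  by apply: cvg_trans (xu Ix); move=> A; exact: Uoo.
exact: (cvg_unique _ (gtP _ Ix) C1).
Qed.

Lemma average_near (h x r e : R) : 0 < h -> 0 <= e -> mu.-integrable `[x, x + h[ (EFin \o u) ->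
  (\forall t \ae mu, x < t < x + h -> `|u t - r| <= e) ->
  `|average u h x - r| <= e.
Proof.
move=> h0 e0 ih ur; have mi : measurable (`[x, x + h[%classic : set (measurableTypeR R)).
  exact: measurable_itv.
have xh : x <= x + h by rewrite lerDl ltW.
have ic k : mu.-integrable `[x, x + h[ (EFin \o cst k) by exact: integrable_co_cst.
have -> : average u h x - r = h^-1 * \int[mu]_(t in `[x, x + h[) (u t - r).
  rewrite RintegralB//; last exact: ic.
  rewrite mulrBr; congr (_ - _); rewrite Rintegral_co_cst// [x + h]addrC addrK.
  by rewrite mulrC mulfK// gt_eqF.
have iB : mu.-integrable `[x, x + h[ (EFin \o (fun t => u t - r)).
  by apply: RintegrableB => //; exact: ic.
rewrite normrM gtr0_norm ?invr_gt0// ler_pdivrMl//.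
apply: (le_trans (le_normr_Rintegral mi iB)).
have -> : h * e = \int[mu]_(t in `[x, x + h[) e.
  by rewrite Rintegral_co_cst// mulrC [x + h]addrC addrK.
have iA : mu.-integrable `[x, x + h[ (EFin \o (fun t => `|u t - r|)).
  by apply: eq_integrable (integrable_abse iB).
rewrite /Rintegral; apply: fine_le.
- exact: integrable_fin_num iA.
- exact: integrable_fin_num (ic e).
apply: ae_ge0_le_integral => //.
- by case/integrableP : iA.
- have N : \forall t \ae mu, t <> x.
    exists [set x]; split => //; first exact: lebesgue_measure_set1.
    by move=> t /=; exact: contrapT.
  apply: aeS2 ur N => t ut tx; rewrite /= in_itv/= => /andP[xt th].
  rewrite lee_fin ut// th andbT lt_neqAle xt andbT eq_sym.
  by apply/eqP.
Qed.

Lemma average_cvg_right (f : R -> R) (x r : R) :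
  (\forall t \ae mu, I t -> f t = u t) -> I x ->
  f t @[t --> x^'+] --> r -> average u (step n) x @[n --> \oo] --> r.
Proof.
move=> fu Ix /cvgrPdist_le fr; apply/cvgrPdist_le => e e0.
have [del /= del0 fe] := fr _ e0.
near=> n; have h0 : 0 < step n by rewrite invr_gt0.
have Ixh : I (x + step n) by near: n; exact: near_step.
have nd : step n < del by near: n; exact: near_infty_natSinv_lt (PosNum del0).
rewrite distrC; apply: average_near => //; [exact: ltW|exact: iu|].
apply: aeS fu => t ft /andP[xt th]; rewrite -ft.
  rewrite distrC; apply: fe => //=.
  rewrite distrC ger0_norm ?subr_ge0 ?ltW//; apply: le_lt_trans nd.
  by rewrite lerBlDl ltW.
by apply: (oo_between Ix Ixh); rewrite !ltW.
Unshelve. all: by end_near. Qed.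

(** The right limits of [f] are limits of averages, hence depend only on the
   class of [f]: they inherit the bound [L] even if the variation of [f]
   itself is larger. *)
Lemma bpv_by_right_lims (f r : R -> R) :
  (\forall t \ae mu, I t -> f t = u t) ->
  (forall x, I x -> f t @[t --> x^'+] --> r x) -> bpv_by I r L.
Proof.
move=> fu fr; apply: bpv_by_of_sum; last exact: oo_between.
move=> t n tm tI.
have C : \sum_(i < n) `|average u (step k) (t i.+1) - average u (step k) (t i)|
    @[k --> \oo] --> \sum_(i < n) `|r (t i.+1) - r (t i)|.
  apply: (cvg_sum_ord
    (F := fun i k => `|average u (step k) (t i.+1) - average u (step k) (t i)|)
    (l := fun i => `|r (t i.+1) - r (t i)|)) => i.
  by apply: cvg_norm; apply: cvgB; exact: (average_cvg_right fu (tI _) (fr _ (tI _))).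
have S : closed [set x : R | x <= L] by exact: closed_le.
by apply: (@closed_cvg _ _ _ _ _ _ S _ _ C); exact: near_averageL.
Qed.

End limits_of_averages.

(** * Abel summation *)

Section riemann_sums.
Context {R : realType}.
Notation mu := (@lebesgue_measure R).
Variables c d : \bar R.
Notation I := (oo c d).

Definition node (a b : R) n i : R := a + (b - a) * i%:R / n.+1%:R.

Lemma node0 a b n : node a b n 0 = a.
Proof. by rewrite /node mulr0 mul0r addr0. Qed.

Lemma nodeS a b n i : node a b n i.+1 - node a b n i = (b - a) / n.+1%:R.
Proof.
rewrite /node -(natr1 i); field; by rewrite nat1r pnatr_eq0.
Qed.

Lemma node_last a b n : node a b n n.+1 = b.
Proof. by rewrite /node mulfK ?pnatr_eq0// addrC subrK. Qed.

Lemma node_homo a b n : a <= b ->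
  {homo node a b n : i j / (i <= j)%N >-> i <= j}.
Proof.
move=> ab i j ij; rewrite lerD2l ler_pM2r ?invr_gt0//.
by rewrite ler_wpM2l ?subr_ge0// ler_nat.
Qed.

Lemma node_between a b n i : a <= b -> (i <= n.+1)%N -> a <= node a b n i <= b.
Proof.
move=> ab ni; rewrite -{1}(node0 a b n) node_homo//=.
by rewrite -[leRHS](node_last a b n) node_homo.
Qed.

Lemma node_cover a b n x : a <= x < b ->
  exists2 i, (i < n.+1)%N & node a b n i <= x < node a b n i.+1.
Proof.
move=> /andP[ax xb].
have ex : exists i, x < node a b n i by exists n.+1; rewrite node_last.
case: (ex_minnP ex) => -[|i] xi imin.
  by move: xi; rewrite node0 ltNge ax.
exists i; last first.
  rewrite xi andbT leNgt; apply/negP => /imin; by rewrite ltnn.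
by have := imin n.+1; rewrite node_last => /(_ xb).
Qed.

Lemma node_disjoint a b n x i j : a <= b -> node a b n i <= x < node a b n i.+1 ->
  node a b n j <= x < node a b n j.+1 -> i = j.
Proof.
move=> ab; have le k l : node a b n k <= x < node a b n k.+1 ->
    node a b n l <= x < node a b n l.+1 -> (k <= l)%N.
  move=> /andP[kx _] /andP[_ xl]; rewrite leqNgt; apply/negP => lk.
  by have := lt_le_trans xl (le_trans (node_homo n ab lk) kx); rewrite ltxx.
by move=> xi xj; apply/eqP; rewrite eqn_leq (le _ _ xi xj) (le _ _ xj xi).
Qed.

(** The step functions with values [G (node a b n i)] converge to [G] wherever
   it is continuous, and are dominated by [M]. *)
Lemma riemann_sum_cvg (f G g : R -> R) (M a b : R) : locint c d f ->
  (forall x, I x -> `|G x| <= M) ->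
  measurable_fun setT g ->
  (\forall x \ae mu, I x -> {for x, continuous G} /\ G x = g x) ->
  I a -> I b -> a <= b ->
  \sum_(i < n.+1) (G (node a b n i) *
     \int[mu]_(x in `[node a b n i, node a b n i.+1[) f x) @[n --> \oo] -->
  \int[mu]_(x in `[a, b[) (f x * g x).
Proof.
move=> lf GM mg Gg Ia Ib ab.
have mi : measurable (`[a, b[%classic : set (measurableTypeR R)).
  exact: measurable_itv.
pose J n i : set (measurableTypeR R) := `[node a b n i, node a b n i.+1[%classic.
have mJ n i : measurable (J n i) by exact: measurable_itv.
pose s n x := \sum_(i < n.+1) (G (node a b n i) * \1_(J n i) x).
have sE n i x : (i < n.+1)%N -> node a b n i <= x < node a b n i.+1 ->
    s n x = G (node a b n i).
  move=> ni xi; rewrite /s (bigD1 (Ordinal ni))//= big1 ?addr0.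
    by rewrite indicE mem_set ?mulr1// /J/= in_itv.
  move=> j ji; rewrite indicE memNset ?mulr0//; rewrite /J/= in_itv/= => xj.
  by move/eqP : ji; apply; apply/val_inj => /=; exact: (node_disjoint ab xj xi).
have nodeI n i : (i <= n.+1)%N -> I (node a b n i).
  by move=> ni; apply: (oo_between Ia Ib); exact: node_between.
have ifi : mu.-integrable `[a, b[ (EFin \o f) by exact: locint_co lf Ia Ib.
have mf : measurable_fun setT f by case: lf.
have ms n : measurable_fun setT (s n).
  by apply: measurable_sum => i; apply: measurable_funM => //; exact: measurable_indic.
have -> : (fun n => \sum_(i < n.+1) (G (node a b n i) *
     \int[mu]_(x in `[node a b n i, node a b n i.+1[) f x)) =
  (fun n => \int[mu]_(x in `[a, b[) (f x * s n x)).
  apply/funext => n.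
  pose F i x := G (node a b n i) * (f \_ (J n i)) x.
  have iJ i : mu.-integrable `[a, b[ (EFin \o (f \_ (J n i))).
    apply: (le_integrable mi _ _ ifi).
      apply/measurable_EFinP; apply: measurable_funTS.
      by apply/(measurable_restrictT _ (mJ n i)); exact: measurable_funTS.
    by move=> x _; rewrite /= patchE lee_fin; case: ifP => // _; rewrite normr0.
  have iF i : mu.-integrable `[a, b[ (EFin \o F i) by exact: RintegrableZl.
  transitivity (\int[mu]_(x in `[a, b[) \sum_(i < n.+1) F i x); last first.
    apply: eq_Rintegral => x _; rewrite /s mulr_sumr; apply: eq_bigr => i _.
    by rewrite /F patchE indicE; case: ifP => _; rewrite ?mulr1 ?mulr0 1?mulrC.
  rewrite Rintegral_sum//; apply: eq_bigr => i _.
  rewrite RintegralZl//; congr (_ * fine _).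
  transitivity (\int[mu]_(x in `[a, b[) ((EFin \o f) \_ (J n i)) x)%E; last first.
    by rewrite restrict_EFin.
  rewrite -integral_mkcondr setIidr// => x; rewrite /J /= !in_itv/= => /andP[ix xi].
  have /andP[ai _] := node_between ab (ltnW (ltn_ord i)).
  have /andP[_ ib] := node_between ab (ltn_ord i).
  by rewrite (le_trans ai ix) (lt_le_trans xi ib).
have sM n x : a <= x < b -> `|s n x| <= M.
  move=> xab; have [i ni xi] := node_cover n xab.
  by rewrite (sE n i)//; apply/GM/nodeI/ltnW.
have mfs n : measurable_fun (`[a, b[%classic : set (measurableTypeR R))
    (fun x => (f x * s n x)%:E).
  by apply/measurable_EFinP; apply: measurable_funTS; exact: measurable_funM.
have mfg : measurable_fun (`[a, b[%classic : set (measurableTypeR R))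
    (fun x => (f x * g x)%:E).
  by apply/measurable_EFinP; apply: measurable_funTS; exact: measurable_funM.
have cv : \forall x \ae mu, `[a, b[%classic x ->
    (f x * s n x)%:E @[n --> \oo] --> (f x * g x)%:E.
  apply: aeS Gg => x Gg; rewrite /= in_itv/= => xab; have [ax xb] := andP xab.
  have [|Gc Gx] := Gg; first by apply: (oo_between Ia Ib); rewrite ax ltW.
  apply: cvg_EFin; first exact: nearW.
  apply: cvgM; first exact: cvg_cst.
  rewrite -Gx; apply/cvgrPdist_le => e e0.
  move/cvgrPdist_le : Gc => /(_ _ e0) [del /= del0 Gdel].
  near=> n; have [i ni xi] := node_cover n xab; rewrite (sE n i)//.
  apply: Gdel => /=; have [ix xi'] := andP xi.
  rewrite ger0_norm ?subr_ge0//.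
  apply: (@lt_trans _ _ (node a b n i.+1 - node a b n i)); first by rewrite ltrD2r.
  rewrite nodeS ltr_pdivrMr// mulrC -ltr_pdivrMr//.
  apply: (@le_lt_trans _ _ n%:R); last by rewrite ltr_nat.
  near: n; exact: nbhs_infty_ger.
have igM : mu.-integrable `[a, b[ (EFin \o (fun x => M * `|f x|)).
  by apply: RintegrableZl => //; apply: eq_integrable (integrable_abse ifi).
have dom : \forall x \ae mu, forall n, `[a, b[%classic x ->
    (`|(f x * s n x)%:E| <= (M * `|f x|)%:E)%E.
  apply: aeW => x n; rewrite /= in_itv/= => xab.
  by rewrite lee_fin normrM mulrC ler_wpM2r// sM.
have [ifg _ C] := dominated_convergence mi mfs mfg cv igM dom.
by apply: fine_cvg; rewrite fineK//; exact: integrable_fin_num ifg.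
Unshelve. all: by end_near. Qed.

Lemma bpv_by_node_sum (r : R -> R) (L a b : R) n : bpv_by I r L ->
  I a -> I b -> a <= b ->
  \sum_(i < n.+1) `|r (node a b n i.+1) - r (node a b n i)| <= L.
Proof.
move=> rL Ia Ib ab; pose t i := node a b n (minn i n.+1).
have -> : \sum_(i < n.+1) `|r (node a b n i.+1) - r (node a b n i)| =
    \sum_(i < n.+1) `|r (t i.+1) - r (t i)|.
  apply: eq_bigr => i _.
  by rewrite /t (minn_idPl (ltn_ord i)) (minn_idPl (ltnW (ltn_ord i))).
apply: bpv_by_sum rL _ _ => [i j ij|i].
  by apply: node_homo => //; rewrite leq_min geq_minr andbT (leq_trans (geq_minl _ _) ij).
apply: (oo_between Ia Ib); apply: node_between => //; exact: geq_minr.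
Qed.

Lemma abel_sum (F G : nat -> R) n :
  \sum_(i < n) G i * (F i.+1 - F i) =
  G n * F n - G 0%N * F 0%N - \sum_(i < n) F i.+1 * (G i.+1 - G i).
Proof.
elim: n => [|n IH]; first by rewrite !big_ord0; ring.
by rewrite !big_ord_recr/= IH; ring.
Qed.

Variables (v g r : R -> R) (M L b0 : R).
Hypothesis lv : locint c d v.
Notation V := (prim c v).
Hypothesis Vgt0 : forall x, I x -> 0 < V x.
Hypothesis mg : measurable_fun setT g.
Hypothesis gM : forall x, `|g x| <= M.
Hypothesis Ib0 : I b0.
Hypothesis g0 : forall x, b0 <= x -> g x = 0.
Hypothesis rg : \forall x \ae mu, I x -> {for x, continuous r} /\ r x = V x * g x.
Hypothesis rM : forall x, I x -> `|r x| <= M * V x.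
Hypothesis r0 : r b0 = 0.
Hypothesis rL : bpv_by I r L.

Lemma locint_mul_bounded f : locint c d f -> locint c d (fun x => f x * g x).
Proof.
move=> lf; apply: (@locint_le _ _ _ _ (fun x => M * f x)).
- by apply: measurable_funM => //; case: lf.
- exact: locintZ.
- by move=> x Ix; rewrite !normrM mulrC ler_wpM2r// (le_trans (gM x))// ler_norm.
Qed.

(** With [G = r / V], which is [g] almost everywhere, Abel summation over a
   partition turns the integral of [f g] into a sum of values of [prim c f]
   times the increments of [G], and
   [(G_(i+1) - G_i) V_(i+1) = r_(i+1) - r_i - G_i (V_(i+1) - V_i)]. The factor
   [1 / V_(i+1)] is absorbed by the bound on [prim c f]. *)
Lemma dual_bound_co (f : R -> R) (N a : R) : locint c d f -> 0 <= N ->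
  (forall x, I x -> `|prim c f x| <= N * V x) -> I a -> a <= b0 ->
  `|\int[mu]_(x in `[a, b0[) (f x * g x)| <=
  M * `|prim c f a| + N * (L + \int[mu]_(x in `[a, b0[) (`|v x| * `|g x|)).
Proof.
move=> lf N0 fN Ia ab.
pose G x := r x / V x.
have GM x : I x -> `|G x| <= M.
  move=> Ix; rewrite /G normrM normfV (gtr0_norm (Vgt0 Ix)) ler_pdivrMr ?Vgt0//.
  exact: rM.
have Gg : \forall x \ae mu, I x -> {for x, continuous G} /\ G x = g x.
  apply: aeS rg => x rx Ix; have [rc rE] := rx Ix.
  have V0 : V x != 0 by rewrite gt_eqF// Vgt0.
  split; last by rewrite /G rE mulrAC divff// mul1r.
  apply: continuousM => //; apply: continuousV => //.
  exact: prim_continuous lv Ix.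
have Gg' : \forall x \ae mu, I x ->
    {for x, continuous (fun y => `|G y|)} /\ `|G x| = `|g x|.
  apply: aeS Gg => x Gx Ix; have [Gc ->] := Gx Ix; split => //.
  exact: (continuous_comp Gc (@norm_continuous _ _ _)).
have GM' x : I x -> `| `|G x| | <= M by move=> Ix; rewrite normr_id; exact: GM.
have mg' : measurable_fun setT (fun x => `|g x|) by exact: measurableT_comp.
have C1 := riemann_sum_cvg lf GM mg Gg Ia Ib0 ab.
have C2 := riemann_sum_cvg (locint_abs lv) GM' mg' Gg' Ia Ib0 ab.
apply: (ler_cvg_to (cvg_norm C1)
  (cvgD (cvg_cst (M * `|prim c f a|)) (cvgM (cvg_cst N) (cvgD (cvg_cst L) C2)))).
apply: nearW => n.
pose t i := node a b0 n i.
have tI i : (i <= n.+1)%N -> I (t i).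
  by move=> ni; apply: (oo_between Ia Ib0); exact: node_between.
have tS i : t i <= t i.+1 by exact: node_homo.
have intE h i : locint c d h -> (i < n.+1)%N ->
    \int[mu]_(x in `[t i, t i.+1[) h x = prim c h (t i.+1) - prim c h (t i).
  move=> lh ni; rewrite (prim_sub lh)//; first exact: (tI _ (ltnW ni)).
  exact: (tI _ ni).
have -> : \sum_(i < n.+1) G (t i) * \int[mu]_(x in `[t i, t i.+1[) f x =
    \sum_(i < n.+1) G (t i) * (prim c f (t i.+1) - prim c f (t i)).
  by apply: eq_bigr => i _; rewrite intE.
rewrite (abel_sum (fun i => prim c f (t i)) (fun i => G (t i))).
rewrite {1}/t node_last {1}/G r0 !mul0r sub0r.
apply: (le_trans (ler_normB _ _)); rewrite normrN normrM /t node0 -/(t _).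
apply: lerD; first by rewrite ler_wpM2r// GM.
apply: (le_trans (ler_norm_sum _ _ _)).
apply: (@le_trans _ _ (\sum_(i < n.+1) N * (`|r (t i.+1) - r (t i)| +
    `|G (t i)| * \int[mu]_(x in `[t i, t i.+1[) `|v x|))).
  apply: ler_sum => i _.
  have Ii : I (t i) by apply: tI; exact: ltnW.
  have Ii1 : I (t i.+1) by apply: tI.
  have V0 := Vgt0 Ii; have V1 := Vgt0 Ii1.
  have -> : G (t i.+1) - G (t i) = (V (t i.+1))^-1 *
      (r (t i.+1) - r (t i) - G (t i) * (V (t i.+1) - V (t i))).
    by rewrite /G; field; rewrite !gt_eqF.
  rewrite mulrA normrM ler_pM//.
    by rewrite normrM normfV (gtr0_norm V1) ler_pdivrMr// fN.
  apply: (le_trans (ler_normB _ _)); rewrite lerD2l normrM ler_wpM2l//.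
  exact: (normr_prim_sub lv).
rewrite -mulr_sumr ler_wpM2l// big_split/= lerD2r.
exact: bpv_by_node_sum.
Qed.

(** The previous bound in the limit [a -> c], where the boundary terms vanish;
   to the right of [b0], [g] is null. *)
Lemma dual_bound (f : R -> R) (N : R) : locint c d f -> 0 <= N ->
  (forall x, I x -> `|prim c f x| <= N * V x) ->
  mu.-integrable I (EFin \o (fun x => v x * g x)) ->
  mu.-integrable I (EFin \o (fun x => f x * g x)) /\
  `|\int[mu]_(x in I) (f x * g x)| <= N * (L + \int[mu]_(x in I) `|v x * g x|).
Proof.
move=> lf N0 fN ivg.
have mI : measurable (I : set (measurableTypeR R)) := measurable_oo c d.
have mo : measurable (oo c b0%:E : set (measurableTypeR R)) := measurable_oo _ _.
have lfg := locint_mul_bounded lf.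
have IE : I `&` oo c b0%:E = oo c b0%:E by rewrite setIidr//; exact: sub_oo.
have fgI : {in I, EFin \o (fun x => f x * g x) =1 (EFin \o (fun x => f x * g x)) \_ (oo c b0%:E)}.
  move=> x /set_mem Ix; rewrite patchE; case: ifPn => // /negP nx.
  rewrite /= g0 ?mulr0// leNgt; apply/negP => xb; apply: nx; apply/mem_set.
  by apply/andP; split => //; case/andP: Ix.
have ifg : mu.-integrable I (EFin \o (fun x => f x * g x)).
  have : mu.-integrable I ((EFin \o (fun x => f x * g x)) \_ (oo c b0%:E)).
    apply: (@integrableS _ _ _ mu setT) => //.
    by apply/(integrable_mkcond _ mo); case: lfg => _; exact.
  by apply: eq_integrable => // x xI; rewrite fgI.
split => //.
have fgP : \int[mu]_(x in I) (f x * g x) = prim c (fun x => f x * g x) b0.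
  rewrite /prim /Rintegral -[in RHS]IE integral_mkcondr; congr fine.
  by apply: eq_integral => x xI; rewrite -fgI.
have W : forall a, I a -> a <= b0 ->
   \int[mu]_(x in `[a, b0[) (`|v x| * `|g x|) <= \int[mu]_(x in I) `|v x * g x|.
  move=> a Ia ab; have sI : `[a, b0[%classic `<=` I.
    by move=> x; rewrite /= in_itv/= => /andP[ax /ltW xb]; apply: (oo_between Ia Ib0); rewrite ax.
  have mi : measurable (`[a, b0[%classic : set (measurableTypeR R)).
    exact: measurable_itv.
  have ia : mu.-integrable I (EFin \o (fun x => `|v x * g x|)).
    by apply: eq_integrable (integrable_abse ivg).
  under eq_Rintegral do rewrite -normrM.
  rewrite /Rintegral; apply: fine_le.
  - by apply: integrable_fin_num => //; apply: integrableS ia.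
  - exact: integrable_fin_num ia.
  - apply: ge0_subset_integral => //.
    by case/integrableP : ia.
rewrite fgP; apply/ler_addgt0Pr => e e0.
have M0 : 0 <= M by exact: le_trans (gM 0).
(* The two boundary terms at [a] are at most [2 * M] times the integral of [|f|]
   over [(c, a)]. *)
have e1 : 0 < e / (2 * M + 1) by rewrite divr_gt0// ltr_wpDl// mulr_ge0.
have [a1 Ia1 fa] := prim_cvg0 lf Ib0 e1.
pose a := Num.min a1 b0.
have Ia : I a by rewrite /a minEle; case: ifP.
have ab : a <= b0 by rewrite /a ge_min lexx orbT.
have {}fa : prim c (fun t => `|f t|) a < e / (2 * M + 1).
  by apply: fa => //; rewrite /a ge_min lexx.
have H1 : `|prim c (fun x => f x * g x) a| <= M * prim c (fun t => `|f t|) a.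
  apply: (le_trans (prim_le_abs lfg Ia)); rewrite -(primZ _ (locint_abs lf))//.
  apply: le_Rintegral => //.
  - exact: measurable_oo.
  - by case: (locint_abs lfg) => _; exact.
  - by case: (locintZ M (locint_abs lf)) => _; exact.
  - by move=> x _; rewrite normrM mulrC ler_wpM2r.
have H2 := dual_bound_co lf N0 fN Ia ab.
rewrite -(prim_sub lfg)// in H2.
have H3 : N * (L + \int[mu]_(x in `[a, b0[) (`|v x| * `|g x|)) <=
  N * (L + \int[mu]_(x in I) `|v x * g x|) by rewrite ler_wpM2l// lerD2l W.
have H4 := prim_le_abs lf Ia.
have H5 : 2 * M * prim c (fun t => `|f t|) a <= e.
  apply: (@le_trans _ _ (2 * M * (e / (2 * M + 1)))).
    by rewrite ler_wpM2l ?mulr_ge0// ltW.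
  rewrite mulrCA ger_pMr// ler_pdivrMr ?mul1r ?lerDl//.
  by rewrite ltr_wpDl// mulr_ge0.
have H6 := ler_normD (prim c (fun x => f x * g x) b0 - prim c (fun x => f x * g x) a)
  (prim c (fun x => f x * g x) a).
rewrite subrK in H6.
have H7 : M * `|prim c f a| <= M * prim c (fun t => `|f t|) a by rewrite ler_wpM2l.
apply: (le_trans H6); apply: (le_trans (lerD H2 H1)).
rewrite addrAC addrC lerD// (le_trans (lerD H7 (lexx _)))//.
by rewrite -mulr2n -[_ *+ 2]mulr_natl mulrA.
Qed.

End riemann_sums.

(** * Stieltjes charges *)

Lemma fin_num_subC (R : realType) (x y z t : \bar R) : x \is a fin_num ->
  y \is a fin_num -> z \is a fin_num -> t \is a fin_num ->
  (z - t = x - y -> x + t = y + z)%E.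
Proof.
move: x y z t => [x| |] [y| |] [z| |] [t| |]//= _ _ _ _ [E].
by congr EFin; lra.
Qed.

Section stieltjes_charges.
Context {R : realType}.
Variables c d : \bar R.
Notation I := (oo c d).

(** A Lebesgue-Stieltjes measure needs a right-continuous function on the
   whole line: the right limits of [p], extended to the left of [I] by the
   infimum of [p] and to the right by [b]. *)
Lemma exists_cumulative (p : R -> R) (a b : R) :
  (forall x y, I x -> I y -> x <= y -> p x <= p y) ->
  (forall x, I x -> a <= p x <= b) -> a <= b ->
  exists C : cumulative R R, (forall x, a <= C x <= b) /\
    forall x, I x -> p y @[y --> x^'+] --> (C : R -> R) x.
Proof.
move=> pm pab ab.
pose A x := [set p y | y in [set y | I y /\ x < y]].
pose C x := if pselect (A x !=set0) then inf (A x) else b.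
have Alb x : has_lbound (A x).
  by exists a => _ [y [Iy _] <-]; case/andP: (pab _ Iy).
have Cy x y : I y -> x < y -> C x <= p y.
  move=> Iy xy; rewrite /C; case: pselect => /= [_|]; last by case; exists (p y), y.
  by apply: inf_lbound => //; exists y.
have Cle x r : (exists2 y, I y & x < y) -> (forall y, I y -> x < y -> r <= p y) -> r <= C x.
  move=> [y Iy xy] rp; rewrite /C; case: pselect => /= [A0|]; last by case; exists (p y), y.
  by apply: lb_le_inf => // _ [z [Iz xz] <-]; exact: rp.
have Cb x : C x <= b.
  rewrite /C; case: pselect => /= [[z [y [Iy xy] _]]|//].
  apply: (@le_trans _ _ (p y)); last by case/andP: (pab _ Iy).
  by apply: inf_lbound => //; exists y.
have aC x : a <= C x.
  rewrite /C; case: pselect => /= [A0|//].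
  by apply: lb_le_inf => // _ [y [Iy _] <-]; case/andP: (pab _ Iy).
have top x : ~ (exists2 y, I y & x < y) -> C x = b.
  move=> nx; rewrite /C; case: pselect => /= [|//] -[z [y [Iy xy] _]].
  by exfalso; apply: nx; exists y.
have Cnd : nondecreasing C.
  move=> x y xy; have [ey|ny] := pselect (exists2 z, I z & y < z); last by rewrite (top y).
  by apply: Cle => // z Iz yz; apply: Cy => //; exact: le_lt_trans yz.
have near_p x e : (exists2 y, I y & x < y) -> 0 < e -> exists2 y, I y & x < y /\ p y < C x + e.
  move=> ex e0; apply: contrapT => H.
  have : C x + e <= C x.
    apply: Cle => // y Iy xy; rewrite leNgt; apply/negP => py.
    by apply: H; exists y.
  by rewrite gerDl leNgt e0.
have Crc : right_continuous C.
  move=> x; have [ex|nx] := pselect (exists2 y, I y & x < y); last first.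
    have -> : C x = b by rewrite top.
    apply: cvg_near_cst; near=> y; rewrite top// => -[z Iz yz].
    apply: nx; exists z => //; apply: lt_trans yz; near: y; exact: nbhs_right_gt.
  apply/cvgrPdist_le => e e0; have [y Iy [xy py]] := near_p _ _ ex e0.
  near=> z; have xz : x < z by near: z; exact: nbhs_right_gt.
  have zy : z < y by near: z; exact: nbhs_right_lt.
  have Cxz : C x <= C z by apply: Cnd; exact: ltW.
  rewrite distrC ger0_norm ?subr_ge0// lerBlDl.
  apply: (le_trans (Cy _ _ Iy zy)); exact: ltW.
pose CC : cumulative R R := HB.pack C (isCumulative.Build _ _ _ C Cnd Crc).
exists CC; split=> [x|x Ix]; first by rewrite /= aC Cb.
have ex : exists2 y, I y & x < y.
  by have [b' [_ bI _ /(_ _ Ix)[n xb]]] := oo_exhaust_right Ix; exists (b' n).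
apply/cvgrPdist_le => e e0; have [y Iy [xy py]] := near_p _ _ ex e0.
near=> z; have xz : x < z by near: z; exact: nbhs_right_gt.
have zy : z < y by near: z; exact: nbhs_right_lt.
have Iz : I z by apply: (oo_between Ix Iy); rewrite !ltW.
rewrite /= distrC ger0_norm ?subr_ge0 ?Cy// lerBlDl.
apply: (le_trans (pm _ _ Iz Iy (ltW zy))); exact: ltW.
Unshelve. all: by end_near. Qed.

Local Open Scope ereal_scope.

Lemma exists_finite_stieltjes (C : cumulative R R) (a b : R) :
  (forall x, a <= C x <= b)%R ->
  exists m : {finite_measure set (measurableTypeR R) -> \bar R},
    (forall x y : R, (x <= y)%R -> m `]x, y]%classic = (C y - C x)%:E) /\
    m setT <= (b - a)%:E.
Proof.
move=> Cab; pose m := lebesgue_stieltjes_measure C.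
have mE (x y : R) : (x <= y)%R -> m `]x, y]%classic = (C y - C x)%:E.
  move=> xy; rewrite /m /lebesgue_stieltjes_measure /measure_extension.
  by rewrite measurable_mu_extE/=; [rewrite wlength_itv_bnd|exact: is_ocitv].
have mT : m setT <= (b - a)%:E.
  pose F n : set (measurableTypeR R) := `](- n%:R)%R, n%:R]%classic.
  have mF n : measurable (F n) by exact: measurable_itv.
  have TE : setT = \bigcup_n F n.
    apply/seteqP; split => // x _; exists (Num.truncn `|x|%R).+1 => //.
    rewrite /F/= in_itv/=; have := truncnS_gt `|x|%R.
    by rewrite ltr_norml => /andP[-> /ltW].
  have FE n : m (F n) <= (b - a)%:E.
    rewrite /F mE ?lee_fin; last by rewrite ge0_cp ?ler0n.
    have /andP[_ Cb] := Cab n%:R; have /andP[aC _] := Cab (- n%:R)%R.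
    by rewrite lerB.
  rewrite TE.
  have mU : measurable (\bigcup_n F n) by exact: bigcupT_measurable.
  have ndF : {homo F : n k / (n <= k)%N >-> (n <= k)%O}.
    move=> n k nk; apply/subsetPset => x; rewrite /F/= !in_itv/= => /andP[nx xn].
    rewrite (le_trans xn) ?ler_nat// andbT (le_lt_trans _ nx)//.
    by rewrite lerN2 ler_nat.
  have cv := @nondecreasing_cvg_mu _ _ _ m F mF mU ndF.
  have -> : m (\bigcup_n F n) = limn (m \o F) by apply/esym/cvg_lim.
  apply: lime_le; first by apply/cvg_ex; eexists; exact: cv.
  exact: nearW.
have fin : fin_num_fun m.
  move=> A mA; rewrite ge0_fin_numE// (@le_lt_trans _ _ (b - a)%:E) ?ltry//.
  apply: le_trans mT; apply: le_measure; rewrite ?inE//.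
pose m' : {finite_measure set (measurableTypeR R) -> \bar R} :=
  HB.pack m (Measure_isFinite.Build _ _ _ m fin).
by exists m'.
Qed.

Variables (f r : R -> R) (L : R).
Hypothesis fr : forall x, I x -> f y @[y --> x^'+] --> r x.
Hypothesis rL : bpv_by I r L.
Hypothesis I0 : I !=set0.

Lemma right_lim_right_continuous x : I x -> r y @[y --> x^'+] --> r x.
Proof.
move=> Ix; have /cvgrPdist_le fx := fr Ix.
apply/cvgrPdist_le => e e0; have [del /= del0 fe] := fx _ e0.
have [b [_ bI _ /(_ _ Ix)[n xb]]] := oo_exhaust_right Ix.
near=> y; have xy : (x < y)%R by near: y; exact: nbhs_right_gt.
have yb : (y < b n)%R by near: y; exact: nbhs_right_lt.
have yd : (y < x + del)%R by near: y; apply: nbhs_right_lt; rewrite ltrDl.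
have Iy : I y by apply: (oo_between Ix (bI n)); rewrite !ltW.
have D : (`|r x - f z| @[z --> y^'+] --> `|r x - r y|)%R.
  by apply: cvg_norm; apply: cvgB; [exact: cvg_cst|exact: fr].
have S : closed [set z : R | (z <= e)%R] by exact: closed_le.
apply: (@closed_cvg _ _ _ _ _ _ S _ _ D); near=> z.
have yz : (y < z)%R by near: z; exact: nbhs_right_gt.
have zd : (z < x + del)%R by near: z; exact: nbhs_right_lt.
apply: fe => /=; last exact: lt_trans yz.
by rewrite distrC gtr0_norm ?subr_gt0 ?(lt_trans xy)// ltrBlDl.
Unshelve. all: by end_near. Qed.

(** [r] is the difference of [T] and [T - r], where [T x] is the variation of
   [r] up to [x]; their oscillations are at most [L] and [2 * L]. *)
Lemma exists_jordan_measures :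
  exists m1 m2 : {finite_measure set (measurableTypeR R) -> \bar R},
  [/\ forall x y, I x -> I y -> (x <= y)%R ->
        m1 `]x, y]%classic - m2 `]x, y]%classic = (r y - r x)%:E,
      m1 setT <= L%:E & m2 setT <= (2 * L)%:E].
Proof.
have [T [TL rT]] := bpv_by_cumulative rL.
have [x0 Ix0] := I0.
have pm x y : I x -> I y -> (x <= y -> T x <= T y)%R.
  by move=> Ix Iy xy; rewrite -subr_ge0 (le_trans _ (rT _ _ Ix Iy xy)).
pose q x := (T x - r x)%R.
have qT x y : I x -> I y -> (x <= y)%R -> (0 <= q y - q x <= 2 * (T y - T x))%R.
  move=> Ix Iy xy; have := rT _ _ Ix Iy xy; rewrite ler_norml /q => /andP[H1 H2].
  by apply/andP; split; lra.
have L0 : (0 <= L)%R by have /andP[] := TL _ Ix0; exact: le_trans.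
have [C1 [C1b C1l]] := exists_cumulative pm TL L0.
(* The increments of [q] are at most twice those of [T], which takes its values
   in [[0, L]]. *)
have [||| C2 [C2b C2l]] := @exists_cumulative q (q x0 - 2 * T x0) (q x0 + 2 * (L - T x0)).
- by move=> x y Ix Iy xy; rewrite -subr_ge0; case/andP: (qT _ _ Ix Iy xy).
- move=> x Ix; have /andP[Tx0 TxL] := TL _ Ix; have /andP[T0 T0L] := TL _ Ix0.
  have [xx0|/ltW x0x] := leP x x0.
    by have /andP[? ?] := qT _ _ Ix Ix0 xx0; apply/andP; split; lra.
  by have /andP[? ?] := qT _ _ Ix0 Ix x0x; apply/andP; split; lra.
- by lra.
have C12 x : I x -> (C1 x - C2 x = r x)%R.
  move=> Ix; have C : (r y @[y --> x^'+] --> C1 x - C2 x)%R.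
    rewrite (_ : r = T \- q)%R; first exact: cvgB (C1l _ Ix) (C2l _ Ix).
    by apply/funext => y; rewrite /q /=; ring.
  exact: (cvg_unique _ C (right_lim_right_continuous Ix)).
have [m1 [m1E m1T]] := exists_finite_stieltjes C1b.
have [m2 [m2E m2T]] := exists_finite_stieltjes C2b.
exists m1, m2; split.
- move=> x y Ix Iy xy; rewrite m1E// m2E// -EFinB; congr EFin.
  by rewrite -!C12//; ring.
- by rewrite -[L]subr0.
- apply: (le_trans m2T); rewrite lee_fin; lra.
Qed.

Lemma exists_is_stieltjes : exists nu, is_stieltjes I f nu.
Proof.
have [m1 [m2 [mE _ _]]] := exists_jordan_measures.
have mI : measurable (I : set (measurableTypeR R)) := measurable_oo c d.
pose nu : {charge set (measurableTypeR R) -> \bar R} :=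
  crestr0 (cadd (charge_of_finite_measure m1)
             (cscale (-1) (charge_of_finite_measure m2))) mI.
exists nu; split=> [A mA|a b Ia Ib ab].
  rewrite /nu/= /crestr0 !mem_set//; last exact: measurableI.
  by rewrite /crestr -setIA setIid.
rewrite /nu/= /crestr0 mem_set; last exact: measurable_itv.
rewrite /crestr setIidl; last first.
  move=> x; rewrite /= in_itv/= => /andP[/ltW ax xb].
  by apply: (oo_between Ia Ib); rewrite ax.
rewrite /cadd /= /cscale mulN1e [LHS](mE _ _ Ia Ib ab).
by rewrite (cvg_lim _ (fr Ia))// (cvg_lim _ (fr Ib)).
Qed.

Lemma is_stieltjes_oc (nu : {charge set (measurableTypeR R) -> \bar R}) a b :
  is_stieltjes I f nu -> I a -> I b -> (a <= b)%R ->
  nu `]a, b]%classic = (r b - r a)%:E.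
Proof.
move=> [_ nuE] Ia Ib ab; rewrite nuE//.
by rewrite (cvg_lim _ (fr Ia))// (cvg_lim _ (fr Ib)).
Qed.

(** The intervals which reach an end point of [I] are exhausted from inside by
   intervals with end points in [I]. *)
Lemma measure_oc_unique (m1 m2 : {measure set (measurableTypeR R) -> \bar R}) :
  (forall a b, I a -> I b -> (a <= b)%R -> m1 `]a, b]%classic = m2 `]a, b]%classic) ->
  m1 setT < +oo ->
  forall A : set (measurableTypeR R), measurable A -> m1 (A `&` I) = m2 (A `&` I).
Proof.
move=> m12 m1T A mA.
have mI : measurable (I : set (measurableTypeR R)) := measurable_oo c d.
have [x0 Ix0] := I0.
have [al [_ aI ania acof]] := oo_exhaust_left Ix0.
have [be [_ bI bndb bcof]] := oo_exhaust_right Ix0.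
suff : mrestr m1 mI A = mrestr m2 mI A by [].
have mG : @measurable _ (measurableTypeR R) = <<s @ocitv R >> by [].
apply: (@measure_unique _ _ (measurableTypeR R) (@ocitv R)
  (fun n => `](- n%:R)%R, n%:R]%classic) mG _ _ _ (mrestr m1 mI) (mrestr m2 mI)) => //.
- exact: ocitvI.
- by move=> n; exact: is_ocitv.
- apply/seteqP; split => // x _; exists (Num.truncn `|x|%R).+1 => //.
  rewrite /= in_itv/=; have := truncnS_gt `|x|%R.
  by rewrite ltr_norml => /andP[-> /ltW].
- move=> _ [[a b] _ <-] /=.
  pose F n : set (measurableTypeR R) := `]Num.max a (al n), Num.min b (be n)]%classic.
  have mF n : measurable (F n) by exact: measurable_itv.
  have UE : `]a, b]%classic `&` I = \bigcup_n F n.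
    apply/seteqP; split => [x|x [n _]]; rewrite /F /= !in_itv/=.
      move=> [/andP[ax xb] Ix].
      have [n anx] := acof _ Ix; have [k xbk] := bcof _ Ix.
      exists (n + k)%N => //=; rewrite in_itv/= gt_max ax le_min xb/=.
      rewrite (le_lt_trans _ anx) ?ania ?leq_addr//=.
      by rewrite (le_trans (ltW xbk))// bndb// leq_addl.
    rewrite gt_max le_min => /andP[/andP[-> ax] /andP[-> xb]]; split => //.
    by apply: (oo_between (aI n) (bI n)); rewrite xb ltW.
  have mU : measurable (\bigcup_n F n) by exact: bigcupT_measurable.
  have ndF : {homo F : n k / (n <= k)%N >-> (n <= k)%O}.
    move=> n k nk; apply/subsetPset => x; rewrite /F/= !in_itv/= !gt_max !le_min.
    move=> /andP[/andP[-> ax] /andP[-> xb]] /=.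
    by rewrite (le_lt_trans (ania _ _ nk) ax) (le_trans xb)// bndb.
  have FE n : m1 (F n) = m2 (F n).
    have [ab|ba] := leP (Num.max a (al n)) (Num.min b (be n)).
      apply: m12 => //; apply: (oo_between (aI n) (bI n)).
        by rewrite le_max lexx orbT (le_trans ab)// ge_min lexx orbT.
      by rewrite ge_min lexx orbT andbT (le_trans _ ab)// le_max lexx orbT.
    by rewrite /F set_itv_ge ?measure0// bnd_simp -leNgt ltW.
  rewrite /mrestr UE.
  have c1 := @nondecreasing_cvg_mu _ _ _ m1 F mF mU ndF.
  have c2 := @nondecreasing_cvg_mu _ _ _ m2 F mF mU ndF.
  have E : m1 \o F = m2 \o F by apply/funext => n /=; exact: FE.
  rewrite E in c1; exact: (cvg_unique _ c1 c2).
- move=> n; rewrite /mrestr; apply: le_lt_trans m1T.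
  apply: le_measure; rewrite ?inE//.
  by apply: measurableI => //; exact: measurable_itv.
Qed.

(** On the positive set of a Hahn decomposition, where [nu] is its positive
   part, [nu + m2 = m1] gives [nu <= m1]; likewise [- nu <= m2] on the
   negative set. Hence the constant [3 = 1 + 2]. *)
Lemma total_var_le (nu : {charge set (measurableTypeR R) -> \bar R}) :
  is_stieltjes I f nu -> total_var nu I <= (3 * L)%:E.
Proof.
move=> nuf; have [m1 [m2 [mE m1L m2L]]] := exists_jordan_measures.
have mI : measurable (I : set (measurableTypeR R)) := measurable_oo c d.
rewrite /total_var; case: cid => P HP; case: cid => N nuPN.
have [[mP _] [mN _] _ PN0] := nuPN.
pose jp := jordan_pos nuPN; pose jn := jordan_neg nuPN.
have nuE (A : set (measurableTypeR R)) : measurable A -> nu A = jp A - jn A.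
  by move=> mA; rewrite (jordan_decomp nuPN)// /cadd /= /cscale mulN1e.
have fin (m : {finite_measure set (measurableTypeR R) -> \bar R}) A :
    measurable A -> m A \is a fin_num by move=> mA; exact: fin_num_measure.
have key A : measurable A -> jp (A `&` I) + m2 (A `&` I) = jn (A `&` I) + m1 (A `&` I).
  move=> mA.
  rewrite -(measure_addE jp m2) -(measure_addE jn m1); apply: measure_oc_unique => //.
  - move=> a b Ia Ib ab; rewrite [LHS](measure_addE jp m2) [RHS](measure_addE jn m1).
    have mab : measurable (`]a, b]%classic : set (measurableTypeR R)).
      exact: measurable_itv.
    apply: fin_num_subC; [exact: fin_num_measure..|].
    by rewrite (mE _ _ Ia Ib ab) -(is_stieltjes_oc nuf Ia Ib ab) nuE.
  - by rewrite [ltLHS](measure_addE jp m2) ltey_eq fin_numD fin// fin.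
have jpI : jp I <= L%:E.
  have -> : jp I = jp (P `&` I).
    rewrite /jp !jordan_posE !cjordan_posE /crestr0 !mem_set//; last exact: measurableI.
    by rewrite /crestr setIAC setIid setIC.
  have jn0 : jn (P `&` I) = 0.
    rewrite /jn jordan_negE cjordan_negE /crestr0 mem_set//; last exact: measurableI.
    by rewrite /crestr setIAC PN0 set0I charge0 oppe0.
  have := key _ mP; rewrite jn0 add0e => E.
  apply: le_trans m1L; apply: (@le_trans _ _ (m1 (P `&` I))).
    by rewrite -E leeDl.
  by apply: le_measure; rewrite ?inE//; exact: measurableI.
have jnI : jn I <= (2 * L)%:E.
  have -> : jn I = jn (N `&` I).
    rewrite /jn !jordan_negE !cjordan_negE /crestr0 !mem_set//; last exact: measurableI.
    by rewrite /crestr setIAC setIid setIC.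
  have jp0 : jp (N `&` I) = 0.
    rewrite /jp jordan_posE cjordan_posE /crestr0 mem_set//; last exact: measurableI.
    by rewrite /crestr setIAC [N `&` P]setIC PN0 set0I charge0.
  have := key _ mN; rewrite jp0 add0e => E.
  apply: le_trans m2L; apply: (@le_trans _ _ (m2 (N `&` I))).
    by rewrite E leeDl.
  by apply: le_measure; rewrite ?inE//; exact: measurableI.
rewrite (_ : 3 * L = L + 2 * L)%R; last by ring.
by rewrite EFinD /charge_variation /=; exact: leeD.
Qed.

(** The variation of a charge is additive over consecutive intervals. *)
Lemma bpv_by_total_var (nu : {charge set (measurableTypeR R) -> \bar R}) :
  is_stieltjes I f nu -> bpv_by I r (fine (total_var nu I)).
Proof.
move=> nuf; have mI : measurable (I : set (measurableTypeR R)) := measurable_oo c d.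
apply: bpv_by_of_sum; last by move=> a b x; exact: oo_between.
move=> t n tm tI; rewrite /total_var; case: cid => P HP; case: cid => N nuPN.
pose cv := charge_variation nuPN.
have cvfin A : measurable A -> cv A \is a fin_num.
  by move=> mA; exact: fin_num_measure.
rewrite -lee_fin fineK; last exact: cvfin.
have mt x y : measurable (`]x, y]%classic : set (measurableTypeR R)).
  exact: measurable_itv.
apply: (@le_trans _ _ (cv `]t 0%N, t n]%classic)); last first.
  apply: le_measure; rewrite ?inE// => x; rewrite /= in_itv/= => /andP[/ltW ax xb].
  by apply: (oo_between (tI 0%N) (tI n)); rewrite ax.
elim: n => [|n IH]; first by rewrite big_ord0; exact: measure_ge0.
rewrite big_ord_recr/= EFinD.
have -> : `]t 0%N, t n.+1]%classic = `]t 0%N, t n]%classic `|` `]t n, t n.+1]%classic.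
  apply/seteqP; split => x; rewrite /= !in_itv/=.
    by move=> /andP[-> ->]; rewrite andbT; case: (leP x (t n)); [left|right].
  move=> [/andP[-> xn]|/andP[nx ->]].
    by rewrite (le_trans xn)// tm.
  by rewrite andbT (le_lt_trans _ nx)// tm.
have dis : `]t 0%N, t n]%classic `&` `]t n, t n.+1]%classic = set0.
  apply/seteqP; split => // x [] /=; rewrite !in_itv/= => /andP[_ xn] /andP[nx _].
  by rewrite ltNge xn in nx.
rewrite [leRHS](measureU cv (mt _ _) (mt _ _) dis).
apply: leeD => //.
have := abse_charge_variation nuPN (mt (t n) (t n.+1)).
by rewrite (is_stieltjes_oc nuf)// tm.
Qed.

End stieltjes_charges.

(** * From classes to representatives *)

Section representatives.
Context {R : realType}.
Notation mu := (@lebesgue_measure R).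
Notation lam := (@lambda1 R).
Variables c d : \bar R.
Notation I := (oo c d).
Local Open Scope ereal_scope.

Lemma measurable_oo_leb (a b : \bar R) : measurable (oo a b : set (leb R)).
Proof. by apply: borel_leb; exact: measurable_oo. Qed.

Lemma integral_repr (D : set R) (f h : R -> \bar R) :
  measurable D -> D `<=` I -> L0 I f -> measurable_fun setT h -> eq_ae I f h ->
  \int[lam]_(x in D) f x = \int[mu]_(x in D) h x.
Proof.
move=> mD DI mf mh fh; rewrite -integral_leb//; last exact: measurable_funTS.
apply: ae_eq_integral.
- exact: borel_leb.
- by apply: measurable_funS mf => //; exact: measurable_oo_leb.
- by apply: measurable_fun_leb => //; exact: measurable_funTS.
- by apply: aeS fh => x fh /DI.
Qed.

Lemma eq_ae_abse (D : set R) (f h : R -> \bar R) : eq_ae D f h ->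
  eq_ae D (fun x => `|f x|) (fun x => `|h x|).
Proof. by apply: aeS => x fh Dx; rewrite fh. Qed.

Lemma L0_abse (D : set R) (f : R -> \bar R) : L0 D f -> L0 D (fun x => `|f x|).
Proof. exact: measurableT_comp. Qed.

Lemma L1norm_repr (D : set R) (f h : R -> \bar R) :
  measurable D -> D `<=` I -> L0 I f -> measurable_fun setT h -> eq_ae I f h ->
  L1norm D f = \int[mu]_(x in D) `|h x|.
Proof.
move=> mD DI mf mh fh; apply: (@integral_repr _ (fun x => `|f x|)) => //.
- exact: L0_abse.
- exact: measurableT_comp.
- exact: eq_ae_abse.
Qed.

Lemma L1loc_repr (f : R -> \bar R) : I !=set0 -> L1loc c d f -> exists f' : R -> R,
  [/\ locint c d f', eq_ae I f (EFin \o f') &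
      forall x, I x -> primitive c f x%:E = (prim c f' x)%:E].
Proof.
move=> [x0 Ix0] [mf Lf].
have mI : measurable (I : set R) by exact: measurable_oo.
have [f1 mf1 ff1] := leb_borel_repr mI mf.
have if1 x : I x -> mu.-integrable (oo c x%:E) f1.
  move=> Ix; apply/integrableP; split; first exact: measurable_funTS.
  rewrite -(@L1norm_repr _ f)//; [exact: Lf|exact: measurable_oo|exact: sub_oo].
have [b [_ bI _ bcof]] := oo_exhaust_right Ix0.
have fin1 : \forall x \ae mu, I x -> f1 x \is a fin_num.
  have : \forall x \ae mu, forall n, oo c (b n)%:E x -> f1 x \is a fin_num.
    apply: ae_foralln => n; apply: integrable_ae (if1 _ (bI n)).
    exact: measurable_oo.
  apply: aeS => x Hx Ix; have [n xn] := bcof _ Ix.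
  by apply: (Hx n); apply/andP; split => //; case/andP: Ix.
pose f' x := fine (f1 x).
have mf' : measurable_fun setT f' by exact: measurableT_comp.
have lf' : locint c d f'.
  split => // x Ix; apply: le_integrable (if1 _ Ix); first exact: measurable_oo.
    by apply/measurable_EFinP; exact: measurable_funTS.
  move=> y _; rewrite /f' /=; case: (f1 y) => //= *; by rewrite normr0 leey.
have ff' : eq_ae I f (EFin \o f').
  apply/ae_lebP; apply: aeS2 fin1 ((ae_lebP _).1 ff1) => x fx E Ix.
  by rewrite E//= fineK// fx.
exists f'; split => // x Ix; rewrite /primitive (@integral_repr _ _ (EFin \o f'))//.
- rewrite /prim /Rintegral fineK//; apply: integrable_fin_num; first exact: measurable_oo.
  by case: lf' => _; exact.
- exact: measurable_oo.
- exact: sub_oo.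
- by apply/measurable_EFinP.
Qed.

Lemma locint_L1loc (f : R -> R) : locint c d f ->
  L1loc c d (EFin \o f) /\
  forall x, I x -> primitive c (EFin \o f) x%:E = (prim c f x)%:E.
Proof.
move=> [mf lf].
have m1 : measurable_fun setT (EFin \o f) by apply/measurable_EFinP.
have L0f : L0 I (EFin \o f).
  by apply: measurable_fun_leb; [exact: measurable_oo|exact: measurable_funTS].
have ff : eq_ae I (EFin \o f) (EFin \o f) by apply: aeW.
split; [split=> // x Ix|move=> x Ix].
  rewrite (@L1norm_repr _ _ (EFin \o f))//; [|exact: measurable_oo|exact: sub_oo].
  by case/integrableP: (lf _ Ix).
rewrite /primitive (@integral_repr _ _ (EFin \o f))//; [|exact: measurable_oo|exact: sub_oo].
rewrite /prim /Rintegral fineK//; apply: integrable_fin_num; first exact: measurable_oo.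
exact: lf.
Qed.

(** Every right neighbourhood of [x] in [I] has positive measure. *)
Lemma right_limit_ae_le (phi : R -> R) (x l : R) : I x ->
  phi y @[y --> x^'+] --> l ->
  (\forall y \ae mu, I y -> (x < y)%R -> (phi y <= 0)%R) -> (l <= 0)%R.
Proof.
move=> Ix /cvgrPdist_lt pl aephi; rewrite leNgt; apply/negP => l0.
have [del /= del0 pdel] := pl _ l0.
have [b [_ bI _ /(_ _ Ix)[n xb]]] := oo_exhaust_right Ix.
pose e := Num.min (b n) (x + del)%R.
have xe : (x < e)%R by rewrite lt_min xb ltrDl.
have [N [mN N0 sN]] := aephi.
have mJ : measurable (`]x, e[%classic : set (measurableTypeR R)) by exact: measurable_itv.
have : mu `]x, e[%classic <= mu N.
  apply: le_measure; rewrite ?inE// => y; rewrite /= in_itv/= lt_min.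
  move=> /andP[xy /andP[yb yd]]; apply: sN => /= H.
  have Iy : I y by apply: (oo_between Ix (bI n)); rewrite !ltW.
  have := H Iy xy; have := pdel y; rewrite /= distrC gtr0_norm ?subr_gt0// ltrBlDl.
  move=> /(_ yd xy) /(le_lt_trans (ler_norm _)); rewrite ltrBlDr ltrDl ltNge.
  by move=> /negP.
by rewrite [leRHS]N0 /= lebesgue_measure_itv/= lte_fin xe -EFinB lee_fin leNgt subr_gt0 xe.
Qed.

End representatives.

(** * The norm of [Ch] and its weak dual *)

Section dual_pairing.
Context {R : realType}.
Notation mu := (@lebesgue_measure R).
Notation lam := (@lambda1 R).
Variables c d : \bar R.
Notation I := (oo c d).
Local Open Scope ereal_scope.

Lemma bounded_repr (g : R -> \bar R) (M b : R) : (0 <= M)%R -> L0 I g ->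
  (\forall x \ae lam, I x -> `|g x| <= M%:E) -> I b ->
  eq_ae (oo b%:E d) g (cst 0) -> exists g' : R -> R,
  [/\ measurable_fun setT g', forall x, (`|g' x| <= M)%R,
      forall x, (b <= x)%R -> g' x = 0%R & eq_ae I g (EFin \o g')].
Proof.
move=> M0 mg gM Ib g0.
have mI : measurable (I : set R) by exact: measurable_oo.
have [g1 mg1 gg1] := leb_borel_repr mI mg.
pose D : set R := [set x | `|g1 x| <= M%:E] `&` `]-oo, b[%classic.
have mD : measurable D.
  apply: measurableI; last exact: measurable_itv.
  rewrite -[X in measurable X]setTI; apply: emeasurable_fun_infty_c => //.
  exact: measurableT_comp.
pose g' := (fine \o g1) \_ D.
have DE x : D x -> (EFin \o g') x = g1 x.
  move=> Dx; rewrite /g' /= patchE mem_set//= fineK//.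
  by rewrite fin_num_abs; case: Dx => + _; move/le_lt_trans; apply; rewrite ltry.
exists g'; split.
- apply/(measurable_restrictT _ mD); apply: measurable_funTS.
  exact: measurableT_comp.
- move=> x; rewrite -lee_fin; have [Dx|nD] := pselect (D x).
    by rewrite -abse_EFin [EFin _](DE _ Dx); case: Dx.
  by rewrite /g' patchE memNset// normr0 lee_fin.
- move=> x bx; rewrite /g' patchE memNset// => -[_] /=.
  by rewrite in_itv/= ltNge bx.
have nb : \forall x \ae lam, x <> b.
  apply/ae_lebP; exists [set b]; split => //; first exact: lebesgue_measure_set1.
  by move=> t /=; exact: contrapT.
apply: aeS2 (aeS2 (fun x H1 H2 => conj H1 H2) gM g0)
  (aeS2 (fun x H1 H2 => conj H1 H2) gg1 nb) => x [gMx g0x] [gg1x xb] Ix.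
have [Dx|nD] := pselect (D x); first by rewrite DE// gg1x.
rewrite /g' /= patchE memNset//.
have bx : (b < x)%R.
  rewrite lt_neqAle eq_sym; apply/andP; split; first exact/eqP.
  rewrite leNgt; apply/negP => bx; apply: nD; split => /=.
    by rewrite -gg1x// gMx.
  by rewrite in_itv.
by rewrite g0x//; apply/andP; split => //; case/andP: Ix.
Qed.

Variables (v : R -> \bar R) (v' : R -> R).
Hypothesis lv' : locint c d v'.
Notation V := (prim c v').
Hypothesis vV : forall x, I x -> primitive c v x%:E = (V x)%:E.
Hypothesis Vgt0 : forall x, I x -> (0 < V x)%R.
Notation w := (fun x : R => (primitive c v x%:E)^-1).

(** The functions compared are continuous, so that a bound almost everywhere
   is a bound everywhere. *)
Lemma Ch_normP (f : R -> \bar R) (F : R -> R) (N : R) :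
  (forall x, I x -> primitive c f x%:E = (F x)%:E) ->
  (forall x, I x -> {for x, continuous F}) -> (0 <= N)%R ->
  Ch_norm c d w f <= N%:E <-> (forall x, I x -> (`|F x| <= N * V x)%R).
Proof.
move=> fF Fc N0.
have val x : I x -> `|w x * primitive c f x%:E| = (`|F x| / V x)%:E.
  move=> Ix; have V0 := Vgt0 Ix.
  rewrite fF// vV// inver gt_eqF// -EFinM abse_EFin normrM mulrC.
  by rewrite (gtr0_norm (_ : 0 < (V x)^-1)%R) ?invr_gt0.
have valP x : I x -> (`|w x * primitive c f x%:E| <= N%:E) = (`|F x| <= N * V x)%R.
  by move=> Ix; rewrite val// lee_fin ler_pdivrMr// Vgt0.
split=> [/ess_supP FN x Ix|FN].
  have Vc : {for x, continuous V} by exact: prim_continuous lv' Ix.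
  pose phi y := (`|F y| - N * V y)%R.
  have phic : {for x, continuous phi}.
    apply: continuousB; first exact: (continuous_comp (Fc _ Ix) (@norm_continuous _ _ _)).
    by apply: continuousM => //; exact: cst_continuous.
  rewrite -subr_le0 -/(phi x).
  apply: (right_limit_ae_le Ix (cvg_at_right_filter phic)).
  apply: aeS ((ae_lebP _).1 FN) => y + Iy _; rewrite /= patchE mem_set//.
  by rewrite valP// /phi subr_le0.
apply/ess_supP; apply: aeW => x; rewrite /= patchE; case: ifPn => [/set_mem Ix|_].
  by rewrite valP// FN.
by rewrite abse0 lee_fin.
Qed.

Lemma lambda1_setT_gt0 : 0 < lam setT.
Proof.
have : (mu `[0%R, 1%R]%classic <= mu setT).
  by apply: le_measure; rewrite ?inE//; exact: measurable_itv.
rewrite /= lebesgue_measure_itv/= lte_fin ltr01 -EFinB subr0.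
by apply: lt_le_trans; rewrite lte_fin.
Qed.

Lemma Ch_norm_ge0 (f : R -> \bar R) : 0 <= Ch_norm c d w f.
Proof.
apply: ess_sup_gee; first exact: lambda1_setT_gt0.
by apply: aeW => x; exact: abse_ge0.
Qed.

Lemma Ch_repr (f : R -> \bar R) : I !=set0 -> Ch c d w f -> exists (f' : R -> R) (n : R),
  [/\ locint c d f', eq_ae I f (EFin \o f'), (0 <= n)%R, Ch_norm c d w f = n%:E &
      forall x, I x -> (`|prim c f' x| <= n * V x)%R].
Proof.
move=> I0 [Lf Nf]; have [f' [lf' ff' fF]] := L1loc_repr I0 Lf.
have Nfin : Ch_norm c d w f \is a fin_num by rewrite ge0_fin_numE// Ch_norm_ge0.
have n0 : (0 <= fine (Ch_norm c d w f))%R by rewrite fine_ge0// Ch_norm_ge0.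
exists f', (fine (Ch_norm c d w f)); split => //; first by rewrite fineK.
apply/(Ch_normP fF) => //; last by rewrite fineK.
by move=> x Ix; exact: prim_continuous lf' Ix.
Qed.

Lemma locint_Ch (f : R -> R) (n : R) : locint c d f -> (0 <= n)%R ->
  (forall x, I x -> (`|prim c f x| <= n * V x)%R) ->
  Ch c d w (EFin \o f) /\ Ch_norm c d w (EFin \o f) <= n%:E.
Proof.
move=> lf n0 fn; have [Lf fF] := locint_L1loc lf.
have Nn : Ch_norm c d w (EFin \o f) <= n%:E.
  apply/(Ch_normP fF) => // x Ix; exact: prim_continuous lf Ix.
by split => //; split => //; rewrite (le_lt_trans Nn)// ltry.
Qed.

Lemma pairing_repr (f g : R -> \bar R) (f' g' : R -> R) :
  L0 I f -> L0 I g -> eq_ae I f (EFin \o f') -> eq_ae I g (EFin \o g') ->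
  measurable_fun setT f' -> measurable_fun setT g' ->
  [/\ L0 I (fun x => f x * g x),
      \int[lam]_(x in I) (f x * g x) = \int[mu]_(x in I) (f' x * g' x)%:E &
      L1norm I (fun x => f x * g x) = \int[mu]_(x in I) `|f' x * g' x|%:E].
Proof.
move=> mf mg ff' gg' mf' mg'.
have mI : measurable (I : set R) by exact: measurable_oo.
have mfg : L0 I (fun x => f x * g x) by exact: emeasurable_funM.
have mfg' : measurable_fun setT (fun x => (f' x * g' x)%:E).
  by apply/measurable_EFinP; exact: measurable_funM.
have E : eq_ae I (fun x => f x * g x) (fun x => (f' x * g' x)%:E).
  by apply: aeS2 ff' gg' => x fx gx Ix; rewrite fx// gx.
split => //.
  exact: (integral_repr mI (@subset_refl _ I) mfg mfg' E).
exact: (L1norm_repr mI (@subset_refl _ I) mfg mfg' E).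
Qed.

Lemma weak_assoc_le (g : R -> \bar R) (g' : R -> R) (B : R) : I !=set0 ->
  (0 <= B)%R -> L0 I g -> measurable_fun setT g' -> eq_ae I g (EFin \o g') ->
  (forall (f : R -> R) (n : R), locint c d f -> (0 <= n)%R ->
    (forall x, I x -> (`|prim c f x| <= n * V x)%R) ->
    mu.-integrable I (EFin \o (fun x => f x * g' x)%R) /\
    (`|\int[mu]_(x in I) (f x * g' x)| <= n * B)%R) ->
  weak_assoc I (Ch c d w) (Ch_norm c d w) g /\
  weak_assoc_norm I (Ch c d w) (Ch_norm c d w) g <= B%:E.
Proof.
move=> I0 B0 mg mg' gg' H.
have mI : measurable (I : set (measurableTypeR R)) by exact: measurable_oo.
have le : weak_assoc_norm I (Ch c d w) (Ch_norm c d w) g <= B%:E.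
  apply: ge_ereal_sup => _ [f [Chf _] <-].
  have [f' [n [lf' ff' n0 -> fn]]] := Ch_repr I0 Chf.
  have [[mf _] _] := Chf.
  have [ifg fgB] := H _ _ lf' n0 fn.
  have [_ -> _] := pairing_repr mf mg ff' gg' lf'.1 mg'.
  rewrite -(fineK (integrable_fin_num mI ifg)) abse_EFin.
  have {}fgB : (`|fine (\int[mu]_(x in I) (f' x * g' x)%:E)| <= n * B)%R := fgB.
  have [nz|nz] := eqVneq n 0%R.
    move: fgB; rewrite nz mul0r normr_le0 => /eqP ->.
    by rewrite normr0 mul0e lee_fin.
  have {nz}n0 : (0 < n)%R by rewrite lt_neqAle eq_sym nz.
  by rewrite inver gt_eqF// -EFinM lee_fin ler_pdivrMr// mulrC.
split => //; split => //; last by rewrite (le_lt_trans le)// ltry.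
move=> f Chf; have [f' [n [lf' ff' n0 _ fn]]] := Ch_repr I0 Chf.
have [[mf _] _] := Chf.
have [ifg _] := H _ _ lf' n0 fn.
have [mfg _ fgE] := pairing_repr mf mg ff' gg' lf'.1 mg'.
by split => //; rewrite fgE; case/integrableP: ifg.
Qed.

(** [v] itself is an element of [Ch], of norm at most [1]: hence the
   integrability of [v g]. *)
Lemma weak_assoc_ge (g : R -> \bar R) : L1loc c d v -> I !=set0 ->
  weak_assoc I (Ch c d w) (Ch_norm c d w) g ->
  L1 I (fun x => v x * g x) /\ exists2 A : R,
    weak_assoc_norm I (Ch c d w) (Ch_norm c d w) g = A%:E &
    forall f : R -> R, locint c d f ->
      (forall x, I x -> (`|prim c f x| <= V x)%R) ->
      L1 I (fun x => (f x)%:E * g x) /\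
      `|\int[lam]_(x in I) ((f x)%:E * g x)| <= A%:E.
Proof.
move=> Lv [x0 Ix0] [mg Lg NA].
have Vc x : I x -> {for x, continuous V} by move=> Ix; exact: prim_continuous lv' Ix.
have v1 : Ch_norm c d w v <= 1%:E.
  by apply/(Ch_normP vV) => // x Ix; rewrite mul1r gtr0_norm// Vgt0.
have Chv : Ch c d w v by split => //; rewrite (le_lt_trans v1)// ltry.
have vn0 : ~ eq_ae I v (cst 0).
  move=> v0; have := vV Ix0; rewrite /primitive (ae_eq_integral (cst 0)).
  - by rewrite integral0 => -[V0]; have := Vgt0 Ix0; rewrite -V0 ltxx.
  - exact: measurable_oo_leb.
  - apply: measurable_funS (Lv.1); first exact: measurable_oo_leb.
    exact: sub_oo.
  - exact: measurable_cst.
  - by apply: aeS v0 => x + /(sub_oo Ix0).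
set W := weak_assoc_norm _ _ _ g in NA *.
have ub h : Ch c d w h -> ~ eq_ae I h (cst 0) ->
    `|\int[lam]_(x in I) (h x * g x)| / Ch_norm c d w h <= W.
  by move=> Chh h0; apply: ereal_sup_ubound; exists h.
have W0 : 0 <= W.
  by apply: le_trans (ub _ Chv vn0); rewrite mule_ge0// inve_ge0 Ch_norm_ge0.
have WE : W = (fine W)%:E by rewrite fineK// ge0_fin_numE.
split; first exact: Lg.
exists (fine W) => // f lf fV.
have [||Chf f1] := @locint_Ch f 1%R lf; [by []|by move=> x Ix; rewrite mul1r fV|].
split; first exact: (Lg _ Chf).
rewrite -WE; have [f0|f0] := pselect (eq_ae I (EFin \o f) (cst 0)).
  rewrite (ae_eq_integral (cst 0)) ?integral0 ?abse0//.
  - exact: measurable_oo_leb.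
  - by have [+ _] := Lg _ Chf.
  - by apply: aeS f0 => x fx Ix; have /= -> := fx Ix; rewrite mul0e.
have := ub _ Chf f0; set X := `|_|; have X0 : 0 <= X by exact: abse_ge0.
set n := Ch_norm _ _ _ _ in f1 *; have n0 : 0 <= n by exact: Ch_norm_ge0.
apply: le_trans; rewrite -{1}[X]mule1 lee_wpmul2l//.
by rewrite inve_ge1.
Qed.

End dual_pairing.

(** * Right limits of a representative of bounded variation *)

Section assembly.
Context {R : realType}.
Notation mu := (@lebesgue_measure R).
Notation lam := (@lambda1 R).

Lemma oo_nonempty (c d : \bar R) : (c < d)%E -> oo c d !=set0.
Proof.
case: c d => [c| |] [d| |]//; rewrite ?lte_fin => cd.
- by exists ((c + d) / 2); rewrite /oo/= !lte_fin !midf_lt.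
- by exists (c + 1); rewrite /oo/= lte_fin ltrDl ltr01 ltry.
- by exists (d - 1); rewrite /oo/= lte_fin gtrDl ltrN10 ltNyr.
- by exists 0; rewrite /oo/= ltNyr ltry.
Qed.

Variables c d : \bar R.
Notation I := (oo c d).

Lemma bpv_by_right_lim_fun (f r : R -> R) (L : R) : bpv_by I f L ->
  (forall x, I x -> f y @[y --> x^'+] --> r x) -> bpv_by I r L.
Proof.
move=> fL fr; apply: bpv_by_of_sum; last by move=> a b x; exact: oo_between.
move=> t n tm tI; have [tm' tI' tIh] := nat_mono_min n tm tI.
have shift x : I x -> f (x + h) @[h --> 0^'+] --> r x.
  move=> Ix; have /cvgrPdist_le fx := fr _ Ix.
  apply/cvgrPdist_le => e e0; have [del /= del0 fe] := fx _ e0.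
  near=> h; have h0 : 0 < h by near: h; exact: nbhs_right_gt.
  have hd : h < del by near: h; exact: nbhs_right_lt.
  apply: fe => /=; last by rewrite ltrDl.
  by rewrite distrC addrAC subrr add0r gtr0_norm.
have C : \sum_(i < n) `|f (t i.+1 + h) - f (t i + h)|
    @[h --> 0^'+] --> \sum_(i < n) `|r (t i.+1) - r (t i)|.
  apply: (cvg_sum_ord (F := fun i h => `|f (t i.+1 + h) - f (t i + h)|)
    (l := fun i => `|r (t i.+1) - r (t i)|)) => i.
  by apply: cvg_norm; apply: cvgB; exact: shift.
have S : closed [set x : R | x <= L] by exact: closed_le.
apply: (@closed_cvg _ _ _ _ _ _ S _ _ C).
have [b [_ bI _ /(_ _ (tI n))[k tb]]] := oo_exhaust_right (tI n).
have tb0 : 0 < b k - t n by rewrite subr_gt0.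
near=> h; have h0 : 0 <= h by near: h; exact: nbhs_right_ge.
have tnh : I (t n + h).
  apply: (oo_between (tI n) (bI k)); rewrite lerDl h0/= -lerBrDl.
  by near: h; exact: nbhs_right_le.
have mono : {homo (fun i => t (minn i n) + h) : i j / (i <= j)%N >-> i <= j}.
  by move=> i j ij; rewrite lerD2r tm'.
have := bpv_by_sum n fL mono (tIh _ h0 tnh).
apply: le_trans; rewrite le_eqVlt; apply/orP; left.
apply/eqP/eq_bigr => i _.
by rewrite (minn_idPl (ltn_ord i)) (minn_idPl (ltnW (ltn_ord i))).
Unshelve. all: by end_near. Qed.

Lemma stieltjesP (f : R -> R) : (exists nu, is_stieltjes I f nu) ->
  is_stieltjes I f (stieltjes I f).
Proof. by move=> H; rewrite /stieltjes; case: pselect => // H'; exact: svalP (cid H'). Qed.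

Section right_limits.
Variables (v' g' gt r : R -> R) (M b K : R).
Hypothesis lv' : locint c d v'.
Notation V := (prim c v').
Hypothesis Vgt0 : forall x, I x -> 0 < V x.
Hypothesis gM : forall x, `|g' x| <= M.
Hypothesis Ib : I b.
Hypothesis g0 : forall x, b <= x -> g' x = 0.
Hypothesis gtL : bpv_by I gt K.
Hypothesis gtE : \forall x \ae mu, I x -> gt x = V x * g' x.
Hypothesis gtr : forall x, I x -> gt y @[y --> x^'+] --> r x.

(** Almost everywhere on [I], both [gt] and [r] are continuous. *)
Lemma right_lims_ae :
  \forall x \ae mu, I x -> {for x, continuous r} /\ r x = V x * g' x.
Proof.
have rL := bpv_by_right_lim_fun gtL gtr.
have C := aeS2 (fun x H1 H2 => conj H1 H2) (bpv_by_continuous_ae gtL)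
  (bpv_by_continuous_ae rL).
apply: aeS2 C gtE => x [gc rc] E Ix; split; first exact: rc.
rewrite -E//; apply: (cvg_unique _ (gtr Ix)) => //.
exact: cvg_at_right_filter (gc Ix).
Qed.

Lemma right_lims_le x : I x -> `|r x| <= M * V x.
Proof.
move=> Ix; rewrite -subr_le0.
have C : `|gt y| - M * V y @[y --> x^'+] --> `|r x| - M * V x.
  apply: cvgB; first by apply: cvg_norm; exact: gtr.
  apply: cvgM; first exact: cvg_cst.
  exact: (cvg_at_right_filter (prim_continuous lv' Ix)).
apply: (right_limit_ae_le Ix C); apply: aeS gtE => y gy Iy _.
rewrite gy// normrM (gtr0_norm (Vgt0 Iy)) subr_le0 mulrC ler_wpM2r//.
exact/ltW/Vgt0.
Qed.

Lemma right_lims_vanish : r b = 0.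
Proof.
apply/eqP; rewrite -normr_le0.
have C : `|gt y| @[y --> b^'+] --> `|r b| by apply: cvg_norm; exact: gtr.
apply: (right_limit_ae_le Ib C); apply: aeS gtE => y gy Iy bly.
by rewrite gy// g0 ?(ltW bly)// mulr0 normr0.
Qed.

End right_limits.

Local Open Scope ereal_scope.

Lemma prim_locally_bounded_below (v' : R -> R) p q : locint c d v' ->
  (forall x, I x -> (0 < prim c v' x)%R) -> I p -> I q -> (p <= q)%R ->
  exists2 e : R, (0 < e)%R & forall x, (p <= x <= q)%R -> (e <= prim c v' x)%R.
Proof.
move=> lv' V0 Ip Iq pq; have [x + xm] := EVT_min pq (prim_within lv' Ip Iq).
rewrite in_itv/= => xpq; exists (prim c v' x); last first.
  by move=> y ypq; apply: xm; rewrite in_itv.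
by apply: V0; exact: (oo_between Ip Iq).
Qed.

(** The signs of [exists_signs] make a test function of every locally
   integrable [h >= 0] without changing [|h g|]. *)
Lemma weak_assoc_repr (v g : R -> \bar R) (v' : R -> R) :
  L1loc c d v -> locint c d v' -> I !=set0 ->
  (forall x, I x -> primitive c v x%:E = (prim c v' x)%:E) ->
  (forall x, I x -> (0 < prim c v' x)%R) ->
  let w := fun x : R => (primitive c v x%:E)^-1 in
  weak_assoc I (Ch c d w) (Ch_norm c d w) g ->
  exists (g' : R -> R) (M b : R), [/\ (0 <= M)%R /\ I b,
    measurable_fun setT g', forall x, (`|g' x| <= M)%R,
    forall x, (b <= x)%R -> g' x = 0%R & eq_ae I g (EFin \o g')].
Proof.
move=> Lv lv' I0 vV Vgt0 w gw; have mg : L0 I g by case: gw.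
have mI : measurable (I : set R) by exact: measurable_oo.
have [_ [A _ gA]] := weak_assoc_ge lv' vV Vgt0 Lv I0 gw.
have [g1 mg1 gg1] := leb_borel_repr mI mg.
have gint h : locint c d h -> (forall x, (0 <= h x)%R) ->
    \int[mu]_(x in I) ((h x)%:E * `|g1 x|) < +oo.
  move=> lh h0.
  have [S mS Sle] := exists_signs lh h0
    (fun p q Ip Iq pq => prim_locally_bounded_below lv' Vgt0 Ip Iq pq).
  have lS := locint_signed mS lh.
  have [[mSg SgL] _] := gA _ lS Sle.
  have E : eq_ae I (fun x => (signed S h x)%:E * g x)
      (fun x => (signed S h x)%:E * g1 x).
    by apply: aeS gg1 => x gx Ix; rewrite gx.
  have mS1 : measurable_fun setT (fun x => (signed S h x)%:E * g1 x).
    by apply: emeasurable_funM => //; apply/measurable_EFinP; case: lS.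
  move: SgL; rewrite (L1norm_repr mI (@subset_refl _ I) mSg mS1 E).
  under eq_integral do rewrite abseM abse_EFin normr_signed ger0_norm//.
  by [].
have [M M0 gM] := locint_dual_bounded mg1 gint.
have [b Ib gb] := locint_dual_vanish mg1 gint I0.
have [|||g' [mg' g'M g'0 gg']] := @bounded_repr _ c d g M b M0 mg.
- by apply: aeS2 ((ae_lebP _).2 gM) gg1 => x gx E Ix; rewrite E// gx.
- exact: Ib.
- have gb' := (ae_lebP (fun x => oo b%:E d x -> g1 x = 0)).2 gb.
  apply: aeS2 gb' gg1 => x gx E bx; rewrite E ?gx//.
  by move: bx => /andP[bx xd]; apply/andP; split => //; case/andP: Ib => cb _; exact: lt_trans bx.
by exists g', M, b.
Qed.

End assembly.

(** * The characterization of the weak dual *)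

Section characterization.
Context {R : realType}.
Notation mu := (@lebesgue_measure R).
Notation lam := (@lambda1 R).
Variables (c d : \bar R) (v g : R -> \bar R) (v' g' : R -> R) (M b : R).
Notation I := (oo c d).
Notation V := (prim c v').
Notation w := (fun x : R => (primitive c v x%:E)^-1)%E.
Notation W := (\int[mu]_(x in I) `|v' x * g' x|).
Hypothesis I0 : I !=set0.
Hypothesis Lv : L1loc c d v.
Hypothesis lv' : locint c d v'.
Hypothesis vv' : eq_ae I v (EFin \o v').
Hypothesis vV : forall x, I x -> primitive c v x%:E = (V x)%:E.
Hypothesis Vgt0 : forall x, I x -> 0 < V x.
Hypothesis mg : L0 I g.
Hypothesis mg' : measurable_fun setT g'.
Hypothesis g'M : forall x, `|g' x| <= M.
Hypothesis Ib : I b.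
Hypothesis g'0 : forall x, b <= x -> g' x = 0.
Hypothesis gg' : eq_ae I g (EFin \o g').

Let mI : measurable (I : set (measurableTypeR R)). Proof. exact: measurable_oo. Qed.

Lemma integrable_vg : L1 I (fun x => v x * g x)%E ->
  mu.-integrable I (EFin \o (fun x => v' x * g' x)).
Proof.
move=> [_]; have [mv' _] := lv'.
have [_ _ ->] := pairing_repr Lv.1 mg vv' gg' mv' mg' => vgoo.
apply/integrableP; split => //.
by apply/measurable_EFinP; apply: measurable_funTS; exact: measurable_funM.
Qed.

Lemma W_ge0 : 0 <= W. Proof. exact: Rintegral_ge0. Qed.

Lemma L1norm_vg : L1 I (fun x => v x * g x)%E ->
  L1norm I (fun x => v x * g x)%E = W%:E.
Proof.
move=> Lvg; have [mv' _] := lv'.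
have [_ _ ->] := pairing_repr Lv.1 mg vv' gg' mv' mg'.
have ivg := integrable_vg Lvg.
rewrite /Rintegral fineK//; apply: integrable_fin_num => //.
by apply: eq_integrable (integrable_abse ivg).
Qed.

Lemma weight_inv x : I x -> ((w x)^-1 = (V x)%:E)%E.
Proof.
move=> Ix; have V0 := Vgt0 Ix.
by rewrite vV// inver gt_eqF// inver invr_eq0 gt_eqF// invrK.
Qed.

Lemma BPV_repr_ae gt : BPV_repr I (fun x => (w x)^-1 * g x)%E gt <->
  (exists L, bpv_by I gt L) /\ \forall x \ae mu, I x -> gt x = V x * g' x.
Proof.
have E : eq_ae I (fun x => (w x)^-1 * g x)%E (fun x => (V x * g' x)%:E).
  by apply: aeS gg' => x gx Ix; rewrite weight_inv// gx.
split=> [[bpv gtE]|[bpv gtE]]; split => //.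
- apply/ae_lebP; apply: aeS2 E gtE => x Ex gx Ix.
  by apply/EFin_inj; rewrite -Ex// -gx.
- apply: aeS2 E ((ae_lebP _).2 gtE) => x Ex gx Ix.
  by rewrite Ex//= gx.
Qed.

Lemma weak_assoc_dual : weak_assoc I (Ch c d w) (Ch_norm c d w) g ->
  L1 I (fun x => v x * g x)%E /\ exists A : R,
  [/\ weak_assoc_norm I (Ch c d w) (Ch_norm c d w) g = A%:E,
      forall f : R -> R, locint c d f -> (forall x, I x -> `|prim c f x| <= V x) ->
        `|\int[mu]_(x in I) (f x * g' x)| <= A &
      forall h (t : nat -> R) n, 0 < h ->
        {homo t : i j / (i <= j)%N >-> i <= j} -> (forall i, I (t i)) ->
        (forall i, I (t i + h)) ->
        \sum_(i < n) `|average (fun x => V x * g' x) h (t i.+1) -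
                       average (fun x => V x * g' x) h (t i)| <= A + W].
Proof.
move=> gw; have [Lvg [A AE gA]] := weak_assoc_ge lv' vV Vgt0 Lv I0 gw.
have gA' f : locint c d f -> (forall x, I x -> `|prim c f x| <= V x) ->
    `|\int[mu]_(x in I) (f x * g' x)| <= A.
  move=> lf fV; have [[_ fgoo] fgA] := gA _ lf fV.
  have mf : L0 I (EFin \o f) by have [[]] := locint_L1loc lf.
  have ff : eq_ae I (EFin \o f) (EFin \o f) by apply: aeW.
  have [_ E1 E2] := pairing_repr mf mg ff gg' lf.1 mg'.
  have ifg : mu.-integrable I (EFin \o (fun x => f x * g' x)).
    apply/integrableP; split; last by rewrite -E2.
    apply/measurable_EFinP; apply: measurable_funTS; apply: measurable_funM => //.
    by case: lf.
  rewrite -lee_fin; apply: le_trans fgA; rewrite E1.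
  by rewrite -[in leRHS](fineK (integrable_fin_num mI ifg)).
split => //; exists A; split => //.
have ivg := integrable_vg Lvg.
by move=> h t n; exact: (average_variation lv' mg' g'M Vgt0 ivg gA').
Qed.

Lemma weak_assoc_BPV : weak_assoc I (Ch c d w) (Ch_norm c d w) g ->
  BPV_repr I (fun x => (w x)^-1 * g x)%E !=set0.
Proof.
move=> /weak_assoc_dual[_ [A [_ _ avg]]].
have iu a0 b0 : I a0 -> I b0 ->
    mu.-integrable `[a0, b0[ (EFin \o (fun x => V x * g' x)).
  by move=> Ia Ib0; exact: (integrable_primM_co lv' mg' g'M Ia Ib0).
have [gt gtL gtE] := exists_bpv_repr iu avg I0.
exists gt; apply/BPV_repr_ae; split => //; by exists (A + W).
Qed.

Section representative.
Variable gt : R -> R.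
Hypothesis gtP : BPV_repr I (fun x => (w x)^-1 * g x)%E gt.
Hypothesis Lvg : L1 I (fun x => v x * g x)%E.

(** The bound [L] is left free: any of them shows that [g] is in the dual,
   while the norm estimate uses the mass of the Stieltjes charge. *)
Lemma BPV_right_limits : exists r : R -> R,
  [/\ forall x, I x -> gt y @[y --> x^'+] --> r x,
      exists L, bpv_by I r L &
      forall L, bpv_by I r L ->
        weak_assoc I (Ch c d w) (Ch_norm c d w) g /\
        (weak_assoc_norm I (Ch c d w) (Ch_norm c d w) g <= (L + W)%:E)%E].
Proof.
have [[K gtL] gtE] := (BPV_repr_ae gt).1 gtP.
have [r gtr] : exists r : R -> R, forall x, I x -> gt y @[y --> x^'+] --> r x.
  by exists (fun x => lim (gt y @[y --> x^'+])) => x Ix; exact: bpv_by_right_lim gtL Ix.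
exists r; split => //; first by exists K; exact: bpv_by_right_lim_fun gtL gtr.
move=> L rL; have rg := right_lims_ae gtL gtE gtr.
have rM := right_lims_le lv' Vgt0 g'M gtE gtr.
have rb := right_lims_vanish Ib g'0 gtE gtr.
have ivg := integrable_vg Lvg.
have L_ge0 : 0 <= L.
  have := bpv_by_sum (t := fun=> b) 0%N rL _ _.
  by rewrite big_ord0; apply.
apply: (weak_assoc_le lv' vV Vgt0 I0 _ mg mg' gg').
  by rewrite addr_ge0// W_ge0.
move=> f n lf n0 fn.
exact: (dual_bound lv' Vgt0 mg' g'M Ib g'0 rg rM rb rL lf n0 fn ivg).
Qed.

(** [v] times the sign of [g] is a test function, since the modulus of its
   primitive is at most the primitive [V] of [|v| = v]. Hence the integral [W]
   of [|v g|] is at most [A], the variation of the right limits at most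
   [A + W <= 2 * A], and the mass of the charge at most [6 * A]. *)
Lemma norm_equivalence : (\forall x \ae lam, I x -> (0 < v x)%E) ->
  weak_assoc I (Ch c d w) (Ch_norm c d w) g ->
  let A := weak_assoc_norm I (Ch c d w) (Ch_norm c d w) g in
  let B := (L1norm I (fun x => v x * g x) + total_var (stieltjes I gt) I)%E in
  (A <= B /\ B <= 7%:E * A)%E.
Proof.
move=> v0 gw A0 B; have [_ [A [AE gA avg]]] := weak_assoc_dual gw.
have [r [gtr _ upper]] := BPV_right_limits.
have [_ gtE] := (BPV_repr_ae gt).1 gtP.
have iu a0 b0 : I a0 -> I b0 ->
    mu.-integrable `[a0, b0[ (EFin \o (fun x => V x * g' x)).
  by move=> Ia Ib0; exact: (integrable_primM_co lv' mg' g'M Ia Ib0).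
have rL : bpv_by I r (A + W) by exact: (bpv_by_right_lims iu avg gtE gtr).
have st : is_stieltjes I gt (stieltjes I gt).
  by apply: stieltjesP; exact: exists_is_stieltjes gtr rL I0.
have tvle := total_var_le gtr rL I0 st.
have tvr := bpv_by_total_var gtr st.
have tv0 : (0 <= total_var (stieltjes I gt) I)%E.
  rewrite /total_var; case: cid => P HP; case: cid => N nuPN; exact: measure_ge0.
have tvfin : total_var (stieltjes I gt) I \is a fin_num.
  by rewrite ge0_fin_numE// (le_lt_trans tvle)// ltry.
have v'0 : \forall x \ae mu, I x -> 0 < v' x.
  apply/ae_lebP; apply: aeS2 v0 vv' => x vx E Ix.
  by rewrite -lte_fin -[(v' x)%:E](E Ix) vx.
have WA : W <= A.
  pose S : set R := [set x | 0 <= g' x].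
  have mS : measurable S.
    rewrite (_ : S = g' @^-1` `[0, +oo[%classic).
      by rewrite -[X in measurable X]setTI; apply: mg' => //; exact: measurable_itv.
    by apply/seteqP; split => x; rewrite /S/= in_itv/= andbT.
  have lS := locint_signed mS lv'.
  have SV x : I x -> `|prim c (signed S v') x| <= V x.
    move=> Ix; apply: (le_trans (prim_le_abs lS Ix)).
    rewrite le_eqVlt; apply/orP; left; apply/eqP.
    rewrite /prim /Rintegral; congr fine; apply: ae_eq_integral.
    - exact: measurable_oo.
    - apply/measurable_EFinP; apply: measurable_funTS; apply: measurableT_comp => //.
      by case: lS.
    - by apply/measurable_EFinP; apply: measurable_funTS; case: lv'.
    - apply: aeS v'0 => y v'y /(sub_oo Ix) Iy /=.
      by rewrite normr_signed gtr0_norm// v'y.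
  apply: le_trans (gA _ lS SV); apply: le_trans (ler_norm _).
  rewrite le_eqVlt; apply/orP; left; apply/eqP.
  rewrite /Rintegral; congr fine; apply: ae_eq_integral => //.
  - apply/measurable_EFinP; apply: measurable_funTS; apply: measurableT_comp => //.
    by apply: measurable_funM => //; case: lv'.
  - apply/measurable_EFinP; apply: measurable_funTS.
    by apply: measurable_funM => //; case: lS.
  - apply: aeS v'0 => y v'y Iy /=; congr EFin.
    rewrite normrM gtr0_norm ?v'y// /signed; case: ifPn => [/set_mem|/negP nS].
      by move=> g0; rewrite ger0_norm.
    by rewrite ltr0_norm ?mulrN ?mulNr// ltNge; apply/negP => g0; apply: nS; exact/mem_set.
rewrite /A0 /B L1norm_vg// AE -(fineK tvfin); split.
  rewrite -EFinD addrC -AE.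
  by have [_] := upper _ tvr.
rewrite -EFinD -EFinM lee_fin.
have : fine (total_var (stieltjes I gt) I) <= 3 * (A + W).
  by rewrite -lee_fin fineK.
by move: WA; set X := fine _; set Y := W => H1 H2; lra.
Qed.

End representative.
End characterization.

Local Open Scope ereal_scope.

Theorem theorem3p5 (R : realType) :
  exists k1 k2 : R, (0 < k1)%R /\ (0 < k2)%R /\
  forall (c d : \bar R) (v g : R -> \bar R),
    c < d ->
    L1loc c d v ->
    primitive c v b @[b --> within [set b | b < d] (nbhs d)] --> +oo ->
    let I := oo c d in
    let w := fun x : R => (primitive c v x%:E)^-1 in
    (forall x, I x -> 0 < w x < +oo) ->
    L0 I g ->
    (weak_assoc I (Ch c d w) (Ch_norm c d w) g <->
      [/\ L1 I (fun x => v x * g x),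
          BPV_repr I (fun x => (w x)^-1 * g x) !=set0,
          Linf I g &
          exists2 b : R, I b & eq_ae (oo b%:E d) g (cst 0)])
    /\
    ((\forall x \ae @lambda1 R, I x -> 0 < v x) ->
      weak_assoc I (Ch c d w) (Ch_norm c d w) g ->
      forall gt : R -> R, BPV_repr I (fun x => (w x)^-1 * g x) gt ->
        let A := weak_assoc_norm I (Ch c d w) (Ch_norm c d w) g in
        let B := L1norm I (fun x => v x * g x) + total_var (stieltjes I gt) I in
        k1%:E * A <= B /\ B <= k2%:E * A).
Proof.
exists 1%R, 7%R; split => //; split => // c d v g cd Lv _ I w w01 mg.
have I0 : I !=set0 by exact: oo_nonempty.
have [v' [lv' vv' vV]] := L1loc_repr I0 Lv.
have Vgt0 x : I x -> (0 < prim c v' x)%R.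
  move=> Ix; have := w01 _ Ix; rewrite /w vV// inver.
  case: eqP => _; first by rewrite ltxx andbF.
  by rewrite lte_fin invr_gt0 => /andP[].
split; last first.
  move=> v0 gw gt gtP A B; rewrite mul1e.
  have [g' [M [b [[M0 Ib] mg' g'M g'0 gg']]]] := weak_assoc_repr Lv lv' I0 vV Vgt0 gw.
  have [Lvg _] := weak_assoc_dual I0 Lv lv' vv' vV Vgt0 mg mg' g'M gg' gw.
  exact: (norm_equivalence I0 Lv lv' vv' vV Vgt0 mg mg' g'M Ib g'0 gg' gtP Lvg v0 gw).
split=> [gw|[Lvg [gt gtP] [_ gLinf] [b Ib gb]]].
  have [g' [M [b [[M0 Ib] mg' g'M g'0 gg']]]] := weak_assoc_repr Lv lv' I0 vV Vgt0 gw.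
  have [Lvg _] := weak_assoc_dual I0 Lv lv' vv' vV Vgt0 mg mg' g'M gg' gw.
  split => //.
  - exact: (weak_assoc_BPV I0 Lv lv' vv' vV Vgt0 mg mg' g'M gg' gw).
  - split => //; apply: (@le_lt_trans _ _ M%:E); last by rewrite ltry.
    apply/ess_supP; apply: aeS gg' => x gx; rewrite /= patchE; case: ifPn => [/set_mem Ix|_].
      by rewrite gx//= lee_fin.
    by rewrite abse0 lee_fin.
  - exists b => //; have nb : \forall x \ae @lambda1 R, x <> b.
      apply/ae_lebP; exists [set b]; split => //; first exact: lebesgue_measure_set1.
      by move=> t /=; exact: contrapT.
    apply: aeS gg' => x gx /andP[bx xd]; rewrite gx /= ?g'0 ?ltW//.
    by apply/andP; split => //; case/andP: Ib => cb _; exact: lt_trans bx.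
have n0 : 0 <= Linfnorm I g.
  apply: ess_sup_gee; first exact: lambda1_setT_gt0.
  by apply: aeW => x; exact: abse_ge0.
have nfin : Linfnorm I g \is a fin_num by rewrite ge0_fin_numE.
have gM : \forall x \ae @lambda1 R, I x -> `|g x| <= (fine (Linfnorm I g))%:E.
  rewrite fineK//; apply: aeS (ess_sup_ge (@lambda1 R) (abse \o (g \_ I))) => x + Ix.
  by rewrite /= patchE mem_set.
have [g' [mg' g'M g'0 gg']] := bounded_repr (fine_ge0 n0) mg gM Ib gb.
have [r [_ [L rL] upper]] :=
  BPV_right_limits I0 Lv lv' vv' vV Vgt0 mg mg' g'M Ib g'0 gg' gtP Lvg.
by have [] := upper _ rL.
Qed.
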